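(* Let $(\mu_n)$ be an SI-martingale on $\mathbb{R}^d$ which either is of $(\mathcal{F},\tau,\zeta)$-cell type with $\mu_n\le C2^{\alpha n}$, or is of $(\mathcal{F},\alpha,\zeta)$-cutout type. Let $\Gamma$ be a bounded subset of $(\mathrm{Sim}_d^c)^m\times P_m$ whose elements consist of contracting similitudes with contraction ratios bounded uniformly away from $0$ and $1$, and such that for some $s>\alpha$, $$\eta_t(B(x,r))=O(r^s)\quad\text{for all }x\in\mathbb{R}^d,\ t\in\Gamma,\ 0<r<1.$$ Assume furthermore that for some $0<\gamma_1<s$, for all $0<\varepsilon<1$, all $(F,p)\in\Gamma$ and all $\Lambda\in\mathcal{F}$, the set $\partial\Lambda(\varepsilon)\cap E_F$ can be covered by $O(\varepsilon^{-\gamma_1})$ balls of radius $\varepsilon$ (with implicit constants uniform). Then there are a deterministic $\gamma>0$ and a finite random variable $K$ such that almost surely: (i) the sequence $Y_n^t:=\int\mu_n\,d\eta_t$ converges uniformly over $t\in\Gamma$; denote the limit by $Y^t$; (ii) $|Y^t-Y^u|\le K\,d(t,u)^\gamma$ for all $t,u\in\Gamma$.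
   Context: An SI-martingale on $\mathbb{R}^d$ is a sequence $(\mu_n)_{n\ge0}$ of random functions $\mu_n:\mathbb{R}^d\to[0,\infty)$ such that: (SI1) $\mu_0$ is deterministic, bounded, with bounded support; (SI2) $\mu_n$ is $\mathcal{B}_n$-measurable for an increasing filtration and $\mathbb{E}(\mu_{n+1}(x)\mid\mathcal{B}_n)=\mu_n(x)$; (SI3) $\mu_{n+1}\le C\mu_n$ pointwise; (SI4) for some $C$, for any $(C2^{-n})$-separated family of half-open dyadic cubes of side $2^{-(n+1)}$, the restrictions of $\mu_{n+1}$ to them are conditionally independent given $\mathcal{B}_n$. For a family $\mathcal{F}$ of Borel subsets of a fixed ball: $(\mu_n)$ is of $(\mathcal{F},\alpha,\zeta)$-cutout type if $\mu_n=2^{\alpha n}\mathbf{1}_{A_n}$, $A_n=\Omega\setminus\bigcup_{j=1}^{M_n}\Lambda^{(n)}_j$ with $\Omega\in\mathcal{F}$, random $\Lambda_j^{(n)}\in\mathcal{F}$, and a.s. $M_n\le C2^{\zeta n}$ for $n\ge N_0$ (random, a.s. finite); of $(\mathcal{F},\tau,\zeta)$-cell type if $\mu_n=\sum_{j=1}^{M_n}c_j^{(n)}\mathbf{1}[F_j^{(n)}]$, random $F_j^{(n)}\in\mathcal{F}$, $0\le c_j^{(n)}\le C2^{\tau n}$, and a.s. $M_n\le C2^{\zeta n}$ for $n\ge N_0$. $\mathrm{Sim}_d^c$ is the set of contracting similarities of $\mathbb{R}^d$. $\Sigma_m=\{1,\dots,m\}^{\mathbb{N}}$; for $F=(F_1,\dots,F_m)\in(\mathrm{Sim}^c_d)^m$,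 $\Pi_F:\Sigma_m\to\mathbb{R}^d$, $\Pi_F(i_1i_2\dots)=\lim_N F_{i_1}\circ\cdots\circ F_{i_N}(0)$, and $E_F=\Pi_F(\Sigma_m)$. $P_m$ is the set of probability vectors $(p_1,\dots,p_m)$ with all $p_i>0$. On $(\mathrm{Sim}^c_d)^m\times P_m$ the metric is $d((F,p),(G,q))=\sup_{\Sigma_m}|\Pi_F-\Pi_G|+\max_i|p_i-q_i|$. For $t=(F,p)$, $\eta_t=\Pi_F(p^{\infty})$, the self-similar measure (push-forward of the Bernoulli product measure). $E(\varepsilon)$ is the open $\varepsilon$-neighbourhood of $E$. *)

(* Defs.v *)
From HB Require Import structures.
From mathcomp Require Import all_boot all_order all_algebra.
From mathcomp Require Import all_classical all_reals all_analysis.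
Set Implicit Arguments. Unset Strict Implicit. Unset Printing Implicit Defensive.
Import Order.TTheory GRing.Theory Num.Theory.
Import numFieldNormedType.Exports.
Local Open Scope classical_set_scope.
Local Open Scope ring_scope.

Section Geometry.
Variables (R : realType) (d : nat).

Definition eucl (x : 'rV[R]_d) : R := Num.sqrt (\sum_i x ord0 i ^+ 2).

Definition eball (c : 'rV[R]_d) (r : R) : set 'rV[R]_d :=
  [set x | eucl (x - c) < r].

Definition nbhd_eps (E : set 'rV[R]_d) (eps : R) : set 'rV[R]_d :=
  [set x | exists2 y, E y & eucl (x - y) < eps].

Definition boundary (A : set 'rV[R]_d) : set 'rV[R]_d :=
  closure A `\` interior A.

Definition Rd := g_sigma_algebraType (@open 'rV[R]_d).

Definition dcube (n : nat) (k : 'I_d -> int) : set 'rV[R]_d :=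
  [set x | forall i, (k i)%:~R / 2 ^+ n.+1 <= x ord0 i
                     /\ x ord0 i < (k i + 1)%:~R / 2 ^+ n.+1].

Definition is_sim (r : R) (f : 'rV[R]_d -> 'rV[R]_d) : Prop :=
  0 < r /\ forall x y, eucl (f x - f y) = r * eucl (x - y).

End Geometry.

Section IFS.
Variables (R : realType) (d m : nat).

(* an m-tuple of maps of R^d together with a weight vector; elements of
   (Sim_d^c)^m x P_m are such pairs satisfying the appropriate predicates *)
Definition param := (('I_m -> 'rV[R]_d -> 'rV[R]_d) * ('I_m -> R))%type.

Fixpoint compw (F : 'I_m -> 'rV[R]_d -> 'rV[R]_d) (w : nat -> 'I_m) (N : nat)
  : 'rV[R]_d :=
  match N with
  | 0 => 0
  | N'.+1 => F (w 0%N) (compw F (fun k => w k.+1) N')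
  end.

Definition coding (F : 'I_m -> 'rV[R]_d -> 'rV[R]_d) (w : nat -> 'I_m)
  : 'rV[R]_d := limn (compw F w).

Definition attractor (F : 'I_m -> 'rV[R]_d -> 'rV[R]_d) : set 'rV[R]_d :=
  range (coding F).

Definition pdist (t u : param) : R :=
  sup [set eucl (coding t.1 w - coding u.1 w) | w in [set: nat -> 'I_m]]
  + \big[Num.max/0]_(i < m) `|t.2 i - u.2 i|.

Definition cyl (u : nat -> 'I_m) (n : nat) : set (nat -> 'I_m) :=
  [set w | forall k, (k < n)%N -> w k = u k].

(* eta is the self-similar measure eta_t: the push-forward under Pi_F of the
   Bernoulli product measure p^N on Sigma_m, i.e. the law of Pi_F(xi) where
   xi = (xi_0, xi_1, ...) is an i.i.d. sequence with law p. *)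
Definition selfsim_measure (t : param) (eta : {measure set (Rd R d) -> \bar R})
  : Prop :=
  exists (dS : measure_display) (S : measurableType dS)
         (beta : probability S R) (xi : S -> nat -> 'I_m),
    (forall u n, measurable (xi @^-1` cyl u n) /\
        beta (xi @^-1` cyl u n) = (\prod_(k < n) t.2 (u k))%:E) /\
    (forall A : set (Rd R d), measurable A ->
        eta A = beta (xi @^-1` (coding t.1 @^-1` A))).

End IFS.

Section Martingale.
Variables (R : realType) (d : nat) (dT : measure_display) (T : measurableType dT)
  (P : probability T R).

Definition sub_measurable (H : set (set T)) (Y : T -> R) : Prop :=
  forall A : set R, measurable A -> H (Y @^-1` A).

Definition cexp_version (H : set (set T)) (X Y : T -> R) : Prop :=
  [/\ sub_measurable H Y, P.-integrable setT (EFin \o X),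
      P.-integrable setT (EFin \o Y) &
      forall B, H B -> (\int[P]_(w in B) (X w)%:E = \int[P]_(w in B) (Y w)%:E)%E].

Definition cond_indep (H : set (set T)) (k : nat) (G : 'I_k -> set (set T))
  : Prop :=
  forall A : 'I_k -> set T, (forall i, G i (A i)) ->
    exists Y : 'I_k -> T -> R,
      (forall i, cexp_version H (\1_(A i)) (Y i)) /\
      cexp_version H (\1_(\bigcap_i A i)) (fun w => \prod_i Y i w).

Definition restr_sigma (mu : T -> 'rV[R]_d -> R) (Q : set 'rV[R]_d)
  : set (set T) :=
  <<s [set E | exists x (A : set R),
          [/\ Q x, measurable A & E = (fun w => mu w x) @^-1` A]] >>.

Definition filtration (B : nat -> set (set T)) : Prop :=
  forall n, [/\ sigma_algebra setT (B n), B n `<=` measurable & B n `<=` B n.+1].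

Definition SI_martingale (B : nat -> set (set T)) (mu : nat -> T -> 'rV[R]_d -> R)
  (C : R) : Prop :=
  [/\ filtration B /\ (forall n w x, 0 <= mu n w x),
      (exists f0 : 'rV[R]_d -> R,
         (forall w, mu 0%N w = f0) /\
         (exists M, forall x, f0 x <= M) /\
         (exists (c : 'rV[R]_d) (r : R), forall x, f0 x != 0 -> eball c r x)),
      (forall n x, sub_measurable (B n) (fun w => mu n w x) /\
         cexp_version (B n) (fun w => mu n.+1 w x) (fun w => mu n w x)),
      (forall n w x, mu n.+1 w x <= C * mu n w x) &
      (forall n k (Q : 'I_k -> 'I_d -> int),
         (forall i j, i != j -> forall x y, @dcube R d n (Q i) x ->
            @dcube R d n (Q j) y -> C / 2 ^+ n <= eucl (x - y)) ->
         cond_indep (B n) (fun i => restr_sigma (mu n.+1) (@dcube R d n (Q i))))].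

Definition borel_family_in_ball (Fam : set (set 'rV[R]_d)) : Prop :=
  exists (c : 'rV[R]_d) (r : R), forall L, Fam L ->
    measurable (L : set (Rd R d)) /\ L `<=` eball c r.

Definition cutout_type (mu : nat -> T -> 'rV[R]_d -> R)
  (Fam : set (set 'rV[R]_d)) (alpha zeta C : R) : Prop :=
  exists (Om0 : set 'rV[R]_d) (M : nat -> T -> nat)
         (Lam : nat -> T -> nat -> set 'rV[R]_d),
    [/\ Fam Om0,
        (forall n w j, (j < M n w)%N -> Fam (Lam n w j)),
        (forall n w x, mu n w x =
           2 `^ (alpha * n%:R) *
           \1_(Om0 `\` \bigcup_(j < M n w) Lam n w j) x) &
        {ae P, forall w, exists N0, forall n, (N0 <= n)%N ->
           (M n w)%:R <= C * 2 `^ (zeta * n%:R)}].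

Definition cell_type (mu : nat -> T -> 'rV[R]_d -> R)
  (Fam : set (set 'rV[R]_d)) (tau zeta C : R) : Prop :=
  exists (M : nat -> T -> nat) (Fs : nat -> T -> nat -> set 'rV[R]_d)
         (c : nat -> T -> nat -> R),
    [/\ (forall n w j, (j < M n w)%N ->
           Fam (Fs n w j) /\ 0 <= c n w j <= C * 2 `^ (tau * n%:R)),
        (forall n w x, mu n w x =
           \sum_(j < M n w) c n w j * \1_(Fs n w j) x) &
        {ae P, forall w, exists N0, forall n, (N0 <= n)%N ->
           (M n w)%:R <= C * 2 `^ (zeta * n%:R)}].

End Martingale.

(* Main.v *)
(**
The functions mu_n are not assumed jointly measurable, so Fubini is not
available.  Every integral against eta_t is replaced by a finite sum: the words v
of length N carry the mass p_v = p_(v 0) ... p_(v (N-1)) at the point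
F_(v 0) o ... o F_(v (N-1)) (0).  If the word sums of u are compared with eta_t,
the only words on which the indicator of a set L of Fam can change are those
whose points in E_F lie within eps of the boundary of L; by the covering
hypothesis and the Frostman bound they have mass O(eps^(s - gamma1)).  With N
proportional to n this gives an error O(2^-n), uniformly over pairs (t, u) with
d(t, u) <= beta^n.

For fixed u, split the cubes of side 2^-(n+1) into finitely many separated
classes.  In a class the masses Z_Q of mu_(n+1) are conditionally independent,
have conditional mean the mass W_Q of mu_n, and are at most
z = O(2^((alpha - s) n)).  Since exp(lam x) <= 1 + th x on [0, z], with
th = lam + 2 lam^2 z, the conditional expectation of exp(lam sum Z_Q) is at most
prod (1 + th W_Q) <= exp(th sum W_Q); this is a Chernoff bound for the increment
of the word sums, with a doubly exponentially small tail.  A similarity is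
determined by its values at 0, e_1, ..., e_d, so Gamma has a beta^n-net of
cardinality exponential in n, and Borel-Cantelli yields
|Y_(n+1) - Y_n| <= c x^n (1 + Y_n) for some x < 1, uniformly over Gamma.
This gives uniform convergence at rate x^n; comparing Y_n^t and Y_n^u at the scale
beta^n ~ d(t, u) gives the Hoelder bound.
*)

(* Three obstacles shape the argument. The tail bound is relative: its error contains Y_n itself,
   while the only a priori bound on Y_n is A^n with A = 2^alpha. Increments are therefore measured
   against 1 + Y_n, and a discrete Gronwall inequality yields boundedness along the path before any
   increment is known to be geometric. The gap alpha < s is spent through the number y > 1 with A
   y^4 = 2^s: cube masses are O(y^(-4n)), which leaves room for lam_n of order y^(2n) and a
   threshold y^n, so that the relative error, the absolute error and the exceptional probability
   exp(1 - y^n) all decay, the last one faster than any exponential net can grow. Moreover Y_n and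
   Y_(n+1) are compared with sums over the same words, so that the increment is one martingale step
   at fixed points. Finally, a supremum of quotients over an uncountable Gamma need not be
   measurable; K is built from word sums at the countably many net points and reaches all of Gamma
   by the continuity already known for that path. *)
Require Import Defs.
From HB Require Import structures.
From mathcomp Require Import all_boot all_order all_algebra.
From mathcomp Require Import all_classical all_reals all_analysis.
From mathcomp Require Import measurable_realfun ring lra.
Set Implicit Arguments. Unset Strict Implicit. Unset Printing Implicit Defensive.
Import Order.TTheory GRing.Theory Num.Theory.
Import numFieldNormedType.Exports.
Local Open Scope classical_set_scope.
Local Open Scope ring_scope.

(** * Euclidean geometry *)

Section EuclideanNorm.
Variables (R : realType) (d : nat).
Implicit Types x y z : 'rV[R]_d.

Definition dot x y : R := \sum_i x ord0 i * y ord0 i.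

Lemma dotC x y : dot x y = dot y x.
Proof. by apply: eq_bigr => i _; rewrite mulrC. Qed.

Lemma dotDl x y z : dot (x + y) z = dot x z + dot y z.
Proof. by rewrite /dot -big_split; apply: eq_bigr => i _; rewrite mxE mulrDl. Qed.

Lemma dotZl a x z : dot (a *: x) z = a * dot x z.
Proof. by rewrite /dot mulr_sumr; apply: eq_bigr => i _; rewrite mxE mulrA. Qed.

Lemma dotNl x z : dot (- x) z = - dot x z.
Proof. by rewrite -scaleN1r dotZl mulN1r. Qed.

Lemma dotBl x y z : dot (x - y) z = dot x z - dot y z.
Proof. by rewrite dotDl dotNl. Qed.

Lemma dotBr x y z : dot z (x - y) = dot z x - dot z y.
Proof. by rewrite dotC dotBl !(dotC z). Qed.

Lemma dot_suml I (r : seq I) (f : I -> 'rV[R]_d) z :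
  dot (\sum_(i <- r) f i) z = \sum_(i <- r) dot (f i) z.
Proof.
elim/big_rec2: _ => [|i a b _ <-]; last by rewrite dotDl.
by rewrite /dot big1 // => i _; rewrite mxE mul0r.
Qed.

Lemma dot_ge0 x : 0 <= dot x x.
Proof. by apply: sumr_ge0 => i _; rewrite -expr2 sqr_ge0. Qed.

Lemma euclE x : eucl x = Num.sqrt (dot x x).
Proof. by congr Num.sqrt; apply: eq_bigr => i _; rewrite expr2. Qed.

Lemma eucl_ge0 x : 0 <= eucl x.
Proof. exact: sqrtr_ge0. Qed.

Lemma eucl_sqr x : eucl x ^+ 2 = dot x x.
Proof. by rewrite euclE sqr_sqrtr // dot_ge0. Qed.

Lemma eucl_coord x i : `|x ord0 i| <= eucl x.
Proof.
rewrite -sqrtr_sqr; apply: ler_wsqrtr.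
by rewrite (bigD1 i) //= lerDl sumr_ge0 // => j _; rewrite sqr_ge0.
Qed.

Lemma eucl_eq0 x : eucl x = 0 -> x = 0.
Proof.
move=> x0; apply/rowP => i; rewrite mxE; apply/eqP; rewrite -normr_le0 -x0.
exact: eucl_coord.
Qed.

Lemma eucl0 : eucl (0 : 'rV[R]_d) = 0.
Proof. by rewrite /eucl big1 ?sqrtr0 // => i _; rewrite mxE expr0n. Qed.

Lemma euclN x : eucl (- x) = eucl x.
Proof. by congr Num.sqrt; apply: eq_bigr => i _; rewrite mxE sqrrN. Qed.

Lemma euclB x y : eucl (x - y) = eucl (y - x).
Proof. by rewrite -euclN opprB. Qed.

Lemma euclZ a x : eucl (a *: x) = `|a| * eucl x.
Proof.
rewrite !euclE dotZl dotC dotZl mulrA -expr2 sqrtrM ?sqr_ge0 //.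
by rewrite sqrtr_sqr.
Qed.

Lemma dot_le_eucl x y : dot x y <= eucl x * eucl y.
Proof.
have [->|x0] := eqVneq x 0.
  rewrite eucl0 mul0r; rewrite -(scale0r (0 : 'rV[R]_d)) dotZl mul0r //.
have [->|y0] := eqVneq y 0.
  rewrite eucl0 mulr0; rewrite -(scale0r (0 : 'rV[R]_d)) dotC dotZl mul0r //.
have ex : 0 < eucl x.
  by rewrite lt_def eucl_ge0 andbT; apply: contra_neq x0; exact: eucl_eq0.
have ey : 0 < eucl y.
  by rewrite lt_def eucl_ge0 andbT; apply: contra_neq y0; exact: eucl_eq0.
(* Expanding this square gives twice the product of the two norms times the gap in
   Cauchy-Schwarz. *)
have := dot_ge0 (eucl y *: x - eucl x *: y).
rewrite dotBl !dotBr !dotZl !(dotC _ (_ *: _)) !dotZl (dotC y x) -!eucl_sqr.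
set a := eucl x in ex *; set b := eucl y in ey *; set c := dot x y.
have -> : b * (b * a ^+ 2) - b * (a * c) - (a * (b * c) - a * (a * b ^+ 2))
   = (2 * (a * b)) * (a * b - c) by ring.
by rewrite pmulr_rge0 ?subr_ge0 // mulr_gt0 // mulr_gt0.
Qed.

Lemma eucl_triangle x y : eucl (x + y) <= eucl x + eucl y.
Proof.
rewrite -(@ler_pXn2r _ 2%N) ?nnegrE ?addr_ge0 ?eucl_ge0 //.
rewrite eucl_sqr dotDl !(dotC _ (x + y)) !dotDl -!eucl_sqr (dotC y x).
have := dot_le_eucl x y; nra.
Qed.

Lemma eucl_dist_triangle x y z : eucl (x - z) <= eucl (x - y) + eucl (y - z).
Proof. by have := eucl_triangle (x - y) (y - z); rewrite addrA subrK. Qed.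

Lemma eucl_sum I (r : seq I) (f : I -> 'rV[R]_d) :
  eucl (\sum_(i <- r) f i) <= \sum_(i <- r) eucl (f i).
Proof.
elim/big_rec2: _ => [|i a b _ h]; first by rewrite eucl0.
by apply: le_trans (eucl_triangle _ _) _; rewrite lerD2l.
Qed.

Lemma eucl_delta i : eucl (delta_mx ord0 i : 'rV[R]_d) = 1.
Proof.
rewrite /eucl (bigD1 i) //= big1 => [|j ji].
  by rewrite mxE !eqxx expr1n addr0 sqrtr1.
by rewrite mxE (negbTE ji) andbF expr0n.
Qed.

Lemma eucl_le_sum x : eucl x <= \sum_i `|x ord0 i|.
Proof.
rewrite {1}(row_sum_delta x); apply: le_trans (eucl_sum _ _) _.
by apply: ler_sum => i _; rewrite euclZ eucl_delta mulr1.
Qed.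

Lemma eucl_le_max x e : (forall i, `|x ord0 i| <= e) -> eucl x <= d%:R * e.
Proof.
move=> h; apply: le_trans (eucl_le_sum x) _.
by rewrite (le_trans (ler_sum _ (fun i _ => h i))) // sumr_const card_ord mulr_natl.
Qed.

(** The topology of row vectors comes from the maximum norm, comparable with [eucl] up to the factor
    [d]. Dividing by [d.+1] makes the last inequality strict and covers [d = 0]. *)
Lemma nbhs_euclP (x : 'rV[R]_d) (A : set 'rV[R]_d) :
  nbhs x A <-> exists2 e : R, 0 < e & eball x e `<=` A.
Proof.
split.
  move=> /nbhs_ballP[e /= e0 h]; exists e => // y; rewrite /eball /= => yx.
  apply: h; split=> // i j; rewrite /ball /= (ord1 i).
  apply: le_lt_trans yx; rewrite distrC.
  by apply: le_trans (eucl_coord _ j); rewrite !mxE.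
move=> [e e0 h]; apply/nbhs_ballP; exists (e / (d.+1)%:R); first by rewrite /= divr_gt0.
move=> y yx; apply: h; rewrite /eball /=.
have h i : `|(y - x) ord0 i| <= e / d.+1%:R.
  by have := yx.2 ord0 i; rewrite /ball /= distrC !mxE => /ltW.
apply: le_lt_trans (eucl_le_max h) _.
by rewrite mulrA ltr_pdivrMr // mulrC ltr_pM2l // ltr_nat.
Qed.

Lemma eball_open x (r : R) : open (eball x r : set 'rV[R]_d).
Proof.
rewrite openE => y yx; apply/nbhs_euclP; exists (r - eucl (y - x)).
  by rewrite subr_gt0.
move=> z; rewrite /eball /= => zy.
by have := eucl_dist_triangle z y x; lra.
Qed.

Lemma measurable_eball x (r : R) : measurable (eball x r : set (Rd R d)).
Proof. by apply: sub_sigma_algebra; exact: eball_open. Qed.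

(* t is the supremum of the parameters at which the segment is in L. *)
Lemma segment_meets_boundary (L : set 'rV[R]_d) x y : L x -> ~ L y ->
  exists2 z, boundary L z & exists2 t, 0 <= t <= 1 & z = x + t *: (y - x).
Proof.
move=> Lx Ly; pose g (t : R) : 'rV[R]_d := x + t *: (y - x).
have g1 : g 1 = y by rewrite /g scale1r addrC subrK.
have g0 : g 0 = x by rewrite /g scale0r addr0.
have gB t u : eucl (g t - g u) = `|t - u| * eucl (y - x).
  by rewrite /g opprD addrACA subrr add0r -scalerBl euclZ.
pose A := [set t : R | 0 <= t <= 1 /\ L (g t)].
have A0 : A 0 by split; rewrite ?lexx ?ler01 ?g0.
have Aub : ubound A 1 by move=> t [/andP[]].
have hsA : has_sup A by split; [exists 0|exists 1].
pose t0 := sup A.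
have hub : has_ubound A by exists 1.
have t0ge0 : 0 <= t0 by exact: ub_le_sup.
have t0le1 : t0 <= 1 by apply: ge_sup; [exists 0|exact: Aub].
have l0 := eucl_ge0 (y - x).
exists (g t0); last by exists t0; rewrite ?t0ge0.
have hdiv e : 0 < e -> 0 < e / (1 + eucl (y - x)).
  by move=> e0; rewrite divr_gt0 // ltr_pwDl.
have hlt e t : 0 < e -> `|t - t0| < e / (1 + eucl (y - x)) ->
    eucl (g t - g t0) < e.
  move=> e0; rewrite ltr_pdivlMr ?ltr_pwDl // gB => h.
  by apply: le_lt_trans h; rewrite ler_wpM2l // lerDr.
split.
  move=> U /nbhs_euclP[e e0 hU].
  have [t At tt0] := sup_adherent (hdiv _ e0) hsA.
  exists (g t); split; first by case: At.
  apply: hU; apply: hlt => //; rewrite distrC ger0_norm; last first.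
    by rewrite subr_ge0 ub_le_sup.
  by rewrite ltrBlDr -ltrBlDl.
move=> /nbhs_euclP[e e0 hU].
have Lt0 : L (g t0) by apply: hU; rewrite /eball /= subrr eucl0.
have t0lt1 : t0 < 1.
  by rewrite lt_neqAle t0le1 andbT; apply/eqP => t01; apply: Ly; rewrite -g1 -t01.
pose h := Num.min (1 - t0) (e / (1 + eucl (y - x)) / 2).
have h0 : 0 < h by rewrite lt_min subr_gt0 t0lt1 divr_gt0 // hdiv.
have : A (t0 + h).
  split.
    rewrite addr_ge0 ?(ltW h0) //=.
    have : h <= 1 - t0 by rewrite ge_min lexx.
    by lra.
  apply: hU; apply: hlt => //; rewrite addrAC subrr add0r gtr0_norm //.
  have : h <= e / (1 + eucl (y - x)) / 2 by rewrite ge_min lexx orbT.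
  by have := hdiv _ e0; lra.
move=> /(ub_le_sup hub); rewrite -/t0.
by lra.
Qed.

(** The segment between the two points crosses the boundary. With x in the attractor and y an
    approximation of it, this puts x in a [nbhd_eps] of the boundary, the set that the covering
    hypothesis controls. *)
Lemma boundary_between (L : set 'rV[R]_d) x y : \1_L x != \1_L y :> R ->
  exists2 z, boundary L z & eucl (x - z) <= eucl (x - y).
Proof.
rewrite !indicE; case: (boolP (x \in L)); case: (boolP (y \in L)); rewrite ?eqxx //.
- move=> /negP yL /set_mem xL _.
  have [|z bz [t /andP[t0 t1] zE]] := @segment_meets_boundary L x y xL.
    by move=> Ly; apply: yL; exact: mem_set.
  exists z => //; rewrite zE.
  rewrite opprD addrA subrr add0r euclN euclZ ger0_norm // euclB.
  by rewrite ler_piMl // eucl_ge0.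
- move=> /set_mem yL /negP xL _.
  have [|z bz [t /andP[t0 t1] zE]] := @segment_meets_boundary L y x yL.
    by move=> Lx; apply: xL; exact: mem_set.
  exists z => //; rewrite zE.
  have -> : x - (y + t *: (x - y)) = (1 - t) *: (x - y).
    by rewrite scalerBl scale1r opprD addrA.
  by rewrite euclZ ger0_norm ?subr_ge0 // ler_piMl ?eucl_ge0 // gerBl.
Qed.

End EuclideanNorm.

(** * Similarities, coding maps and the parameter metric *)

Section Similarities.
Variables (R : realType) (d : nat).
Implicit Types (x y : 'rV[R]_d) (f g : 'rV[R]_d -> 'rV[R]_d).

(** Polarization: inner products are combinations of squared distances, all of which scale by
    [r ^+ 2]. *)
Lemma dot_sim r f x y : is_sim r f ->
  dot (f x - f 0) (f y - f 0) = r ^+ 2 * dot x y.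
Proof.
move=> [_ fr].
have nrm u v : dot (f u - f v) (f u - f v) = r ^+ 2 * dot (u - v) (u - v).
  by rewrite -!eucl_sqr fr exprMn.
have pol (u v : 'rV[R]_d) : dot (u - v) (u - v) = dot u u + dot v v - 2 * dot u v.
  by rewrite dotBl !dotBr (dotC v u); ring.
have := nrm x y; have := nrm x 0; have := nrm y 0.
have -> : f x - f y = (f x - f 0) - (f y - f 0).
  by rewrite opprB addrA subrK.
by rewrite !subr0 (pol (f x - f 0)) (pol x) => -> -> ; lra.
Qed.

(* h = f x - f 0 - sum_j x_j (f e_j - f 0) is orthogonal to every f y - f 0,
   hence to itself. *)
Lemma sim_affine r f x : is_sim r f ->
  f x = f 0 + \sum_j x ord0 j *: (f (delta_mx ord0 j) - f 0).
Proof.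
move=> fr; pose h := (f x - f 0) - \sum_j x ord0 j *: (f (delta_mx ord0 j) - f 0).
have hy y : dot h (f y - f 0) = 0.
  rewrite dotBl dot_suml (dot_sim _ _ fr).
  under eq_bigr => j _ do rewrite dotZl (dot_sim _ _ fr) mulrCA -dotZl.
  by rewrite -mulr_sumr -dot_suml -row_sum_delta subrr.
have : dot h h = 0.
  rewrite {2}/h dotBr hy dotC dot_suml big1 ?subr0 // => j _.
  by rewrite dotZl dotC hy mulr0.
rewrite -eucl_sqr => /eqP; rewrite sqrf_eq0 => /eqP /eucl_eq0 /eqP.
by rewrite subr_eq0 subr_eq addrC => /eqP.
Qed.

(** By [sim_affine] the difference is that at 0 plus d terms, each a coordinate of x, at most A,
    times a difference of increments from 0, at most 2 e. *)
Lemma sim_perturb r1 r2 f g x e A : is_sim r1 f -> is_sim r2 g ->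
  eucl (f 0 - g 0) <= e ->
  (forall j, eucl (f (delta_mx ord0 j) - g (delta_mx ord0 j)) <= e) ->
  eucl x <= A -> eucl (f x - g x) <= e * (1 + 2 * d%:R * A).
Proof.
move=> fr gr h0 hj xA; have A0 : 0 <= A by exact: le_trans (eucl_ge0 _) xA.
rewrite (sim_affine x fr) (sim_affine x gr).
have e0 : 0 <= e by exact: le_trans (eucl_ge0 _) h0.
rewrite opprD addrACA -sumrB.
apply: le_trans (eucl_triangle _ _) _; rewrite mulrDr mulr1 lerD //.
apply: le_trans (eucl_sum _ _) _.
apply: (@le_trans _ _ (\sum_(j < d) A * (2 * e))); last first.
  by rewrite sumr_const card_ord -mulr_natl; lra.
apply: ler_sum => j _; rewrite -scalerBr euclZ ler_pM ?eucl_ge0 //.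
  exact: le_trans (eucl_coord x j) xA.
rewrite opprD opprK addrACA; apply: le_trans (eucl_triangle _ _) _.
by have := hj j; rewrite (addrC (- f 0)) euclB in h0 *; lra.
Qed.

End Similarities.

(** * Convergence, shift identity and perturbation of the coding map *)

Section Coding.
Variables (R : realType) (d m : nat) (b : R).
Hypotheses (b_ge0 : 0 <= b) (b_lt1 : b < 1).

Definition contractions (F : 'I_m -> 'rV[R]_d -> 'rV[R]_d) :=
  forall i x y, eucl (F i x - F i y) <= b * eucl (x - y).

Definition coding_bound (A : R) (F : 'I_m -> 'rV[R]_d -> 'rV[R]_d) :=
  forall w, eucl (coding F w) <= A.

Lemma cvg_euclP (u : nat -> 'rV[R]_d) (l : 'rV[R]_d) : u @ \oo --> l ->
  forall e : R, 0 < e -> exists N, forall n, (N <= n)%N -> eucl (u n - l) < e.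
Proof.
move=> ul e e0.
have [|N _ hN] := ul (eball l e); first by apply/nbhs_euclP; exists e.
by exists N => n /hN.
Qed.

Variable F : 'I_m -> 'rV[R]_d -> 'rV[R]_d.
Hypothesis Fb : contractions F.

(** The radius A0 / (1 - b) is the fixed point of r -> A0 + b r, so every map of the system
    preserves the ball of this radius. *)
Lemma compw_bound : exists2 A : R, 0 <= A & forall w N, eucl (compw F w N) <= A.
Proof.
pose A0 := \sum_i eucl (F i 0).
have A0ge0 : 0 <= A0 by apply: sumr_ge0 => i _; exact: eucl_ge0.
have A1 : 0 <= A0 / (1 - b) by rewrite divr_ge0 // subr_ge0 ltW.
exists (A0 / (1 - b)) => // w N; elim: N w => [|N IH] w /=; first by rewrite eucl0.
have -> : A0 / (1 - b) = A0 + b * (A0 / (1 - b)).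
  by field; rewrite subr_eq0 gt_eqF.
rewrite -[X in eucl X](subrK (F (w 0) 0)) addrC.
apply: le_trans (eucl_triangle _ _) _; apply: lerD.
  by rewrite /A0 (bigD1 (w 0)) //= lerDl sumr_ge0 // => i _; exact: eucl_ge0.
apply: le_trans (Fb _ _ _) _.
by rewrite subr0 ler_wpM2l // IH.
Qed.

(** [coding] is a bare [limn], which says nothing before convergence is known. Prefixes of length N
    and N + k are images of two points of a bounded set under the same N contractions, hence the
    Cauchy property. *)
Lemma cvg_coding w : compw F w @ \oo --> coding F w.
Proof.
have [A A0 hA] := compw_bound.
have close : forall N k w, eucl (compw F w (N + k) - compw F w N) <= b ^+ N * A.
  elim=> [|N IH] k v; first by rewrite subr0 add0n mul1r hA.
  rewrite addSn /=; apply: le_trans (Fb _ _ _) _.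
  by rewrite exprS -mulrA ler_wpM2l.
suff /cauchy_cvg : cauchy (compw F w @ \oo) by [].
apply: cauchy_exP => e e0.
have [N hN] : exists N, b ^+ N * A < e.
  have : (b ^+ n * A) @[n --> \oo] --> (0 * A).
    by apply: cvgMl; apply: cvg_expr; rewrite ger0_norm.
  rewrite mul0r => /cvgrPdist_lt /(_ e e0) [N _ hN].
  exists N; have := hN N (leqnn N).
  by rewrite /= sub0r normrN ger0_norm // mulr_ge0 // exprn_ge0.
exists (compw F w N); exists N => // n /= Nn.
split=> // i j; rewrite /ball /= distrC (ord1 i).
apply: le_lt_trans hN; rewrite -(subnKC Nn).
by apply: le_trans (close N (n - N)%N w); apply: le_trans (eucl_coord _ j); rewrite !mxE.
Qed.

Lemma compw_near w (e : R) : 0 < e -> exists N, forall n, (N <= n)%N ->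
  eucl (compw F w n - coding F w) < e.
Proof. exact: cvg_euclP (@cvg_coding w) e. Qed.

Lemma coding_boundP : exists A, coding_bound A F.
Proof.
have [A A0 hA] := compw_bound.
exists A => w; apply/ler_addgt0Pr => e e0.
have [N hN] := compw_near w e0.
have := eucl_triangle (compw F w N) (coding F w - compw F w N).
by rewrite addrC subrK euclB; have := hN _ (leqnn N); have := hA w N; lra.
Qed.

Lemma coding_shift w : coding F w = F (w 0) (coding F (fun k => w k.+1)).
Proof.
apply/eqP; rewrite -subr_eq0; apply/eqP/eucl_eq0/eqP.
rewrite eq_le eucl_ge0 andbT; apply/ler_addgt0Pl => e e0; rewrite addr0.
have e20 : 0 < e / 2 by rewrite divr_gt0.
have [N hN] := compw_near w e20.
have [M hM] := compw_near (fun k => w k.+1) e20.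
have := hN _ (leqW (leq_maxl N M)); have := hM _ (leq_maxr N M).
rewrite /=; set K := maxn N M => h1 h2.
have := eucl_dist_triangle (coding F w) (F (w 0) (compw F (fun k => w k.+1) K))
  (F (w 0) (coding F (fun k => w k.+1))).
have := Fb (w 0) (compw F (fun k => w k.+1) K) (coding F (fun k => w k.+1)).
rewrite (euclB (coding F w) (F (w 0) (compw F (fun k => w k.+1) K))).
have : b * eucl (compw F (fun k => w k.+1) K - coding F (fun k => w k.+1)) <=
       eucl (compw F (fun k => w k.+1) K - coding F (fun k => w k.+1)).
  by rewrite ler_piMl ?eucl_ge0 // ltW.
by lra.
Qed.

Lemma coding_compw A w N : coding_bound A F ->
  eucl (coding F w - compw F w N) <= b ^+ N * A.
Proof.
move=> hA; elim: N w => [|N IH] w; first by rewrite subr0 mul1r.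
rewrite coding_shift; apply: le_trans (Fb _ _ _) _.
by rewrite exprS -mulrA ler_wpM2l.
Qed.

(** Read off at the constant word i. It converts a bound on codings, the only one that the parameter
    metric gives, into a bound on the maps. *)
Lemma coding_bound_fix0 A i : coding_bound A F -> eucl (F i 0) <= 2 * A.
Proof.
move=> hA; have := hA (fun=> i); have := coding_compw (fun=> i) 1 hA => /= h1 h2.
have A0 : 0 <= A by exact: le_trans (eucl_ge0 _) h2.
have := eucl_triangle (coding F (fun=> i)) (F i 0 - coding F (fun=> i)).
rewrite addrC subrK euclB.
have : b ^+ 1 * A <= A by rewrite expr1 ler_piMl // ltW.
by lra.
Qed.

(** The errors sum geometrically to e / (1 - b). At each letter F and G are compared at a coding of
    F, so their closeness is required only on the ball of radius A. *)
Lemma coding_perturb A e (G : 'I_m -> 'rV[R]_d -> 'rV[R]_d) w :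
  contractions G -> coding_bound A F ->
  (forall i x, eucl x <= A -> eucl (F i x - G i x) <= e) ->
  forall N, eucl (coding F w - compw G w N) <= e / (1 - b) + b ^+ N * A.
Proof.
move=> Gb hA FG N.
have e0 : 0 <= e.
  exact: le_trans (eucl_ge0 _) (FG (w 0) (coding F w) (hA w)).
have b1 : 0 < 1 - b by rewrite subr_gt0.
elim: N w => [|N IH] w.
  by rewrite subr0 mul1r ler_wpDl // divr_ge0 // ltW.
rewrite coding_shift /=.
apply: le_trans (eucl_dist_triangle _ (G (w 0) (coding F (fun k => w k.+1))) _) _.
have -> : e / (1 - b) + b ^+ N.+1 * A = e + b * (e / (1 - b) + b ^+ N * A).
  by rewrite exprS; field; rewrite gt_eqF.
rewrite lerD ?FG //; apply: le_trans (Gb _ _ _) _.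
by rewrite ler_wpM2l.
Qed.

Lemma compw_eq (w w' : nat -> 'I_m) N :
  (forall k, (k < N)%N -> w k = w' k) -> compw F w N = compw F w' N.
Proof.
elim: N w w' => //= N IH w w' h; rewrite h //; congr (F _ _).
by apply: IH => k kN; apply: h.
Qed.

End Coding.

Lemma sup_ge0 (R : realType) (S : set R) : (forall x, S x -> 0 <= x) -> 0 <= sup S.
Proof.
move=> h; have [hs|/sup_out -> //] := pselect (has_sup S).
have [[x Sx] ub] := hs.
by apply: le_trans (h _ Sx) _; exact: ub_le_sup.
Qed.

Section ParameterDistance.
Variables (R : realType) (d m : nat).
Implicit Types t u v : param R d m.

Local Notation bounded t := (exists A, coding_bound A t.1).

(** [sup] of an unbounded set is 0 by convention, so boundedness of the codings is what makes
    [pdist] dominate their distance. *)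
Lemma pdist_coding t u w : bounded t -> bounded u ->
  eucl (coding t.1 w - coding u.1 w) <= pdist t u.
Proof.
move=> [At hAt] [Au hAu].
have h : eucl (coding t.1 w - coding u.1 w) <=
    sup [set eucl (coding t.1 w - coding u.1 w) | w in [set: nat -> 'I_m]].
  apply: ub_le_sup; last by exists w.
  exists (At + Au) => _ [v _ <-]; apply: le_trans (eucl_triangle _ _) _.
  by rewrite euclN lerD.
rewrite /pdist; apply: le_trans h _; rewrite lerDl.
by apply: bigmax_ge_id.
Qed.

Lemma pdist_weight t u i : `|t.2 i - u.2 i| <= pdist t u.
Proof.
rewrite /pdist; apply: (@le_trans _ _ (\big[Num.max/0]_(i < m) `|t.2 i - u.2 i|)).
  exact: (le_bigmax _ (fun i => `|t.2 i - u.2 i|)).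
rewrite lerDr; apply: sup_ge0 => x [w _ <-]; exact: eucl_ge0.
Qed.

Lemma pdist_ge0 t u : 0 <= pdist t u.
Proof.
rewrite /pdist addr_ge0 ?bigmax_ge_id //.
by apply: sup_ge0 => x [w _ <-]; exact: eucl_ge0.
Qed.

Lemma pdist_le t u e1 e2 : 0 <= e1 -> 0 <= e2 ->
  (forall w, eucl (coding t.1 w - coding u.1 w) <= e1) ->
  (forall i, `|t.2 i - u.2 i| <= e2) -> pdist t u <= e1 + e2.
Proof.
move=> e10 e20 h1 h2; apply: lerD; last by apply/bigmax_leP.
(* For [m = 0] there are no words and the supremum is that of the empty set, 0. *)
have [->|/set0P ne] := eqVneq [set eucl (coding t.1 w - coding u.1 w)
    | w in [set: nat -> 'I_m]] set0; first by rewrite sup0.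
by apply: ge_sup => // _ [w _ <-].
Qed.

Lemma pdistC t u : pdist t u = pdist u t.
Proof.
rewrite /pdist; under eq_bigr => i _ do rewrite distrC.
under eq_imagel => w _ do rewrite euclB.
by [].
Qed.

(** Coding part and weight part are each bounded by the full right-hand sum, whence the factor 2; it
    only affects constants later. *)
Lemma pdist_triangle t u v : bounded t -> bounded u -> bounded v ->
  pdist t v <= 2 * (pdist t u + pdist u v).
Proof.
move=> bt bu bv; rewrite mulrDl mul1r.
have h0 : 0 <= pdist t u + pdist u v.
  by have := pdist_ge0 t u; have := pdist_ge0 u v; lra.
apply: pdist_le => // [w|i].
  apply: le_trans (eucl_dist_triangle _ (coding u.1 w) _) _.
  by apply: lerD; apply: pdist_coding.
by apply: le_trans (ler_distD (u.2 i) _ _) _; apply: lerD; apply: pdist_weight.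
Qed.

End ParameterDistance.

(** Coordinates are rounded to a grid of mesh e, and each occupied cell is represented by one of its
    own elements. The representatives lie in [Gam], because all later estimates hold only there. *)
Lemma finite_net (R : realType) (T : Type) (Gam : set T) (J : finType)
  (f : T -> J -> R) (A e : R) : 0 <= A -> 0 < e ->
  (forall t j, Gam t -> `|f t j| <= A) ->
  exists (n : nat) (rep : 'I_n -> T),
   [/\ n%:R <= (2 * A / e + 1) ^+ #|J|,
       (forall i, Gam (rep i)) &
       forall t, Gam t -> exists i, forall j, `|f t j - f (rep i) j| <= e].
Proof.
move=> A0 e0 fA.
have Ae0 : 0 <= 2 * A / e by rewrite divr_ge0 ?mulr_ge0 // ltW.
have [[t0 Gt0]|noG] := pselect (exists t, Gam t); last first.
  have rep0 (i : 'I_0) : T by case: i.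
  exists 0%N, rep0; split.
  - by rewrite exprn_ge0 // addr_ge0.
  - by case.
  - by move=> t Gt; case: noG; exists t.
pose K := (Num.truncn (2 * A / e)).+1.
pose q (x : R) := Num.truncn ((x + A) / e).
pose code t : {ffun J -> 'I_K} := [ffun j => inord (q (f t j))].
have /choice[rep hrep] : forall i : 'I_#|{ffun J -> 'I_K}|, exists u, Gam u /\
    ((exists2 t, Gam t & code t = enum_val i) -> code u = enum_val i).
  move=> i; have [[t Gt ti]|no] := pselect (exists2 t, Gam t & code t = enum_val i).
    by exists t.
  by exists t0; split => // h; case: no.
exists #|{ffun J -> 'I_K}|, rep; split.
- rewrite card_ffun card_ord natrX lerXn2r ?nnegrE ?addr_ge0 //.
  by rewrite /K -natr1 lerD2r truncn_le.
- by move=> i; case: (hrep i).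
move=> t Gt; exists (enum_rank (code t)) => j.
have : Gam (rep (enum_rank (code t))) /\ code (rep (enum_rank (code t))) = code t.
  have [h1 h2] := hrep (enum_rank (code t)); split=> //.
  by rewrite enum_rankK in h2; apply: h2; exists t.
move: (rep _) => u [Gu /ffunP /(_ j)]; rewrite !ffunE => /(congr1 val) /=.
have qK v : Gam v -> (q (f v j) < K)%N.
  move=> Gv; rewrite /K ltnS; apply: le_truncn.
  rewrite ler_wpM2r ?invr_ge0 ?(ltW e0) //.
  by have := fA v j Gv; rewrite ler_norml => /andP[_]; lra.
rewrite !inordK ?qK // /q => h.
have p v : Gam v -> 0 <= (f v j + A) / e.
  move=> Gv; rewrite divr_ge0 ?(ltW e0) //.
  by have := fA v j Gv; rewrite ler_norml => /andP[]; lra.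
have := truncn_itv (p _ Gt); have := truncn_itv (p _ Gu); rewrite h.
move=> /andP[h1 h2] /andP[h3 h4].
have : `|(f t j + A) / e - (f u j + A) / e| <= 1.
  by rewrite -natr1 in h2 h4; rewrite ler_norml; apply/andP; split; lra.
rewrite -mulrBl normrM normfV (gtr0_norm e0) ler_pdivrMr // mul1r.
by rewrite opprD addrACA subrr addr0.
Qed.

Section ParameterNet.
Variables (R : realType) (d m : nat) (b A : R).
Hypotheses (b_ge0 : 0 <= b) (b_lt1 : b < 1) (A_ge0 : 0 <= A).
Variable Gam : set (param R d m).
Hypothesis Gsim : forall t, Gam t -> forall i, exists2 r, r <= b & is_sim r (t.1 i).
Hypothesis Gcod : forall t, Gam t -> coding_bound A t.1.
Hypothesis Gweight : forall t i, Gam t -> `|t.2 i| <= 1.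

Lemma Gam_contractions t : Gam t -> contractions b t.1.
Proof.
move=> Gt i x y; have [r rb [r0 ->]] := Gsim Gt i.
by rewrite ler_wpM2r // eucl_ge0.
Qed.

Lemma parameter_net : exists (Cn : R) (D : nat), 1 <= Cn /\
  forall e : R, 0 < e -> e <= 1 -> exists (n : nat) (rep : 'I_n -> param R d m),
   [/\ n%:R <= (Cn / e) ^+ D, (forall i, Gam (rep i)) &
       forall t, Gam t -> exists i, pdist t (rep i) <= e].
Proof.
have aux (x y z p q h : R) : x <= y + z -> y <= p + q -> q < h / 2 -> z < h / 2 ->
  x <= p + h by lra.
pose pt (o : option 'I_d) : 'rV[R]_d := if o is Some j then delta_mx ord0 j else 0.
pose J : finType := ('I_m * option 'I_d * 'I_d + 'I_m)%type.
pose f (t : param R d m) (j : J) : R := match j with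
  | inl (i, o, k) => t.1 i (pt o) ord0 k | inr i => t.2 i end.
(* F_i(0) has norm at most 2 A, a point at distance at most 1 from 0 adds at most b < 1 to it, and
   weights are at most 1. *)
pose A1 := 2 * A + 2.
have A10 : 0 <= A1 by have := A_ge0; rewrite /A1; lra.
have fA t j : Gam t -> `|f t j| <= A1.
  move=> Gt; case: j => [[[i o] k]|i] /=; last first.
    by apply: le_trans (Gweight i Gt) _; have := A_ge0; rewrite /A1; lra.
  apply: le_trans (eucl_coord _ k) _.
  have tb := Gam_contractions Gt.
  have h0 := coding_bound_fix0 b_ge0 b_lt1 tb i (Gcod Gt).
  have h1 := tb i (pt o) 0; rewrite subr0 in h1.
  have ho : eucl (pt o) <= 1 by case: o {h1} => [j|] /=; rewrite ?eucl_delta ?eucl0.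
  have h2 : b * eucl (pt o) <= 1 by rewrite mulr_ile1 ?eucl_ge0 // ltW.
  have := eucl_triangle (t.1 i (pt o) - t.1 i 0) (t.1 i 0).
  by have := A_ge0; rewrite subrK /A1; lra.
(* Coordinates within e / c put the maps within d (e / c) (1 + 2 d A) on the ball of radius A, the
   codings within this over 1 - b, and the weights within e / c. The total is exactly e. *)
pose c := d%:R * (1 + 2 * d%:R * A) / (1 - b) + 1.
have b1 : 0 < 1 - b by rewrite subr_gt0.
have dA : 0 <= 1 + 2 * d%:R * A by rewrite addr_ge0 // !mulr_ge0.
have c1 : 1 <= c by rewrite /c lerDr divr_ge0 ?(ltW b1) // mulr_ge0.
have c0 : 0 < c by lra.
exists (2 * A1 * c + 1), #|J|; split.
  by rewrite lerDr mulr_ge0 // ?mulr_ge0 // ltW.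
move=> e e0 e1.
have ec0 : 0 < e / c by rewrite divr_gt0.
have [n [rep [nb Gr hr]]] := finite_net A10 ec0 (fun t j Gt => fA t j Gt).
exists n, rep; split => //.
  apply: le_trans nb _; rewrite lerXn2r ?nnegrE //.
  - by rewrite addr_ge0 // divr_ge0 ?(ltW ec0) // mulr_ge0.
  - by rewrite divr_ge0 ?(ltW e0) // addr_ge0 // !mulr_ge0 // ltW.
  have -> : 2 * A1 / (e / c) = 2 * A1 * c / e by field; rewrite !gt_eqF.
  by rewrite [leRHS]mulrDl lerD2l mul1r invf_ge1.
move=> t Gt; have [i hi] := hr t Gt; exists i.
have Gi := Gr i; move: (rep i) hi Gi => u hu Gu.
have ptu k o : eucl (t.1 k (pt o) - u.1 k (pt o)) <= d%:R * (e / c).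
  apply: eucl_le_max => l; have := hu (inl (k, o, l)).
  by rewrite /= !mxE.
have pert k x : eucl x <= A ->
    eucl (t.1 k x - u.1 k x) <= (d%:R * (e / c)) * (1 + 2 * d%:R * A).
  have [r1 _ s1] := Gsim Gt k; have [r2 _ s2] := Gsim Gu k.
  move=> xA; apply: (sim_perturb s1 s2) xA; first exact: (ptu k None).
  by move=> j; exact: (ptu k (Some j)).
have -> : e = d%:R * (e / c) * (1 + 2 * d%:R * A) / (1 - b) + e / c.
  transitivity (e / c * c); first by rewrite divfK ?gt_eqF.
  by rewrite {2}/c; field; rewrite (gt_eqF b1) gt_eqF.
apply: (pdist_le _ (ltW ec0)).
- by apply: divr_ge0 (ltW b1); apply: mulr_ge0 dA; apply: mulr_ge0 (ltW ec0).
- move=> w; have [tb ub] := (Gam_contractions Gt, Gam_contractions Gu).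
  apply/ler_addgt0Pr => h h0.
  have h20 : 0 < h / 2 by rewrite divr_gt0.
  have [N1 hN1] := compw_near b_ge0 b_lt1 ub w h20.
  have [N2 hN2] : exists N2, forall n, (N2 <= n)%N -> b ^+ n * A < h / 2.
    have : (b ^+ n * A) @[n --> \oo] --> (0 * A).
      by apply: cvgMl; apply: cvg_expr; rewrite ger0_norm.
    rewrite mul0r => /cvgrPdist_lt /(_ _ h20) [N _ hN].
    exists N => k Nk; have := hN k Nk.
    by rewrite /= sub0r normrN; apply: le_lt_trans; exact: ler_norm.
  have h1 := hN1 _ (leq_maxl N1 N2); have h2 := hN2 _ (leq_maxr N1 N2).
  have h3 := coding_perturb b_ge0 b_lt1 tb w ub (Gcod Gt) pert (maxn N1 N2).
  have h4 := eucl_dist_triangle (coding t.1 w) (compw u.1 w (maxn N1 N2)) (coding u.1 w).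
  exact: aux h4 h3 h2 h1.
- by move=> j; exact: (hu (inr j)).
Qed.

End ParameterNet.

(** * Self-similar measures and word sums *)

Lemma integral_step d (T : measurableType d) (R : realType) (P : probability T R)
  (I : Type) (r : seq I) (a : I -> R) (A : I -> set T) :
  (forall i, 0 <= a i) -> (forall i, measurable (A i)) ->
  (\int[P]_x (\sum_(i <- r) a i * \1_(A i) x)%:E =
   (\sum_(i <- r) a i * fine (P (A i)))%:E)%E.
Proof.
move=> a0 mA.
under eq_integral => x _ do rewrite -sumEFin.
have mf i : measurable_fun setT (fun x => (a i * \1_(A i) x)%:E).
  by apply/measurable_EFinP/measurable_funM => //; exact: measurable_indic.
have f0 i x : setT x -> (0 <= (a i * \1_(A i) x)%:E)%E.
  by move=> _; rewrite lee_fin; apply: mulr_ge0.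
rewrite (ge0_integral_sum P measurableT mf f0).
rewrite -sumEFin; apply: eq_bigr => i _.
under eq_integral => x _ do rewrite EFinM.
have mi : measurable_fun setT (EFin \o (\1_(A i) : T -> R)).
  by apply/measurable_EFinP; exact: measurable_indic.
have i0 x : setT x -> (0 <= (EFin \o (\1_(A i) : T -> R)) x)%E.
  by move=> _; rewrite lee_fin.
rewrite (ge0_integralZl_EFin P measurableT i0 mi (a0 i)) integral_indic // setIT.
by rewrite EFinM fineK // fin_num_measure.
Qed.

Section Words.
Variables (R : realType) (d m : nat).
Implicit Types (t u : param R d m.+1).

(** Padding by [ord0] is the reason for the alphabet size [m.+1]; [compw] at level N reads only the
    first N letters, so the default does not influence word points. *)
Definition ext N (v : {ffun 'I_N -> 'I_m.+1}) (k : nat) : 'I_m.+1 :=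
  if insub k is Some j then v j else ord0.

Lemma ext_ord N (v : {ffun 'I_N -> 'I_m.+1}) (k : 'I_N) : ext v k = v k.
Proof. by rewrite /ext valK. Qed.

Definition word_weight u N (v : {ffun 'I_N -> 'I_m.+1}) := \prod_k u.2 (v k).

Definition word_point u N (v : {ffun 'I_N -> 'I_m.+1}) := compw u.1 (ext v) N.

Definition word_sum u N (f : 'rV[R]_d -> R) :=
  \sum_(v : {ffun 'I_N -> 'I_m.+1}) word_weight u v * f (word_point u v).

Definition prob_weights u := (forall i, 0 < u.2 i) /\ \sum_i u.2 i = 1.

Lemma word_weight_ge0 u N v : prob_weights u -> 0 <= @word_weight u N v.
Proof. by move=> [u0 _]; apply: prodr_ge0 => k _; exact: ltW. Qed.

Lemma word_weight_sum u N : prob_weights u -> \sum_v @word_weight u N v = 1.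
Proof.
move=> [_ u1]; rewrite /word_weight -(bigA_distr_bigA (fun=> u.2)) /=.
by rewrite big1.
Qed.

Lemma prob_weights_le1 u i : prob_weights u -> `|u.2 i| <= 1.
Proof.
move=> [u0 <-]; rewrite ger0_norm ?(ltW (u0 i)) // (bigD1 i) //= lerDl.
by apply: sumr_ge0 => j _; exact: ltW.
Qed.

(* Telescoping: the k-th term changes the k-th letter weight from t to u. *)
Lemma prod_diff_le N (x y : nat -> R) :
  (forall k, 0 <= x k) -> (forall k, 0 <= y k) ->
  `|\prod_(k < N) x k - \prod_(k < N) y k| <=
  \sum_(k < N) \prod_(j < N) (if (j < k)%N then x j
                              else if j == k :> nat then `|x k - y k| else y j).
Proof.
move=> x0 y0; elim: N => [|N IH]; first by rewrite !big_ord0 subrr normr0.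
rewrite !big_ord_recr /=.
have -> : (\prod_(i < N) x i) * x N - (\prod_(i < N) y i) * y N =
  (\prod_(i < N) x i) * (x N - y N) + (\prod_(i < N) x i - \prod_(i < N) y i) * y N.
  by ring.
apply: le_trans (ler_normD _ _) _; rewrite [leLHS]addrC; apply: lerD.
  rewrite normrM (ger0_norm (y0 N)); apply: le_trans (ler_wpM2r (y0 N) IH) _.
  rewrite mulr_suml; apply: ler_sum => k _; rewrite big_ord_recr /=.
  by rewrite ltnNge (ltnW (ltn_ord k)) /= gtn_eqF.
rewrite ltnn eqxx normrM ger0_norm ?prodr_ge0 //.
by under [in leRHS]eq_bigr => i _ do rewrite ltn_ord.
Qed.

(** After telescoping and exchanging sums, each term factors over the letters: every factor sums to
    1 except the k-th, which gives the l^1 distance of the weights. *)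
Lemma word_weight_diff t u N : prob_weights t -> prob_weights u ->
  \sum_v `|@word_weight t N v - word_weight u v| <= N%:R * \sum_i `|t.2 i - u.2 i|.
Proof.
move=> [t0 t1] [u0 u1].
pose H (k j : 'I_N) (i : 'I_m.+1) : R :=
  if (j < k)%N then t.2 i else if j == k then `|t.2 i - u.2 i| else u.2 i.
apply: (@le_trans _ _ (\sum_(v : {ffun 'I_N -> 'I_m.+1}) \sum_k \prod_j H k j (v j))).
  apply: ler_sum => v _.
  have tw (w : param R d m.+1) : \prod_(k < N) w.2 (ext v k) = word_weight w v.
    by apply: eq_bigr => k _; rewrite ext_ord.
  have := @prod_diff_le N (fun k => t.2 (ext v k))
    (fun k => u.2 (ext v k)) (fun k => ltW (t0 _)) (fun k => ltW (u0 _)).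
  rewrite /= !tw.
  move=> /le_trans; apply; apply: ler_sum => k _.
  rewrite le_eqVlt; apply/orP; left; apply/eqP; apply: eq_bigr => j _.
  rewrite /H !ext_ord; case: ifP => // _.
  by rewrite -[(j == k)]/(_ == _ :> nat); case: eqP => // /val_inj ->.
rewrite exchange_big /=.
apply: (@le_trans _ _ (\sum_(k < N) \sum_i `|t.2 i - u.2 i|)); last first.
  by rewrite sumr_const card_ord mulr_natl.
apply: ler_sum => k _; rewrite -(bigA_distr_bigA (H k)) /= (bigD1 k) //=.
rewrite [X in _ * X]big1 => [|j jk]; last by rewrite /H (negbTE jk); case: (j < k)%N.
by rewrite mulr1 /H; under eq_bigr do rewrite ltnn eqxx.
Qed.

End Words.

(** * Self-similar measures against word sums *)

Section SelfSimilarMeasure.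
Variables (R : realType) (d m : nat) (b A : R).
Hypotheses (b_ge0 : 0 <= b) (b_lt1 : b < 1).
Variables (t : param R d m.+1) (eta : {measure set (Rd R d) -> \bar R}).
Hypotheses (tb : contractions b t.1) (tA : coding_bound A t.1).
Variables (dS : measure_display) (S : measurableType dS) (beta : probability S R)
  (xi : S -> nat -> 'I_m.+1).
Hypothesis xi_cyl : forall u n, measurable (xi @^-1` cyl u n) /\
        beta (xi @^-1` cyl u n) = (\prod_(k < n) t.2 (u k))%:E.
Hypothesis eta_xi : forall B : set (Rd R d), measurable B ->
        eta B = beta (xi @^-1` (coding t.1 @^-1` B)).

Definition wordcyl N (v : {ffun 'I_N -> 'I_m.+1}) : set S := xi @^-1` cyl (ext v) N.

Definition wordof N (s : S) : {ffun 'I_N -> 'I_m.+1} := [ffun k : 'I_N => xi s k].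

Lemma measurable_wordcyl N (v : {ffun 'I_N -> 'I_m.+1}) : measurable (wordcyl v).
Proof. by have [] := xi_cyl (ext v) N. Qed.

Lemma beta_wordcyl N (v : {ffun 'I_N -> 'I_m.+1}) :
  fine (beta (wordcyl v)) = word_weight t v.
Proof.
have [_ ->] := xi_cyl (ext v) N; apply: eq_bigr => k _.
by rewrite ext_ord.
Qed.

Lemma wordcylP N (v : {ffun 'I_N -> 'I_m.+1}) s : wordcyl v s <-> v = wordof N s.
Proof.
split.
  by move=> h; apply/ffunP => k; rewrite ffunE h ?ext_ord // ltn_ord.
by move=> -> k kN; have /= := ext_ord (wordof N s) (Ordinal kN); rewrite ffunE /=.
Qed.

Lemma sum_wordcyl N (g : {ffun 'I_N -> 'I_m.+1} -> R) s :
  \sum_v g v * \1_(wordcyl v) s = g (wordof N s).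
Proof.
rewrite (bigD1 (wordof N s)) //= big1 => [|v /eqP ne].
  by rewrite indicE mem_set ?mulr1 ?addr0 //; apply/wordcylP.
by rewrite indicE memNset ?mulr0 // => /wordcylP.
Qed.

(** The coupling behind every comparison: one random word yields a point of law eta_t and,
    truncated, an atom of the word sum of [u]. *)
Lemma word_point_near (u : param R d m.+1) N s : contractions b u.1 ->
  coding_bound A u.1 ->
  eucl (coding t.1 (xi s) - word_point u (wordof N s)) <= pdist t u + b ^+ N * A.
Proof.
move=> ub uA; rewrite /word_point (compw_eq _ (w' := xi s)); last first.
  by move=> k kN; have /= -> := ext_ord (wordof N s) (Ordinal kN); rewrite ffunE.
apply: le_trans (eucl_dist_triangle _ (coding u.1 (xi s)) _) _; apply: lerD.
  by apply: pdist_coding; exists A.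
exact: coding_compw.
Qed.

Lemma pdist_xx : pdist t t = 0.
Proof.
apply/eqP; rewrite eq_le pdist_ge0 andbT.
have := @pdist_le R d m.+1 t t 0 0 (lexx _) (lexx _); rewrite addr0; apply.
  by move=> w; rewrite subrr eucl0.
by move=> i; rewrite subrr normr0.
Qed.

(** An open U pulls back to the union of the cylinders coded entirely into U, because codings over a
    cylinder of length N stay within b^N A of its word point. There are finitely many cylinders of
    each length, so the union is countable. *)
Lemma measurable_coding_xi :
  measurable_fun setT (fun s => coding t.1 (xi s) : Rd R d).
Proof.
apply: (@measurability _ _ S (Rd R d) setT _ (@open 'rV[R]_d)) => [|_ [U oU <-]].
  by [].
rewrite setTI.
pose C N : set {ffun 'I_N -> 'I_m.+1} :=
  [set v | forall s, wordcyl v s -> U (coding t.1 (xi s))].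
have -> : (fun s => coding t.1 (xi s)) @^-1` U =
    \bigcup_N \bigcup_(v in C N) wordcyl v.
  apply/seteqP; split => [s /= Us|s [N _ [v Cv /Cv //]]].
  have /nbhs_euclP[e e0 hU] : nbhs (coding t.1 (xi s)) U by exact: open_nbhs_nbhs.
  have e20 : 0 < e / 2 by rewrite divr_gt0.
  have [N hN] : exists N, b ^+ N * A < e / 2.
    have : (b ^+ n * A) @[n --> \oo] --> (0 * A).
      by apply: cvgMl; apply: cvg_expr; rewrite ger0_norm.
    rewrite mul0r => /cvgrPdist_lt /(_ _ e20) [N _ hN].
    exists N; have := hN N (leqnn N).
    by rewrite /= sub0r normrN; apply: le_lt_trans; exact: ler_norm.
  exists N => //; exists (wordof N s); last exact/wordcylP.
  move=> s' /wordcylP ss'; apply: hU; rewrite /eball /=.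
  have := @word_point_near t N s tb tA; have := @word_point_near t N s' tb tA.
  rewrite -ss' pdist_xx add0r => h1 h2.
  have := eucl_dist_triangle (coding t.1 (xi s')) (word_point t (wordof N s))
    (coding t.1 (xi s)).
  by rewrite (euclB (word_point t (wordof N s))); lra.
apply: bigcup_measurable => N _; apply: fin_bigcup_measurable => //.
by move=> v _; exact: measurable_wordcyl.
Qed.

Lemma eta_preimage (B : set (Rd R d)) : measurable B ->
  eta B = beta ((fun s => coding t.1 (xi s)) @^-1` B).
Proof. by move=> mB; rewrite eta_xi. Qed.

Lemma eta_setT : eta setT = 1%E.
Proof. by rewrite eta_xi // preimage_setT probability_setT. Qed.

(** A cylinder whose word point lies in Q is coded into the ball, and cylinders of one length are
    disjoint. This carries the Frostman bound over to word sums. *)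
Lemma word_mass_le N (Q : set 'rV[R]_d) c r r1 :
  (forall x, Q x -> eucl (x - c) <= r1) -> r1 + b ^+ N * A < r ->
  ((\sum_(v : {ffun 'I_N -> 'I_m.+1} | word_point t v \in Q) word_weight t v)%:E
     <= eta (eball c r))%E.
Proof.
move=> Qr rr; have mB := measurable_eball c r.
rewrite eta_preimage // -(setIT (_ @^-1` _)) -integral_indic //; last first.
  by rewrite -[X in measurable X]setTI; exact: measurable_coding_xi.
have -> : \sum_(v : {ffun 'I_N -> 'I_m.+1} | word_point t v \in Q) word_weight t v =
    \sum_(v : {ffun 'I_N -> 'I_m.+1}) (word_point t v \in Q)%:R * fine (beta (wordcyl v)).
  rewrite big_mkcond; apply: eq_bigr => v _; rewrite beta_wordcyl.
  by case: (_ \in _); rewrite ?mul1r ?mul0r.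
rewrite -integral_step //; last by move=> v; exact: measurable_wordcyl.
apply: ge0_le_integral => //.
- by move=> s _; rewrite lee_fin; apply: sumr_ge0 => v _; apply: mulr_ge0.
- apply/measurable_EFinP/measurable_sum => v; apply: measurable_funM => //.
  by apply: measurable_indic; exact: measurable_wordcyl.
- apply/measurable_EFinP/measurable_indic.
  by rewrite -[X in measurable X]setTI; exact: measurable_coding_xi.
move=> s _; rewrite lee_fin sum_wordcyl.
case: (boolP (_ \in Q)) => // /set_mem /Qr h; rewrite indicE mem_set //=.
have := @word_point_near t N s tb tA; rewrite pdist_xx add0r => h1.
have := eucl_dist_triangle (coding t.1 (xi s)) (word_point t (wordof N s)) c.
rewrite /eball /=; lra.
Qed.

(** Along one random word, f changes by at most h per flipped indicator, and a flip of the j-th one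
    forces the coded point into a set of mass at most rho: J h rho in all. The second term pays for
    exchanging the weights of t for those of u under f <= Mf. *)
Lemma word_sum_compare (u : param R d m.+1) (f : 'rV[R]_d -> R) N J
  (L : nat -> set 'rV[R]_d) (h rho Mf eps : R) :
  contractions b u.1 -> coding_bound A u.1 ->
  prob_weights t -> prob_weights u ->
  measurable_fun (setT : set (Rd R d)) f ->
  (forall x, 0 <= f x <= Mf) -> 0 <= h ->
  (forall x y, `|f x - f y| <= h * \sum_(j < J) `|\1_(L j) x - \1_(L j) y|) ->
  (forall j, (j < J)%N -> exists B : set (Rd R d),
     [/\ measurable B, (eta B <= rho%:E)%E &
         nbhd_eps (boundary (L j)) eps `&` attractor t.1 `<=` B]) ->
  pdist t u + b ^+ N * A < eps ->
  `|fine (\int[eta]_x (f x)%:E) - word_sum u N f| <=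
    h * (J%:R * rho) + N%:R * (\sum_i `|t.2 i - u.2 i|) * Mf.
Proof.
move=> ub uA tp up mf f0 h0 fL hB hd.
pose phi s : Rd R d := coding t.1 (xi s).
have mphi : measurable_fun setT phi := measurable_coding_xi.
have -> : (\int[eta]_x (f x)%:E = \int[beta]_s (f (phi s))%:E)%E.
  rewrite (eq_measure_integral (pushforward beta phi)).
    rewrite ge0_integral_pushforward //; first by apply/measurable_EFinP.
    by move=> x _; rewrite lee_fin; case/andP: (f0 x).
  by move=> B mB _; rewrite /pushforward eta_preimage.
have /choice[B hBj] : forall j, exists B : set (Rd R d), (j < J)%N ->
    [/\ measurable B, (eta B <= rho%:E)%E &
         nbhd_eps (boundary (L j)) eps `&` attractor t.1 `<=` B].
  by move=> j; case: (ltnP j J) => [/hB[B ?]|_]; [exists B|exists setT].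
pose B' (j : 'I_J) := phi @^-1` B j.
have mB' j : measurable (B' j).
  have [mB _ _] := hBj j (ltn_ord j).
  by rewrite /B' -[X in measurable X]setTI; exact: mphi.
have B'rho j : fine (beta (B' j)) <= rho.
  have [mB le_rho _] := hBj j (ltn_ord j).
  rewrite -lee_fin fineK ?fin_num_measure //.
  by rewrite /B' -[X in beta X]/((fun s => coding t.1 (xi s)) @^-1` _) -eta_preimage.
have close s : `|f (coding t.1 (xi s)) - f (word_point u (wordof N s))| <=
    \sum_(j < J) h * \1_(B' j) s.
  apply: le_trans (fL _ _) _; rewrite mulr_sumr; apply: ler_sum => j _.
  apply: ler_wpM2l => //.
  have [e|ne] := eqVneq (\1_(L j) (coding t.1 (xi s)) : R) (\1_(L j) (word_point u (wordof N s))).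
    by rewrite e subrr normr0 indicE.
  have [z bz hz] := boundary_between ne.
  have [_ _ sub] := hBj j (ltn_ord j).
  rewrite (indicE _ (B' j)) mem_set /=; last first.
    apply: sub; split; last by exists (xi s).
    exists z => //; apply: le_lt_trans hz _; apply: le_lt_trans hd.
    exact: word_point_near.
  rewrite !indicE; case: (_ \in _); case: (_ \in _);
    by rewrite ?subrr ?subr0 ?sub0r ?normrN ?normr0 ?normr1.
pose g v := f (@word_point R d m u N v).
have g0 v : 0 <= g v by case/andP: (f0 (word_point u v)).
pose a := \sum_v g v * fine (beta (@wordcyl N v)).
pose c := \sum_(j < J) h * fine (beta (B' j)).
have mstep1 : measurable_fun setT
    (fun s => (\sum_v g v * \1_(@wordcyl N v) s)%:E).
  apply/measurable_EFinP/measurable_sum => v; apply: measurable_funM => //.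
  by apply: measurable_indic; exact: measurable_wordcyl.
have mstep2 : measurable_fun setT (fun s => (\sum_(j < J) h * \1_(B' j) s)%:E).
  by apply/measurable_EFinP/measurable_sum => v; apply: measurable_funM.
have mfphi : measurable_fun setT (fun s => (f (phi s))%:E).
  by apply/measurable_EFinP; exact: (measurableT_comp mf mphi).
have Ia : (\int[beta]_s (\sum_v g v * \1_(@wordcyl N v) s)%:E = a%:E)%E.
  by rewrite integral_step // => v; exact: measurable_wordcyl.
have Ic : (\int[beta]_s (\sum_(j < J) h * \1_(B' j) s)%:E = c%:E)%E.
  by rewrite integral_step.
have st1 s : (0 <= (\sum_v g v * \1_(@wordcyl N v) s)%:E)%E.
  by rewrite lee_fin sum_wordcyl.
have st2 s : (0 <= (\sum_(j < J) h * \1_(B' j) s)%:E)%E.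
  by rewrite lee_fin; apply: sumr_ge0 => j _; apply: mulr_ge0.
have st3 s : (0 <= (f (phi s))%:E)%E by rewrite lee_fin; case/andP: (f0 (phi s)).
have up1 : (\int[beta]_s (f (phi s))%:E <= (a + c)%:E)%E.
  rewrite EFinD -Ia -Ic -ge0_integralD //; apply: ge0_le_integral => //.
    exact: emeasurable_funD.
  move=> s _; rewrite -EFinD lee_fin sum_wordcyl.
  by have := le_trans (ler_norm _) (close s); rewrite lerBlDl.
have up2 : (a%:E <= \int[beta]_s (f (phi s))%:E + c%:E)%E.
  rewrite -Ia -Ic -ge0_integralD //; apply: ge0_le_integral => //.
    exact: emeasurable_funD.
  move=> s _; rewrite -EFinD lee_fin sum_wordcyl.
  have := close s; rewrite distrC => h1.
  by have := le_trans (ler_norm _) h1; rewrite lerBlDl.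
have I0 : (0 <= \int[beta]_s (f (phi s))%:E)%E by exact: integral_ge0.
have Ifin : (\int[beta]_s (f (phi s))%:E)%E \is a fin_num.
  by rewrite ge0_fin_numE //; apply: le_lt_trans up1 _; rewrite ltry.
move: up1 up2; rewrite -(fineK Ifin) -EFinD !lee_fin; set I := fine _ => up1 up2.
have c_le : c <= h * (J%:R * rho).
  rewrite /c -mulr_sumr ler_wpM2l //.
  rewrite (le_trans (ler_sum _ (fun j _ => B'rho j))) //.
  by rewrite sumr_const card_ord mulr_natl.
have a_le : `|a - word_sum u N f| <= N%:R * (\sum_i `|t.2 i - u.2 i|) * Mf.
  rewrite /a /word_sum -sumrB; apply: le_trans (ler_norm_sum _ _ _) _.
  apply: (@le_trans _ _ ((\sum_v `|@word_weight R d m t N v - word_weight u v|) * Mf)).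
    rewrite mulr_suml; apply: ler_sum => v _; rewrite beta_wordcyl mulrC -mulrBl.
    rewrite normrM ler_wpM2l // ger0_norm //.
    by case/andP: (f0 (word_point u v)).
  apply: ler_wpM2r; first by case/andP: (f0 0) => h1 h2; exact: le_trans h2.
  exact: word_weight_diff.
have := ler_distD a I (word_sum u N f).
have : `|I - a| <= c by rewrite ler_norml; apply/andP; split; lra.
by lra.
Qed.

End SelfSimilarMeasure.

(** * Conditional independence *)

Section Versions.
Variables (R : realType) (dT : measure_display) (T : measurableType dT)
  (P : probability T R).
Implicit Types (X Y : T -> R) (B : set T).

Lemma ae_bounded_integrable X M B : measurable B -> measurable_fun setT X ->
  {ae P, forall w, `|X w| <= M} -> P.-integrable B (EFin \o X).
Proof.
move=> mB mX hM.
have mXB : measurable_fun B (EFin \o X).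
  by apply/measurable_EFinP; exact: measurable_funTS.
apply/integrableP; split => //.
apply: (@le_lt_trans _ _ (\int[P]_(w in B) (`|M|%:E))%E).
  apply: ae_ge0_le_integral => //.
  - exact: measurableT_comp mXB.
  - apply: filterS hM => w hw _ /=.
    by rewrite lee_fin (le_trans hw) // ler_norm.
rewrite integral_cst //; apply: (@le_lt_trans _ _ (`|M|%:E * 1)%E).
  by rewrite lee_pmul // probability_le1.
by rewrite mule1 ltry.
Qed.

Lemma Rintegral_ae_close X1 X2 c B : 0 <= c -> measurable B ->
  measurable_fun setT X1 -> measurable_fun setT X2 ->
  P.-integrable B (EFin \o X1) -> P.-integrable B (EFin \o X2) ->
  {ae P, forall w, `|X1 w - X2 w| <= c} ->
  `|\int[P]_(w in B) X1 w - \int[P]_(w in B) X2 w| <= c.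
Proof.
move=> c0 mB m1 m2 i1 i2 hc.
have m12 : measurable_fun setT (fun w => X1 w - X2 w) by exact: measurable_funB.
have i12 : P.-integrable B (EFin \o (fun w => X1 w - X2 w)).
  by have := integrableB mB i1 i2; apply: eq_integrable => // w _.
rewrite -RintegralB //; apply: le_trans (le_normr_Rintegral mB i12) _.
rewrite -lee_fin /Rintegral fineK; last first.
  by apply: integrable_fin_num => //; exact: integrable_norm.
apply: (@le_trans _ _ (\int[P]_(w in B) (c%:E))%E).
  apply: ae_ge0_le_integral => //.
  - by apply/measurable_EFinP/measurable_funTS; exact: measurableT_comp m12.
  - by apply: filterS hc => w hw _; rewrite lee_fin.
rewrite integral_cst //; apply: (@le_trans _ _ (c%:E * 1)%E); last by rewrite mule1.
by rewrite lee_pmul // probability_le1.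
Qed.

Variable H : set (set T).
Hypotheses (sH : sigma_algebra setT H) (HT : H `<=` measurable).

(** Passing to the measurable type generated by [H] makes the closure lemmas for measurable
    functions available. *)
Lemma sub_measurableP X :
  sub_measurable H X <-> measurable_fun (setT : set (g_sigma_algebraType H)) X.
Proof.
have HE := sigma_algebra_id sH; split.
  by move=> hX _ A mA; rewrite setTI /measurable /= HE; exact: hX.
move=> hX A mA; have := hX measurableT A mA.
by rewrite setTI /measurable /= HE.
Qed.

Lemma sub_measurable_measurable X : sub_measurable H X -> measurable_fun setT X.
Proof. by move=> hX _ A mA; rewrite setTI; exact/HT/hX. Qed.

Lemma cexp_sub_measurable X Y : cexp_version P H X Y -> measurable_fun setT Y.
Proof. by case=> hY _ _ _; exact: sub_measurable_measurable. Qed.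

Lemma cexp_Rintegral X Y B : cexp_version P H X Y -> H B ->
  \int[P]_(w in B) X w = \int[P]_(w in B) Y w.
Proof. by move=> [_ _ _ h] HB; rewrite /Rintegral h. Qed.

Lemma cexp_cst c : cexp_version P H (fun=> c) (fun=> c).
Proof.
have ic : P.-integrable setT (EFin \o (fun=> c : R)).
  apply: (@ae_bounded_integrable _ `|c|) => //; exact: aeW.
by split=> //; apply/sub_measurableP.
Qed.

Lemma cexp_sum (I : Type) (r : seq I) (a : I -> R) (X Y : I -> T -> R) :
  (forall i, cexp_version P H (X i) (Y i)) ->
  cexp_version P H (fun w => \sum_(i <- r) a i * X i w)
                   (fun w => \sum_(i <- r) a i * Y i w).
Proof.
move=> hXY.
have iZ i (Z : I -> T -> R) B : measurable B -> P.-integrable setT (EFin \o Z i) ->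
    P.-integrable B (EFin \o (fun w => a i * Z i w)).
  move=> mB iZ; have := integrableZl mB (a i) (integrableS measurableT mB (@subsetT _ _) iZ).
  by apply: eq_integrable.
have iS (Z : I -> T -> R) B : measurable B ->
    (forall i, P.-integrable setT (EFin \o Z i)) ->
    P.-integrable B (EFin \o (fun w => \sum_(i <- r) a i * Z i w)).
  move=> mB hZ; have := @integrable_sum _ _ _ P B mB _ r xpredT
    (fun i => EFin \o (fun w => a i * Z i w)) (fun i _ => iZ i Z B mB (hZ i)).
  by apply: eq_integrable => // w _; rewrite /= sumEFin.
have iX i : P.-integrable setT (EFin \o X i) by case: (hXY i).
have iY i : P.-integrable setT (EFin \o Y i) by case: (hXY i).
split; [|exact: iS|exact: iS|].
  apply/sub_measurableP/measurable_sum => i; apply: measurable_funM => //.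
  by apply/sub_measurableP; case: (hXY i).
move=> B HB; have mB := HT HB.
have tr (Z : I -> T -> R) : (forall i, P.-integrable setT (EFin \o Z i)) ->
    (\int[P]_(w in B) (\sum_(i <- r) a i * Z i w)%:E =
     \sum_(i <- r) (a i)%:E * \int[P]_(w in B) (Z i w)%:E)%E.
  move=> hZ; under eq_integral => w _ do rewrite -sumEFin.
  rewrite (integral_sum mB (fun i => iZ i Z B mB (hZ i))).
  apply: eq_bigr => i _; rewrite -integralZl //.
  exact: integrableS (hZ i).
rewrite !tr //; apply: eq_bigr => i _; congr (_ * _)%E.
by case: (hXY i) => _ _ _; apply.
Qed.

(** On the event Y2 + c < Y1, which is in [H], the positive difference has integral at most 0, so
    the event is null. Used in both directions with c = 0, this is a.e. uniqueness of versions. *)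
Lemma cexp_ae_le X1 X2 Y1 Y2 c :
  cexp_version P H X1 Y1 -> cexp_version P H X2 Y2 ->
  (forall w, X1 w <= X2 w + c) -> {ae P, forall w, Y1 w <= Y2 w + c}.
Proof.
move=> h1 h2 h12.
have [s1 iX1 iY1 e1] := h1; have [s2 iX2 iY2 e2] := h2.
have [_ iC _ _] := cexp_cst c.
pose B := [set w | Y2 w + c < Y1 w].
have HB : H B.
  have : measurable_fun (setT : set (g_sigma_algebraType H))
      (fun w => Y2 w + c < Y1 w).
    apply: measurable_fun_ltr; last exact/sub_measurableP.
    by apply: measurable_funD => //; exact/sub_measurableP.
  move=> /(_ measurableT [set true] I).
  by rewrite setTI /measurable /= (sigma_algebra_id sH); congr (H _).
have mB := HT HB.
have rs X : P.-integrable setT (EFin \o X) -> P.-integrable B (EFin \o X).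
  by move=> iX; apply: integrableS iX.
pose D w := Y1 w - (Y2 w + c).
have iS X : P.-integrable setT (EFin \o X) ->
    P.-integrable B (EFin \o (fun w => X w + c)).
  move=> iX; have := integrableD mB (rs _ iX) (rs _ iC).
  by apply: eq_integrable.
have mD : measurable_fun setT D.
  apply: measurable_funB; first exact: cexp_sub_measurable h1.
  by apply: measurable_funD => //; exact: cexp_sub_measurable h2.
have D0 w : B w -> 0 < D w by rewrite /B /D /= subr_gt0.
have intD : \int[P]_(w in B) D w <= 0.
  rewrite RintegralB //; [|exact: rs|exact: iS].
  rewrite RintegralD //; [|exact: rs|exact: rs].
  rewrite -(cexp_Rintegral h1 HB) -(cexp_Rintegral h2 HB) subr_le0.
  rewrite -RintegralD //; [|exact: rs|exact: rs].
  by apply: le_Rintegral => //; [exact: rs|exact: iS].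
have iD : P.-integrable B (EFin \o D).
  have := integrableB mB (rs _ iY1) (iS _ iY2).
  by apply: eq_integrable.
have abs0 : (\int[P]_(w in B) `|(EFin \o D) w| = 0)%E.
  apply/eqP; rewrite eq_le integral_ge0 ?andbT; last by move=> w _.
  have -> : (\int[P]_(w in B) `|(EFin \o D) w| = \int[P]_(w in B) (EFin \o D) w)%E.
    apply: eq_integral => w /set_mem Bw /=.
    by rewrite ger0_norm // ltW // D0.
  rewrite -lee_fin /Rintegral fineK in intD; first exact: intD.
  exact: integrable_fin_num.
have mDB : measurable_fun B (EFin \o D).
  by apply/measurable_EFinP; exact: measurable_funTS.
have := (ae_eq_integral_abs P mB mDB).1 abs0.
apply: filterS => w hw; rewrite leNgt; apply/negP => Bw.
have := hw Bw => /= -[D00].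
by have := D0 w Bw; rewrite D00 ltxx.
Qed.

End Versions.

Lemma prod_close (R : realType) k (x y : 'I_k -> R) (e M : R) : 1 <= M -> 0 <= e ->
  (forall i, 0 <= x i <= M) -> (forall i, 0 <= y i <= M) ->
  (forall i, `|x i - y i| <= e) ->
  `|\prod_i x i - \prod_i y i| <= k%:R * e * M ^+ k.
Proof.
move=> M1 e0; have M0 : 0 <= M by exact: le_trans M1.
elim: k x y => [|k IH] x y hx hy hxy.
  by rewrite !big_ord0 subrr normr0 !mul0r.
rewrite !big_ord_recr /=.
set p := \prod_(i < k) _; set q := \prod_(i < k) y _.
have pM : `|p| <= M ^+ k.
  rewrite ger0_norm; last by apply: prodr_ge0 => i _; case/andP: (hx (widen_ord (leqnSn k) i)).
  have -> : M ^+ k = \prod_(i < k) M by rewrite prodr_const card_ord.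
  by apply: ler_prod => i _; exact: hx.
have -> : p * x ord_max - q * y ord_max = p * (x ord_max - y ord_max) + (p - q) * y ord_max.
  by ring.
apply: le_trans (ler_normD _ _) _; rewrite !normrM.
have h1 : `|p| * `|x ord_max - y ord_max| <= M ^+ k * e by rewrite ler_pM.
have h2 : `|p - q| * `|y ord_max| <= (k%:R * e * M ^+ k) * M.
  apply: ler_pM => //; first by apply: IH.
  by have /andP[h0 h1'] := hy ord_max; rewrite ger0_norm.
apply: le_trans (lerD h1 h2) _.
have -> : k.+1%:R * e * M ^+ k.+1 = e * M ^+ k.+1 + k%:R * e * M ^+ k * M.
  by rewrite -natr1 exprS; ring.
rewrite lerD2r mulrC ler_wpM2l // exprS ler_peMl // exprn_ge0 //.
Qed.

Lemma Rintegral_lincomb (R : realType) d (T : measurableType d) (P : probability T R)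
  (I : Type) (r : seq I) (a : I -> R) (Z : I -> T -> R) (B : set T) : measurable B ->
  (forall i, P.-integrable B (EFin \o Z i)) ->
  \int[P]_(w in B) (\sum_(i <- r) a i * Z i w) =
  \sum_(i <- r) a i * \int[P]_(w in B) Z i w.
Proof.
move=> mB iZ.
have iaZ i : P.-integrable B (fun w => (a i * Z i w)%:E).
  have := integrableZl mB (a i) (iZ i); exact: eq_integrable.
elim: r => [|i r IH].
  rewrite big_nil -[RHS](Rintegral_set0 P (fun=> 0)).
  rewrite /Rintegral; under eq_integral => w _ do rewrite big_nil.
  by rewrite integral0 /Rintegral integral_set0.
rewrite big_cons -IH -RintegralZl // -RintegralD //.
- by apply: eq_Rintegral => w _; rewrite big_cons.
- exact: iaZ.
- have := @integrable_sum _ _ _ P B mB _ r xpredT (fun i w => (a i * Z i w)%:E)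
    (fun i _ => iaZ i).
  by apply: eq_integrable => // w _; rewrite /= sumEFin.
Qed.

Lemma prod_indic (R : realType) T k (A : 'I_k -> set T) w :
  \prod_i \1_(A i) w = \1_(\bigcap_i A i) w :> R.
Proof.
have [h|h] := pselect (forall i, A i w).
  rewrite indicE mem_set; last by move=> i _.
  by rewrite big1 // => i _; rewrite indicE mem_set.
have [i ni] : exists i, ~ A i w by apply/existsNP.
rewrite (bigD1 i) //= indicE memNset // mul0r indicE memNset // => H.
by apply: ni; apply: H.
Qed.

Section CondIndep.
Variables (R : realType) (dT : measure_display) (T : measurableType dT)
  (P : probability T R) (H : set (set T)).
Hypotheses (sH : sigma_algebra setT H) (HT : H `<=` measurable).
Variables (k : nat) (G : 'I_k -> set (set T)).
Hypothesis GH : cond_indep P H G.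

(* The conditional factorization of events passes to step functions by
   multilinearity, then to bounded functions by uniform approximation. *)
Lemma cond_indep_prod (f g : 'I_k -> T -> R) (M : R) B : 1 <= M ->
  (forall i, sub_measurable (G i) (f i)) ->
  (forall i, cexp_version P H (f i) (g i)) ->
  (forall i w, 0 <= f i w <= M) -> (forall i w, 0 <= g i w <= M) -> H B ->
  \int[P]_(w in B) \prod_i f i w = \int[P]_(w in B) \prod_i g i w.
Proof.
move=> M1 sf fg fM gM HB; have mB := HT HB.
have M0 : 0 <= M by exact: le_trans M1.
have mf i : measurable_fun setT (f i).
  by have [_ /integrableP[/measurable_EFinP]] := fg i.
have mg i : measurable_fun setT (g i) by exact: cexp_sub_measurable (fg i).
have mprod (x : 'I_k -> T -> R) : (forall i, measurable_fun setT (x i)) ->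
    measurable_fun setT (fun w => \prod_i x i w).
  by move=> mx; apply: measurable_prod => i _; exact: mx.
have prodM (x : 'I_k -> R) (K : R) : (forall i, 0 <= x i <= K) ->
    `|\prod_i x i| <= K ^+ k.
  move=> hx; rewrite ger0_norm; last by apply: prodr_ge0 => i _; case/andP: (hx i).
  have -> : K ^+ k = \prod_(i < k) K by rewrite prodr_const card_ord.
  by apply: ler_prod => i _; exact: hx.
suff main N : `|\int[P]_(w in B) \prod_i f i w - \int[P]_(w in B) \prod_i g i w| <=
    (2 * k%:R * M ^+ k) * N.+1%:R^-1.
  apply/eqP; rewrite -subr_eq0 -normr_le0; apply/ler_addgt0Pr => e e0.
  rewrite add0r; pose c := 2 * k%:R * M ^+ k.
  apply: le_trans (main (Num.truncn (c / e))) _.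
  rewrite ler_pdivrMr // -/c mulrC -ler_pdivrMr //; apply: ltW.
  exact: truncnS_gt.
pose e : R := N.+1%:R^-1; have e0 : 0 < e by rewrite invr_gt0.
(* [fd] below rounds [f] down to multiples of e; J cells of length e cover [0, M]. *)
pose J := (Num.truncn (M / e)).+1.
pose A i (j : 'I_J) := f i @^-1` `[j%:R * e, j.+1%:R * e[%classic.
have GA i j : G i (A i j) by exact: sf.
have mA i j : measurable (A i j).
  by rewrite /A -[X in measurable X]setTI; apply: mf.
pose fd i w := \sum_(j < J) (j%:R * e) * (\1_(A i j) w : R).
have fdP i w : fd i w <= f i w <= fd i w + e /\ 0 <= fd i w.
  have /andP[f0 f1] := fM i w.
  have q0 : 0 <= f i w / e by rewrite divr_ge0 // ltW.
  have jJ : (Num.truncn (f i w / e) < J)%N.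
    by rewrite /J ltnS le_truncn // ler_wpM2r // invr_ge0 ltW.
  have /andP[t1 t2] := truncn_itv q0.
  have -> : fd i w = (Num.truncn (f i w / e))%:R * e.
    rewrite /fd (bigD1 (Ordinal jJ)) //= big1 => [|j jne].
      have Aw : A i (Ordinal jJ) w.
        by rewrite /A /= in_itv /= -ler_pdivlMr // t1 -ltr_pdivrMr.
      by rewrite indicE mem_set // mulr1 addr0.
    rewrite indicE memNset ?mulr0 // /A /= in_itv /= => /andP[h1 h2].
    move/eqP: jne; apply; apply/val_inj => /=; apply/esym/truncn_def.
    by rewrite ler_pdivlMr // h1 ltr_pdivrMr.
  split; last by rewrite mulr_ge0 // ltW.
  apply/andP; split; first by rewrite -ler_pdivlMr.
  by rewrite -[X in _ + X]mul1r -mulrDl natr1 -ler_pdivrMr // ltW.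
have /choice[V VP] : forall j : 'I_J, exists V : 'I_k -> T -> R,
    forall i, cexp_version P H (\1_(A i j)) (V i).
  by move=> j; have [V [h _]] := GH (fun i => GA i j); exists V.
pose gd i w := \sum_(j < J) (j%:R * e) * V j i w.
have fgd i : cexp_version P H (fd i) (gd i).
  exact: (@cexp_sum R dT T P H sH HT _ _ (fun j : 'I_J => j%:R * e)
    (fun j => \1_(A i j) : T -> R) (fun j => V j i) (fun j => VP j i)).
have mV j i : measurable_fun setT (V j i) by exact: cexp_sub_measurable (VP j i).
have mgd i : measurable_fun setT (gd i) by exact: cexp_sub_measurable (fgd i).
have mfd i : measurable_fun setT (fd i).
  by have [_ /integrableP[/measurable_EFinP]] := fgd i.
have cst0 := cexp_cst P sH 0; have cst1 := cexp_cst P sH 1.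
have ae_gd : {ae P, forall w, forall i,
    [/\ gd i w <= g i w + 0, g i w <= gd i w + e & 0 <= gd i w + 0]}.
  apply: (filter_forall (F := almost_everywhere P)) => i.
  have a1 := cexp_ae_le (c := 0) sH HT (fgd i) (fg i).
  have a2 := cexp_ae_le (c := e) sH HT (fg i) (fgd i).
  have a3 := cexp_ae_le (c := 0) sH HT cst0 (fgd i).
  apply: filterS3 (a1 _) (a2 _) (a3 _) => [w h1 h2 h3|w|w|w].
  - by split.
  - by rewrite addr0; have [/andP[]] := fdP i w.
  - by have [/andP[]] := fdP i w.
  - by rewrite addr0; have [] := fdP i w.
have ae_V : {ae P, forall w, forall ji : 'I_J * 'I_k, 0 <= V ji.1 ji.2 w <= 1}.
  apply: (filter_forall (F := almost_everywhere P)) => -[j i] /=.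
  have a1 := cexp_ae_le (c := 0) sH HT cst0 (VP j i).
  have a2 := cexp_ae_le (c := 0) sH HT (VP j i) cst1.
  apply: filterS2 (a1 _) (a2 _) => [w|w|w].
  - by rewrite !addr0 => -> ->.
  - by rewrite addr0 indicE.
  - by rewrite addr0 indicE; case: (_ \in _).
have ae_gdM : {ae P, forall w, forall i, 0 <= gd i w <= M}.
  apply: filterS ae_gd => w h i; have [h1 h2 h3] := h i.
  rewrite !addr0 in h1 h3; rewrite h3 (le_trans h1) //.
  by case/andP: (gM i w).
have fdM i w : 0 <= fd i w <= M.
  have [/andP[h1 _] h2] := fdP i w; rewrite h2 (le_trans h1) //.
  by case/andP: (fM i w).
have integ (x : 'I_k -> T -> R) K : (forall i, measurable_fun setT (x i)) ->
    {ae P, forall w, forall i, 0 <= x i w <= K} ->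
    P.-integrable B (EFin \o (fun w => \prod_i x i w)).
  move=> mx hx; apply: (@ae_bounded_integrable _ _ _ _ _ (K ^+ k)) => //.
    exact: mprod.
  by apply: filterS hx => w hw; exact: prodM.
have bound0 : 0 <= k%:R * e * M ^+ k by rewrite mulr_ge0 ?exprn_ge0 // mulr_ge0 // ltW.
have s1 : `|\int[P]_(w in B) \prod_i f i w - \int[P]_(w in B) \prod_i fd i w| <=
    k%:R * e * M ^+ k.
  apply: (Rintegral_ae_close bound0 mB (mprod _ mf) (mprod _ mfd)).
  - by apply: (integ f M mf); apply: aeW.
  - by apply: (integ fd M mfd); apply: aeW.
  - apply: aeW => w; apply: prod_close => //; first exact: ltW.
    move=> i; have [/andP[h1 h2] h3] := fdP i w.
    by rewrite ger0_norm ?subr_ge0 // lerBlDl.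
have s2 : `|\int[P]_(w in B) \prod_i gd i w - \int[P]_(w in B) \prod_i g i w| <=
    k%:R * e * M ^+ k.
  apply: (Rintegral_ae_close bound0 mB (mprod _ mgd) (mprod _ mg)).
  - exact: (integ gd M mgd).
  - by apply: (integ g M mg); apply: aeW.
  - apply: filterS2 ae_gd ae_gdM => w h hM; apply: prod_close => //; first exact: ltW.
    move=> i; have [h1 h2 h3] := h i; rewrite addr0 in h1.
    by rewrite distrC ger0_norm ?subr_ge0 // lerBlDl.
have s3 : \int[P]_(w in B) \prod_i fd i w = \int[P]_(w in B) \prod_i gd i w.
  pose cJ (j : {ffun 'I_k -> 'I_J}) : R := \prod_i ((j i)%:R * e).
  have expand (x : 'I_k -> 'I_J -> T -> R) w :
      \prod_i \sum_(j < J) (j%:R * e) * x i j w = \sum_(j : {ffun 'I_k -> 'I_J}) cJ j * \prod_i x i (j i) w.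
    by rewrite bigA_distr_bigA /=; apply: eq_bigr => j _; rewrite /cJ -big_split.
  have -> : \int[P]_(w in B) \prod_i fd i w =
      \int[P]_(w in B) (\sum_(j : {ffun 'I_k -> 'I_J}) cJ j * \prod_i \1_(A i (j i)) w).
    by apply: eq_Rintegral => w _; exact: (expand (fun i j => \1_(A i j))).
  have -> : \int[P]_(w in B) \prod_i gd i w =
      \int[P]_(w in B) (\sum_(j : {ffun 'I_k -> 'I_J}) cJ j * \prod_i V (j i) i w).
    by apply: eq_Rintegral => w _; exact: (expand (fun i j => V j i)).
  have iV (j : {ffun 'I_k -> 'I_J}) :
      P.-integrable B (EFin \o (fun w => \prod_i V (j i) i w)).
    apply: (integ (fun i => V (j i) i) 1) => //.
    by apply: filterS ae_V => w h i; exact: (h (j i, i)).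
  have i1 (j : {ffun 'I_k -> 'I_J}) :
      P.-integrable B (EFin \o (fun w => \prod_i \1_(A i (j i)) w)).
    apply: (integ (fun i => \1_(A i (j i))) 1) => //; apply: aeW => w i.
    by rewrite indicE; case: (_ \in _); rewrite ?lexx ?ler01.
  rewrite !Rintegral_lincomb //; apply: eq_bigr => j _; congr (_ * _).
  (* The versions given by [cond_indep] depend on the whole tuple of events, while the [V] come from
     constant tuples. For each i both belong to the same indicator, hence agree a.e. *)
  have [W [WP Wprod]] := GH (fun i => GA i (j i)).
  transitivity (\int[P]_(w in B) (\1_(\bigcap_i A i (j i)) w : R)).
    by apply: eq_Rintegral => w _; exact: prod_indic.
  rewrite (cexp_Rintegral Wprod HB); rewrite /Rintegral; congr fine.
  have mW i : measurable_fun setT (W i) by exact: cexp_sub_measurable (WP i).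
  apply: ae_eq_integral => //.
  - by apply/measurable_EFinP/measurable_funTS/mprod.
  - by apply/measurable_EFinP/measurable_funTS/mprod.
  have : {ae P, forall w, forall i, W i w <= V (j i) i w + 0 /\ V (j i) i w <= W i w + 0}.
    apply: (filter_forall (F := almost_everywhere P)) => i.
    have a1 := cexp_ae_le (c := 0) sH HT (WP i) (VP (j i) i).
    have a2 := cexp_ae_le (c := 0) sH HT (VP (j i) i) (WP i).
    by apply: filterS2 (a1 _) (a2 _) => [w|w|w]; rewrite ?addr0.
  apply: filterS => w h _; congr EFin; apply: eq_bigr => i _.
  by apply/eqP; rewrite eq_le; have := h i; rewrite !addr0 => -[-> ->].
rewrite s3 in s1.
have := ler_distD (\int[P]_(w in B) \prod_i gd i w)
  (\int[P]_(w in B) \prod_i f i w) (\int[P]_(w in B) \prod_i g i w).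
move=> /le_trans; apply; apply: le_trans (lerD s1 s2) _.
by rewrite -/e le_eqVlt; apply/orP; left; apply/eqP; ring.
Qed.

(** From exp(-y) >= 1 - y and (1 + y + 2 y^2)(1 - y) = 1 + y^2 (1 - 2 y) >= 1. *)
Lemma expR_le_quadratic (y : R) : `|y| <= 1 / 2 -> expR y <= 1 + y + 2 * y ^+ 2.
Proof.
rewrite ler_norml => /andP[h1 h2].
have y1 : 0 < 1 - y by lra.
have := expR_ge1Dx (- y); rewrite expRN => h.
have : expR y <= (1 - y)^-1.
  by rewrite -(invrK (expR y)) lef_pV2 // posrE invr_gt0 expR_gt0.
move=> /le_trans; apply; rewrite -[leLHS]mul1r ler_pdivrMr //.
have -> : (1 + y + 2 * y ^+ 2) * (1 - y) = 1 + y ^+ 2 * (1 - 2 * y) by ring.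
by rewrite lerDl mulr_ge0 ?sqr_ge0 //; lra.
Qed.

(** No conditional expectation of an exponential is formed. The range of th times the sum of the W_i
    is cut into unit bins, which are events of [H]; on a bin with left end c, Markov's inequality
    and the product identity compare e^(c + b) P(E and bin) with e^(c + 1) P(bin). The 1 in the
    exponent 1 - b is the bin width. *)
Lemma cond_indep_tail (Z W : 'I_k -> T -> R) (z lam b : R) :
  (forall i, sub_measurable (G i) (fun w => 1 + (lam + 2 * lam ^+ 2 * z) * Z i w)) ->
  (forall i, cexp_version P H (Z i) (W i)) ->
  (forall i w, 0 <= Z i w <= z) -> (forall i w, 0 <= W i w <= z) ->
  `|lam| * z <= 1 / 2 -> 0 <= z ->
  fine (P [set w | (lam + 2 * lam ^+ 2 * z) * (\sum_i W i w) + b <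
                   lam * \sum_i Z i w]) <= expR (1 - b).
Proof.
move=> sZ ZW Zz Wz lz z0; set th := lam + 2 * lam ^+ 2 * z.
have lz2 : `|2 * lam ^+ 2 * z| <= `|lam|.
  rewrite ger0_norm; last by rewrite mulr_ge0 // mulr_ge0 // sqr_ge0.
  rewrite -(real_normK (num_real lam)).
  by have := normr_ge0 lam; nra.
have th_bound x : 0 <= x <= z -> -1 <= th * x <= 1.
  move=> /andP[x0 xz]; rewrite -ler_norml normrM (ger0_norm x0).
  have : `|th| <= 2 * `|lam| by apply: le_trans (ler_normD _ _) _; lra.
  have := normr_ge0 lam; have := normr_ge0 th; nra.
have expZ x : 0 <= x <= z -> expR (lam * x) <= 1 + th * x.
  move=> /andP[x0 xz].
  have lx : `|lam * x| <= 1 / 2.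
    by rewrite normrM (ger0_norm x0); have := normr_ge0 lam; nra.
  apply: le_trans (expR_le_quadratic lx) _.
  have : 0 <= lam ^+ 2 * x * (z - x).
    by rewrite mulr_ge0 ?subr_ge0 // mulr_ge0 // sqr_ge0.
  by rewrite /th; lra.
have mZ i : measurable_fun setT (Z i).
  by have [_ /integrableP[/measurable_EFinP]] := ZW i.
have mW i : measurable_fun setT (W i) by exact: cexp_sub_measurable (ZW i).
pose SZ w := \sum_i Z i w; pose SW w := \sum_i W i w.
have mSZ : measurable_fun setT SZ by exact: measurable_sum.
have mSW : measurable_fun setT SW by exact: measurable_sum.
pose E := [set w | th * SW w + b < lam * SZ w].
have mE : measurable E.
  have : measurable_fun setT (fun w => th * SW w + b < lam * SZ w).
    by apply: measurable_fun_ltr; [apply: measurable_funD|]; try apply: measurable_funM.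
  by move=> /(_ measurableT [set true] I); rewrite setTI.
have fgv i : cexp_version P H (fun w => 1 + th * Z i w) (fun w => 1 + th * W i w).
  pose X (o : bool) w : R := if o then 1 else Z i w.
  pose Y (o : bool) w : R := if o then 1 else W i w.
  have XY o : cexp_version P H (X o) (Y o) by case: o; [exact: (cexp_cst P sH 1)|exact: ZW].
  have := @cexp_sum R dT T P H sH HT _ [:: true; false]
    (fun o : bool => if o then 1 else th) X Y XY.
  by congr cexp_version; apply/funext => w; rewrite !big_cons big_nil /= mul1r addr0.
have f2 i w : 0 <= 1 + th * Z i w <= 2.
  by have := th_bound _ (Zz i w) => /andP[]; lra.
have g2 i w : 0 <= 1 + th * W i w <= 2.
  by have := th_bound _ (Wz i w) => /andP[]; lra.
have prodE B : H B -> \int[P]_(w in B) \prod_i (1 + th * Z i w) =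
    \int[P]_(w in B) \prod_i (1 + th * W i w).
  by move=> HB; apply: (@cond_indep_prod _ _ 2) => //; lra.
(* Each th W_i lies in [-1, 1], so the shift by k puts h in [0, 2k] and the bins are indexed by 2k +
   1 naturals. *)
pose h w := th * SW w + k%:R.
have hb w : 0 <= h w < (2 * k).+1%:R.
  have : `|th * SW w| <= k%:R.
    rewrite /SW mulr_sumr; apply: le_trans (ler_norm_sum _ _ _) _.
    apply: (@le_trans _ _ (\sum_(i < k) 1)); last by rewrite sumr_const card_ord.
    by apply: ler_sum => i _; rewrite ler_norml th_bound.
  rewrite ler_norml /h -natr1 natrM => /andP[]; lra.
pose Bn (j : 'I_(2 * k).+1) := [set w | j%:R <= h w < j.+1%:R].
have HBn j : H (Bn j).
  have mh : measurable_fun (setT : set (g_sigma_algebraType H)) h.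
    apply: measurable_funD => //; apply: measurable_funM => //.
    by apply: measurable_sum => i; apply/(sub_measurableP sH); case: (ZW i).
  have /(sub_measurableP sH)/(_ `[j%:R, j.+1%:R[%classic) := mh.
  have -> : h @^-1` `[j%:R, j.+1%:R[ = Bn j.
    by apply/seteqP; split => w; rewrite /Bn /= in_itv.
  by apply.
have mBn j : measurable (Bn j) by exact/HT/HBn.
have bins w : \sum_j 1 * (\1_(Bn j) w : R) = 1.
  have /andP[h0 h1] := hb w.
  have jJ : (Num.truncn (h w) < (2 * k).+1)%N by rewrite ltnS truncn_le_nat.
  rewrite (bigD1 (Ordinal jJ)) //= big1 => [|j jne].
    by rewrite mul1r addr0 indicE mem_set // /Bn /= truncn_itv.
  rewrite mul1r indicE memNset // /Bn /= => hj.
  by move/eqP: jne; apply; apply/val_inj => /=; apply/esym/truncn_def.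
have PE : fine (P E) = \sum_j 1 * fine (P (E `&` Bn j)).
  apply: EFin_inj; rewrite -integral_step //; last by move=> j; exact: measurableI.
  rewrite fineK ?fin_num_measure // -(setIT E) -integral_indic //.
  apply: eq_integral => w _; congr EFin.
  transitivity (\1_E w * \sum_j 1 * (\1_(Bn j) w : R)); first by rewrite bins mulr1.
  rewrite mulr_sumr; apply: eq_bigr => j _; rewrite !mul1r.
  by rewrite indicI setIT.
have P1 : \sum_j 1 * fine (P (Bn j)) = 1.
  apply: EFin_inj; rewrite -integral_step //.
  under eq_integral => w _ do rewrite bins.
  by rewrite integral_cst // [X in (_ * X)%E]probability_setT mule1.
suff bin j : fine (P (E `&` Bn j)) <= expR (1 - b) * fine (P (Bn j)).
  have -> : expR (1 - b) = \sum_j expR (1 - b) * (1 * fine (P (Bn j))).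
    by rewrite -mulr_sumr P1 mulr1.
  by rewrite -/E PE; apply: ler_sum => j _; rewrite !mul1r; exact: bin.
pose c : R := j%:R - k%:R.
have mprodf : measurable_fun setT (fun w => \prod_i (1 + th * Z i w)).
  by apply: measurable_prod => i _; apply: measurable_funD => //; apply: measurable_funM.
have mprodg : measurable_fun setT (fun w => \prod_i (1 + th * W i w)).
  by apply: measurable_prod => i _; apply: measurable_funD => //; apply: measurable_funM.
have prod2 (x : 'I_k -> R) : (forall i, 0 <= x i <= 2) -> 0 <= \prod_i x i <= 2 ^+ k.
  move=> hx; rewrite prodr_ge0 /=; last by move=> i _; case/andP: (hx i).
  have -> : 2 ^+ k = \prod_(i < k) (2 : R) by rewrite prodr_const card_ord.
  by apply: ler_prod => i _; exact: hx.
have integ (X : T -> R) K D : measurable D -> measurable_fun setT X -> (forall w, 0 <= X w <= K) ->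
    P.-integrable D (EFin \o X).
  move=> mD mX hX; apply: (@ae_bounded_integrable _ _ _ _ _ K) => //.
  by apply: aeW => w; have /andP[? ?] := hX w; rewrite ger0_norm.
have RI D (x : R) : measurable D -> \int[P]_(w in D) x = x * fine (P D).
  move=> mD; rewrite Rintegral_cst //.
have mEB : measurable (E `&` Bn j) by exact: measurableI.
have step1 : expR (c + b) * fine (P (E `&` Bn j)) <=
    \int[P]_(w in Bn j) \prod_i (1 + th * Z i w).
  have -> : expR (c + b) * fine (P (E `&` Bn j)) =
      \int[P]_(w in Bn j) (expR (c + b) * \1_(E `&` Bn j) w).
    rewrite RintegralZl //; last first.
      by apply: (integ _ 1) => // w; rewrite indicE; case: (_ \in _); rewrite ?lexx ?ler01.
    congr (_ * _); rewrite /Rintegral integral_indic //.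
    by rewrite -setIA setIid.
  apply: le_Rintegral => //.
  - apply: (integ _ (expR (c + b))) => //; first by apply: measurable_funM.
    move=> w; rewrite indicE; case: (_ \in _);
      by rewrite ?mulr1 ?mulr0 ?lexx ?expR_ge0.
  - by apply: (integ _ (2 ^+ k)) => // w; apply: prod2.
  move=> w Bw; have [Ew|nEw] := pselect (E w); last first.
    rewrite indicE memNset ?mulr0; last by case.
    by have /andP[] := prod2 _ (fun i => f2 i w).
  rewrite indicE mem_set // mulr1.
  apply: (@le_trans _ _ (expR (lam * SZ w))).
    rewrite ler_expR; move: Ew Bw; rewrite /E /Bn /h /c /= => Ew /andP[h1 _]; lra.
  rewrite /SZ mulr_sumr expR_sum; apply: ler_prod => i _.
  by rewrite expR_ge0 /= expZ.
have step2 : \int[P]_(w in Bn j) \prod_i (1 + th * W i w) <=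
    expR (c + 1) * fine (P (Bn j)).
  rewrite -RI //; apply: le_Rintegral => //.
  - by apply: (integ _ (2 ^+ k)) => // w; apply: prod2.
  - by apply: (integ _ (expR (c + 1))) => // w; rewrite expR_ge0 lexx.
  move=> w Bw; apply: (@le_trans _ _ (expR (th * SW w))).
    rewrite /SW mulr_sumr expR_sum; apply: ler_prod => i _.
    by have /andP[-> _] := g2 i w; rewrite expR_ge1Dx.
  rewrite ler_expR; move: Bw; rewrite /Bn /h /c /= => /andP[_]; rewrite -natr1; lra.
rewrite -(ler_pM2l (expR_gt0 (c + b))) mulrA -expRD.
have -> : c + b + (1 - b) = c + 1 by ring.
by apply: le_trans step1 _; rewrite prodE.
Qed.

End CondIndep.

(** * The martingale increment *)

Lemma prob_union_le (R : realType) d (T : measurableType d) (P : probability T R)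
  (I : finType) (E : set T) (F : I -> set T) : measurable E ->
  (forall i, measurable (F i)) -> (forall w, E w -> exists i, F i w) ->
  fine (P E) <= \sum_i fine (P (F i)).
Proof.
move=> mE mF EF.
have -> : \sum_i fine (P (F i)) = \sum_i 1 * fine (P (F i)).
  by apply: eq_bigr => i _; rewrite mul1r.
rewrite -lee_fin -integral_step // fineK ?fin_num_measure //.
rewrite -(setIT E) -integral_indic //; apply: ge0_le_integral => //.
- by apply/measurable_EFinP; exact: measurable_indic.
- by apply/measurable_EFinP/measurable_sum => i; apply: measurable_funM.
move=> w _; rewrite lee_fin.
have s0 (J : pred I) : 0 <= \sum_(i | J i) 1 * (\1_(F i) w : R).
  by apply: sumr_ge0 => i _; rewrite mul1r.
have [Ew|nE] := pselect (E w); last by rewrite indicE memNset.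
have [i Fi] := EF w Ew.
by rewrite (bigD1 i) //= !indicE !mem_set // mul1r lerDl.
Qed.

Lemma measurable_ltr_set (R : realType) d (T : measurableType d) (f g : T -> R) :
  measurable_fun setT f -> measurable_fun setT g -> measurable [set w | f w < g w].
Proof.
move=> mf mg; have := measurable_fun_ltr mf mg.
by move=> /(_ measurableT [set true] I); rewrite setTI.
Qed.

(** * Separated classes of dyadic cubes *)

Section DyadicCubes.
Variables (R : realType) (d n : nat).
Implicit Types x y : 'rV[R]_d.

Definition cube_index x : {ffun 'I_d -> int} :=
  [ffun i => Num.floor (x ord0 i * 2 ^+ n.+1)].

Lemma cube_indexP x : @dcube R d n (cube_index x) x.
Proof.
move=> i; rewrite ffunE.
have p0 : 0 < 2 ^+ n.+1 :> R by rewrite exprn_gt0.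
by rewrite ler_pdivrMr // ltr_pdivlMr //; apply/andP; rewrite floor_itv.
Qed.

Definition cube_class q x : {ffun 'I_d -> 'I_q.+1} :=
  [ffun i => inord `|(cube_index x i %% q.+1%:Z)%Z|%N].

(** Distinct congruent indices differ by at least q + 1 in some coordinate, which leaves q full cube
    sides between the two cubes. *)
Lemma cube_class_sep q (k k' : 'I_d -> int) x y :
  (forall i, (k i = k' i %[mod q.+1%:Z])%Z) -> (exists i, k i != k' i) ->
  @dcube R d n k x -> @dcube R d n k' y ->
  q%:R / 2 ^+ n.+1 <= eucl (x - y).
Proof.
move=> hmod [i ne] kx ky.
apply: le_trans (eucl_coord (x - y) i); rewrite !mxE.
have p0 : 0 < 2 ^+ n.+1 :> R by rewrite exprn_gt0.
have [] := kx i; rewrite ler_pdivrMr // ltr_pdivlMr //; set X := x ord0 i * _ => x1 x2.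
have [] := ky i; rewrite ler_pdivrMr // ltr_pdivlMr //; set Y := y ord0 i * _ => y1 y2.
rewrite ler_pdivrMr // -[2 ^+ n.+1](gtr0_norm p0) -normrM mulrBl -/X -/Y.
have qk : q.+1%:R <= `|(k i)%:~R - (k' i)%:~R| :> R.
  rewrite -intrB -intr_norm -[q.+1%:R]/(q.+1%:~R) ler_int.
  have : (q.+1%:Z %| k i - k' i)%Z by rewrite -eqz_mod_dvd; apply/eqP; exact: hmod.
  rewrite dvdzE /= => /dvdn_leq; rewrite absz_gt0 subr_eq0 => /(_ ne).
  by rewrite -lez_nat abszE.
rewrite -natr1 in qk; rewrite !intrD in x2 y2.
move: qk; rewrite !ler_normr => /orP[h|h]; apply/orP; [left|right]; lra.
Qed.

Lemma cube_class_mod q x y : cube_class q x = cube_class q y ->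
  forall i, (cube_index x i = cube_index y i %[mod q.+1%:Z])%Z.
Proof.
move=> /ffunP h i; have := h i; rewrite !ffunE => /(congr1 val) /=.
have q0 : q.+1%:Z != 0 by [].
have lt z : (`|(z %% q.+1%:Z)%Z| < q.+1)%N.
  by rewrite -ltz_nat gez0_abs ?modz_ge0 // ltz_pmod.
rewrite !inordK ?lt // => e.
by rewrite -[LHS]gez0_abs ?modz_ge0 // -[RHS]gez0_abs ?modz_ge0 // e.
Qed.

End DyadicCubes.

Section MartingaleTail.
Variables (R : realType) (d : nat) (dT : measure_display) (T : measurableType dT)
  (P : probability T R) (B : nat -> set (set T))
  (mu : nat -> T -> 'rV[R]_d -> R) (C : R).
Hypothesis SI : SI_martingale P B mu C.

Lemma SI_ge0 n w x : 0 <= mu n w x.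
Proof. by case: SI => -[]. Qed.

Lemma SI_cexp n x : cexp_version P (B n) (mu n.+1 ^~ x) (mu n ^~ x).
Proof. by case: SI => _ _ /(_ n x)[]. Qed.

Lemma SI_sigma n : sigma_algebra setT (B n).
Proof. by case: SI => -[/(_ n)[]]. Qed.

Lemma SI_sub n : B n `<=` measurable.
Proof. by case: SI => -[/(_ n)[]]. Qed.

Lemma SI_measurable n x : measurable_fun setT (mu n ^~ x).
Proof. exact: (cexp_sub_measurable (@SI_sub n) (SI_cexp n x)). Qed.

Variables (n : nat) (V : finType) (x : V -> 'rV[R]_d) (a : V -> R) (mass Mx : R).
Hypotheses (a_ge0 : forall v, 0 <= a v) (mass_ge0 : 0 <= mass).
Hypothesis massP : forall k, \sum_(v | x v \in @dcube R d n k) a v <= mass.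
Hypothesis MxP : forall k w y, (k <= n.+1)%N -> (n <= k)%N -> mu k w y <= Mx.
Variables (q : nat) (lam b : R).
Hypotheses (qC : 2 * C <= q%:R) (lam_gt0 : 0 < lam)
  (lam_le : lam * (mass * Mx) <= 1 / 2) (Mx_ge0 : 0 <= Mx).

Definition point_sum k w := \sum_v a v * mu k w (x v).

Lemma measurable_point_sum k : measurable_fun setT (point_sum k).
Proof.
apply: measurable_sum => v; apply: measurable_funM => //; exact: SI_measurable.
Qed.

Let class_sum (c : {ffun 'I_d -> 'I_q.+1}) k w :=
  \sum_(v | cube_class n q (x v) == c) a v * mu k w (x v).

Let measurable_class_sum c k : measurable_fun setT (class_sum c k).
Proof.
have -> : class_sum c k = fun w => \sum_v (if cube_class n q (x v) == c
    then a v * mu k w (x v) else 0).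
  by apply/funext => w; rewrite /class_sum big_mkcond.
apply: measurable_sum => v; case: (_ == c) => //.
apply: measurable_funM => //; exact: SI_measurable.
Qed.

Let z := mass * Mx.

Let dev_set (cs : {ffun 'I_d -> 'I_q.+1} * bool) :=
  let l := if cs.2 then lam else - lam in
  [set w | (l + 2 * l ^+ 2 * z) * class_sum cs.1 n w + b < l * class_sum cs.1 n.+1 w].

Let measurable_dev_set cs : measurable (dev_set cs).
Proof.
apply: measurable_ltr_set.
  by apply: measurable_funD => //; apply: measurable_funM.
by apply: measurable_funM.
Qed.

(** Only the finitely many cubes of the class that carry a point matter. By 2 C <= q they are
    separated as (SI4) demands, and each has weighted mass at most z = mass Mx, so [cond_indep_tail]
    applies to the sums [Z] over the single cubes. *)
Let dev_set_le cs : fine (P (dev_set cs)) <= expR (1 - b).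
Proof.
case: cs => c sg; rewrite /dev_set /=; set l := if sg then _ else _.
pose s := undup [seq cube_index n (x v) | v <- enum V & cube_class n q (x v) == c].
pose k := size s.
pose Q (i : 'I_k) : {ffun 'I_d -> int} := nth [ffun=> 0] s i.
have sP K : K \in s -> exists2 v, cube_class n q (x v) = c & K = cube_index n (x v).
  rewrite mem_undup => /mapP[v]; rewrite mem_filter => /andP[/eqP vc _] ->.
  by exists v.
pose a' (i : 'I_k) v := if cube_index n (x v) == Q i then a v else 0.
pose Z j (i : 'I_k) w := \sum_v a' i v * mu j w (x v).
have a'0 i v : 0 <= a' i v by rewrite /a'; case: ifP.
have sumZ j w : \sum_i Z j i w = class_sum c j w.
  rewrite /Z exchange_big /class_sum [RHS]big_mkcond /=; apply: eq_bigr => v _.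
  have -> : \sum_(i < k) a' i v * mu j w (x v) =
      \sum_(K <- s) (if cube_index n (x v) == K then a v * mu j w (x v) else 0).
    rewrite (big_nth [ffun=> 0]) big_mkord; apply: eq_bigr => i _.
    by rewrite /a' /Q; case: ifP => // _; rewrite mul0r.
  case: ifP => [vc|/negP vc].
    have vs : cube_index n (x v) \in s.
      by rewrite mem_undup; apply: map_f; rewrite mem_filter vc mem_enum.
    rewrite (bigD1_seq (cube_index n (x v)) vs (undup_uniq _)) /= eqxx big1 ?addr0 //.
    by move=> K; rewrite eq_sym => /negbTE ->.
  rewrite big_seq big1 // => K /sP[u uc ->]; case: eqP => // e.
  case: vc; rewrite -uc; apply/eqP/ffunP => i; rewrite !ffunE.
  by move/ffunP: e => /(_ i); rewrite !ffunE => ->.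
have sep (i j : 'I_k) : i != j -> forall y y', @dcube R d n (Q i) y ->
    @dcube R d n (Q j) y' -> C / 2 ^+ n <= eucl (y - y').
  move=> ij y y' yi yj.
  have [v vc Qv] := sP _ (mem_nth [ffun=> 0] (ltn_ord i)).
  have [v' vc' Qv'] := sP _ (mem_nth [ffun=> 0] (ltn_ord j)).
  apply: (@le_trans _ _ (q%:R / 2 ^+ n.+1)).
    rewrite exprS invfM mulrA ler_wpM2r // ?invr_ge0 ?exprn_ge0 //.
    by rewrite ler_pdivlMr // mulrC.
  apply: cube_class_sep yi yj.
    move=> r; rewrite /Q Qv Qv'; apply: cube_class_mod; by rewrite vc vc'.
  apply/existsP; rewrite -negb_forall; apply/negP => /forallP h.
  move/eqP: ij; apply; apply/val_inj/eqP.
  rewrite -(nth_uniq [ffun=> 0] (ltn_ord i) (ltn_ord j) (undup_uniq _)).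
  by apply/eqP/ffunP => r; apply/eqP; exact: h.
have ci : cond_indep P (B n) (fun i : 'I_k => restr_sigma (mu n.+1) (@dcube R d n (Q i))).
  by case: SI => _ _ _ _; apply.
have zbound j i w : (n <= j <= n.+1)%N -> 0 <= Z j i w <= z.
  move=> /andP[nj jn]; apply/andP; split.
    by apply: sumr_ge0 => v _; rewrite mulr_ge0 // SI_ge0.
  apply: (@le_trans _ _ ((\sum_v a' i v) * Mx)).
    by rewrite mulr_suml; apply: ler_sum => v _; rewrite ler_wpM2l // MxP.
  rewrite ler_wpM2r // (le_trans _ (massP (Q i))) // /a' -big_mkcond.
  rewrite [leRHS](bigID (fun v => cube_index n (x v) == Q i)) /=.
  rewrite [X in _ <= X + _](eq_bigl (fun v => cube_index n (x v) == Q i)).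
    by rewrite lerDl; apply: sumr_ge0.
  move=> v; case: eqP => [e|]; rewrite ?andbT ?andbF //.
  by apply/mem_set; rewrite -e; exact: cube_indexP.
have l2 : `|l| = lam.
  by rewrite /l; case: (sg); rewrite ?normrN gtr0_norm.
have := @cond_indep_tail R dT T P (B n) (SI_sigma n) (@SI_sub n) k _ ci
  (Z n.+1) (Z n) z l b.
under [X in _ -> _ -> _ -> _ -> _ -> _ -> fine (P X) <= _]eq_set => w do rewrite !sumZ.
apply.
- move=> i.
  apply/(sub_measurableP (smallest_sigma_algebra _ _)); apply: measurable_funD => //.
  apply: measurable_funM => //; apply: measurable_sum => v.
  rewrite /a'; case: eqP => [e|_]; last first.
    rewrite [X in measurable_fun _ X](_ : _ = fun=> 0) //.
    by apply/funext => w; exact: mul0r.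
  apply: measurable_funM => //.
  apply/(sub_measurableP (smallest_sigma_algebra _ _)) => A mA.
  apply: sub_sigma_algebra; exists (x v), A; split => //.
  by rewrite -e; exact: cube_indexP.
- move=> i; apply: cexp_sum; [exact: SI_sigma|exact: SI_sub|].
  by move=> v; exact: SI_cexp.
- by move=> i w; apply: zbound; rewrite leqnSn leqnn.
- by move=> i w; apply: zbound; rewrite leqnSn leqnn.
- by rewrite l2.
- by rewrite mulr_ge0.
Qed.

(** If no class deviates for either sign of lam, every class increment is at most 2 lam z times its
    sum at level n plus b / lam, since the term 2 lam^2 z is the same for both signs. Summing over
    the (q + 1)^d classes multiplies b / lam; the union over classes and signs gives the factor 2 (q
    + 1)^d. *)
Lemma martingale_tail :
  fine (P [set w | 2 * lam * (mass * Mx) * point_sum n w + (q.+1 ^ d)%:R * (b / lam)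
                   < `|point_sum n.+1 w - point_sum n w|])
  <= 2 * (q.+1 ^ d)%:R * expR (1 - b).
Proof.
rewrite -/z.
have mE : measurable [set w | 2 * lam * z * point_sum n w + (q.+1 ^ d)%:R * (b / lam)
                   < `|point_sum n.+1 w - point_sum n w|].
  apply: measurable_ltr_set.
    apply: measurable_funD => //; apply: measurable_funM => //.
    exact: measurable_point_sum.
  by apply: measurableT_comp => //; apply: measurable_funB; exact: measurable_point_sum.
have cover w : 2 * lam * z * point_sum n w + (q.+1 ^ d)%:R * (b / lam)
    < `|point_sum n.+1 w - point_sum n w| -> exists cs, dev_set cs w.
  move=> Ew.
  apply/not_existsP => hno; move: Ew; rewrite /= ltNge => /negP; apply.
  have sum_class k : point_sum k w = \sum_c class_sum c k w.
    by rewrite /point_sum (partition_big (fun v => cube_class n q (x v)) xpredT).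
  have hc c : `|class_sum c n.+1 w - class_sum c n w| <=
      2 * lam * z * class_sum c n w + b / lam.
    have /negP := hno (c, true); rewrite /dev_set /= -leNgt => h1.
    have /negP := hno (c, false); rewrite /dev_set /= -leNgt => h2.
    rewrite -(ler_pM2l lam_gt0) -[X in X * `|_|](gtr0_norm lam_gt0) -normrM.
    have -> : lam * (2 * lam * z * class_sum c n w + b / lam) =
        2 * lam ^+ 2 * z * class_sum c n w + b by field; rewrite gt_eqF.
    rewrite sqrrN in h2.
    by rewrite ler_norml mulrBr; apply/andP; split; lra.
  rewrite !sum_class -sumrB; apply: le_trans (ler_norm_sum _ _ _) _.
  apply: le_trans (ler_sum _ (fun c _ => hc c)) _.
  rewrite big_split /= -mulr_sumr lerD2l sumr_const.
  by rewrite card_ffun !card_ord mulr_natl.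
apply: le_trans (@prob_union_le R dT T P ({ffun 'I_d -> 'I_q.+1} * bool)%type
  _ dev_set mE measurable_dev_set cover) _.
apply: le_trans (ler_sum _ (fun cs _ => dev_set_le cs)) _.
rewrite sumr_const -[leLHS]mulr_natl.
have -> : #|{: {ffun 'I_d -> 'I_q.+1} * bool}| = (2 * q.+1 ^ d)%N.
  by rewrite card_prod card_ffun !card_ord card_bool mulnC.
by rewrite natrM.
Qed.

End MartingaleTail.

(** * Deterministic estimates *)

Section AnalyticEstimates.
Variable R : realType.
Implicit Types (x y c g rho : R) (Y : nat -> R).

Lemma powR_mulr_nat y n (a : R) : 0 <= y -> y `^ (a * n%:R) = (y `^ a) ^+ n.
Proof. by move=> y0; rewrite powRrM powR_mulrn // powR_ge0. Qed.

Lemma powRX y n (a : R) : 0 <= y -> (y ^+ n) `^ a = (y `^ a) ^+ n.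
Proof. by move=> y0; rewrite -powR_mulrn // -powRrM mulrC powR_mulr_nat. Qed.

Lemma exp_unbounded y c : 1 < y -> exists k, (0 < k)%N /\ c <= y ^+ k.
Proof.
move=> y1; have y0 : 0 < y - 1 by rewrite subr_gt0.
exists (Num.truncn (c / (y - 1))).+1; split => //; set k := _.+1.
have bern n : n%:R * (y - 1) <= y ^+ n.
  elim: n => [|n IH]; first by rewrite mul0r.
  rewrite -natr1 mulrDl mul1r exprS.
  have : 1 <= y ^+ n by rewrite exprn_ege1 // ltW.
  by have := ltW y1; nra.
apply: le_trans (bern k); rewrite -ler_pdivrMr // ltW //.
exact: truncnS_gt.
Qed.

(* exp z >= (1 + z / k)^k with z = y^n *)
Lemma expRN_exp_decay y rho : 1 < y -> 0 < rho ->
  exists K, 0 <= K /\ forall n, expR (- y ^+ n) <= K * rho ^+ n.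
Proof.
move=> y1 rho0; have [k [k0 hk]] := exp_unbounded rho^-1 y1.
exists (k%:R ^+ k); split; first by rewrite exprn_ge0.
move=> n; set z := y ^+ n.
have z0 : 0 < z by rewrite exprn_gt0 // (lt_trans _ y1).
have kR : 0 < k%:R :> R by rewrite ltr0n.
have h : (z / k%:R) ^+ k <= expR z.
  have {2}-> : z = k%:R * (z / k%:R) by rewrite mulrCA divff ?mulr1 // gt_eqF.
  rewrite expRM_natl lerXn2r ?nnegrE ?expR_ge0 ?divr_ge0 ?(ltW z0) //.
  by apply: le_trans (expR_ge1Dx _); rewrite lerDr.
rewrite expRN invf_ple ?posrE ?expR_gt0 ?mulr_gt0 ?exprn_gt0 //.
apply: le_trans h; rewrite invfM expr_div_n mulrC ler_wpM2r ?invr_ge0 ?exprn_ge0 //.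
rewrite /z -exprM mulnC exprM -exprVn lerXn2r ?nnegrE ?invr_ge0 ?(ltW rho0) //.
by rewrite exprn_ge0 // (le_trans _ (ltW y1)).
Qed.

Lemma geometric_small x c e : 0 <= x -> x < 1 -> 0 < e ->
  exists N, forall n, (N <= n)%N -> c * x ^+ n < e.
Proof.
move=> x0 x1 e0.
have : (c * x ^+ n) @[n --> \oo] --> (c * 0).
  by apply: cvgMr; apply: cvg_expr; rewrite ger0_norm.
rewrite mulr0 => /cvgrPdist_lt /(_ e e0) [N _ hN].
exists N => n Nn; have := hN n Nn.
by rewrite /= sub0r normrN; apply: le_lt_trans; exact: ler_norm.
Qed.

(** With C = c / (1 - x) one has C x^n = C x^(n+1) + c x^n, so the intervals of radius C x^n about Y
    n are nested; the limit is the supremum of their left ends. *)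
Lemma geometric_limit Y c x N : 0 <= x -> x < 1 -> 0 <= c ->
  (forall n, (N <= n)%N -> `|Y n.+1 - Y n| <= c * x ^+ n) ->
  exists l, forall n, (N <= n)%N -> `|Y n - l| <= c / (1 - x) * x ^+ n.
Proof.
move=> x0 x1 c0 h; pose C := c / (1 - x).
have x10 : 0 < 1 - x by rewrite subr_gt0.
have C0 : 0 <= C by rewrite divr_ge0 // ltW.
have step n : C * x ^+ n = C * x ^+ n.+1 + c * x ^+ n.
  by rewrite /C exprS; field; rewrite gt_eqF.
have mono n k : (N <= n)%N ->
    Y n - C * x ^+ n <= Y (n + k)%N - C * x ^+ (n + k) /\
    Y (n + k)%N + C * x ^+ (n + k) <= Y n + C * x ^+ n.
  move=> Nn; elim: k => [|k [h1 h2]]; first by rewrite addn0.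
  have := h (n + k)%N (leq_trans Nn (leq_addr _ _)).
  rewrite ler_norml addnS => /andP[]; have := step (n + k)%N.
  by split; lra.
have cross n k : (N <= n)%N -> (N <= k)%N -> Y n - C * x ^+ n <= Y k + C * x ^+ k.
  move=> Nn Nk.
  have [h1 _] := mono n (maxn n k - n)%N Nn; have [_ h2] := mono k (maxn n k - k)%N Nk.
  rewrite subnKC ?leq_maxl // in h1; rewrite subnKC ?leq_maxr // in h2.
  have : 0 <= C * x ^+ maxn n k by rewrite mulr_ge0 // exprn_ge0.
  by lra.
pose S := [set y | exists2 n, (N <= n)%N & y = Y n - C * x ^+ n].
have SN : S (Y N - C * x ^+ N) by exists N.
have ubS n : (N <= n)%N -> ubound S (Y n + C * x ^+ n).
  by move=> Nn _ [k Nk ->]; exact: cross.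
exists (sup S) => n Nn; rewrite -/C ler_norml.
have h1 : Y n - C * x ^+ n <= sup S.
  by apply: ub_le_sup; [exists (Y N + C * x ^+ N); exact: ubS|exists n].
have h2 : sup S <= Y n + C * x ^+ n.
  by apply: ge_sup; [exists (Y N - C * x ^+ N)|exact: ubS].
by apply/andP; split; lra.
Qed.

Lemma discrete_gronwall Y c x N : 0 <= x -> x < 1 -> 0 <= c ->
  (forall n, 0 <= Y n) ->
  (forall n, (N <= n)%N -> `|Y n.+1 - Y n| <= c * x ^+ n * (1 + Y n)) ->
  forall n, (N <= n)%N -> 1 + Y n <= (1 + Y N) * expR (c / (1 - x)).
Proof.
move=> x0 x1 c0 Y0 h n Nn; have x10 : 0 < 1 - x by rewrite subr_gt0.
(* The product over j < k of exp(c x^j), each factor majorizing the growth factor 1 + c x^j. *)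
pose E k := expR (c / (1 - x) * (1 - x ^+ k)).
suff H : 1 + Y n <= (1 + Y N) * E n.
  apply: le_trans H _; apply: ler_wpM2l; first by rewrite addr_ge0.
  rewrite ler_expR ler_piMr ?divr_ge0 ?(ltW x10) // gerBl exprn_ge0 //.
rewrite -(subnKC Nn); elim: (n - N)%N => [|k IH].
  rewrite addn0 ler_peMr ?addr_ge0 // -[leLHS]expR0 ler_expR.
  by rewrite mulr_ge0 ?divr_ge0 ?(ltW x10) // subr_ge0 exprn_ile1 // ltW.
rewrite addnS; set j := (N + k)%N.
have := h j (leq_addr _ _); rewrite ler_norml => /andP[_ h1].
have -> : E j.+1 = expR (c * x ^+ j) * E j.
  rewrite /E -expRD; congr expR; rewrite exprS; field; by rewrite gt_eqF.
apply: (@le_trans _ _ ((1 + c * x ^+ j) * (1 + Y j))); first by lra.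
rewrite mulrCA ler_pM ?expR_ge1Dx ?addr_ge0 // mulr_ge0 // exprn_ge0 //.
Qed.

Lemma geometric_bracket x c N : 0 < x -> x < 1 -> 0 < c -> c <= x ^+ N ->
  exists n, [/\ (N <= n)%N, c <= x ^+ n & x ^+ n.+1 < c].
Proof.
move=> x0 x1 c0 cN.
have ex : exists n, (fun n => x ^+ n < c) n.
  have [M hM] := @geometric_small x 1 c (ltW x0) x1 c0.
  by exists M; have := hM M (leqnn M); rewrite mul1r.
case: (ex_minnP ex) => -[|n] hn minn.
  have : x ^+ N <= x ^+ 0 by rewrite expr0 exprn_ile1 // ltW.
  by move=> /(le_trans cN); rewrite leNgt hn.
have cn : c <= x ^+ n by rewrite leNgt; apply/negP => /minn; rewrite ltnn.
exists n; split => //.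
rewrite leqNgt; apply/negP => nN.
have : x ^+ N <= x ^+ n.+1 by rewrite ler_wiXn2l // ltW.
by move=> /(le_trans cN); rewrite leNgt hn.
Qed.

(** For beta^(n+1) < d <= beta^n the hypothesis gives K x^n = (K / x) x^(n+1), and x^(n+1) <= d^g
    because beta^g = x. Distances above beta^N are covered by the bound M, at the price 2 |M| / x^N;
    distance 0 by letting n grow. *)
Lemma holder_of_geometric (I : Type) (dist : I -> I -> R) (G : set I) (Z : I -> R)
  (x beta K M g : R) N : 0 <= x -> x < 1 -> 0 < beta -> beta < 1 -> 0 < g ->
  beta `^ g = x -> 0 <= K -> (forall t u, 0 <= dist t u) ->
  (forall t, G t -> `|Z t| <= M) ->
  (forall n t u, (N <= n)%N -> G t -> G u -> dist t u <= beta ^+ n ->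
     `|Z t - Z u| <= K * x ^+ n) ->
  exists2 K', 0 <= K' &
    forall t u, G t -> G u -> `|Z t - Z u| <= K' * dist t u `^ g.
Proof.
move=> x0 x1 b0 b1 g0 bx K0 d0 ZM hZ.
have x_gt0 : 0 < x by rewrite -bx powR_gt0.
have xn n : (beta ^+ n) `^ g = x ^+ n by rewrite powRX ?(ltW b0) // bx.
pose M' := `|M|.
have K'0 : 0 <= K / x + 2 * M' / x ^+ N.
  by rewrite addr_ge0 ?divr_ge0 ?exprn_ge0 // mulr_ge0 // normr_ge0.
exists (K / x + 2 * M' / x ^+ N) => // t u Gt Gu.
have [dz|dn] := eqVneq (dist t u) 0.
  rewrite dz powR0 ?gt_eqF // mulr0; apply/ler_addgt0Pr => e e0; rewrite add0r.
  have [M1 hM1] := geometric_small K x0 x1 e0.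
  apply: ltW; apply: le_lt_trans (hM1 (maxn M1 N) (leq_maxl _ _)).
  by apply: hZ => //; rewrite ?leq_maxr // dz exprn_ge0 // ltW.
have dpos : 0 < dist t u by rewrite lt_neqAle eq_sym dn d0.
have [dN|dN] := leP (dist t u) (beta ^+ N).
  have [n [Nn dn1 dn2]] := geometric_bracket b0 b1 dpos dN.
  apply: le_trans (hZ n t u Nn Gt Gu dn1) _.
  apply: (@le_trans _ _ (K / x * dist t u `^ g)); last first.
    by rewrite ler_wpM2r ?powR_ge0 // lerDl divr_ge0 ?exprn_ge0 // mulr_ge0 // normr_ge0.
  have -> : K * x ^+ n = K / x * x ^+ n.+1 by rewrite exprS; field; rewrite gt_eqF.
  rewrite ler_wpM2l ?divr_ge0 // -xn; apply: ge0_ler_powR (ltW dn2);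
    by rewrite ?nnegrE ?exprn_ge0 ?ltW.
apply: (@le_trans _ _ (2 * M')).
  apply: le_trans (ler_normB _ _) _; have := ZM _ Gt; have := ZM _ Gu.
  by have := ler_norm M; rewrite -/M'; lra.
apply: (@le_trans _ _ (2 * M' / x ^+ N * dist t u `^ g)); last first.
  by rewrite ler_wpM2r ?powR_ge0 // lerDr divr_ge0.
rewrite -mulrA ler_peMr ?mulr_ge0 ?normr_ge0 // mulrC ler_pdivlMr ?exprn_gt0 // mul1r.
by rewrite -xn; apply: ge0_ler_powR (ltW dN); rewrite ?nnegrE ?exprn_ge0 ?ltW.
Qed.

End AnalyticEstimates.

(** * Oscillation of cell and cutout functions *)

Section Variation.
Variables (R : realType) (d : nat).

(** J jumps of height h across members of [Fam]. Only the product J h is recorded, since all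
    boundaries share one mass bound. *)
Definition step_variation_le (Fam : set (set 'rV[R]_d)) (V : R) (f : 'rV[R]_d -> R) :=
  exists (J : nat) (h : R) (L : nat -> set 'rV[R]_d),
    [/\ 0 <= h, J%:R * h <= V, (forall j, (j < J)%N -> Fam (L j)) &
        forall x y, `|f x - f y| <= h * \sum_(j < J) `|\1_(L j) x - \1_(L j) y|].

(** If a is in the set and b is not, then b has left Om or lies in a hole that misses a, so one term
    on the right already equals 1. *)
Lemma indic_diff_bigcup (L : nat -> set 'rV[R]_d) (Om : set 'rV[R]_d) M x y :
  `|\1_(Om `\` \bigcup_(j < M) L j) x - \1_(Om `\` \bigcup_(j < M) L j) y| <=
  `|\1_Om x - \1_Om y| + \sum_(j < M) `|\1_(L j) x - \1_(L j) y| :> R.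
Proof.
have key (a b : 'rV[R]_d) : (Om `\` \bigcup_(j < M) L j) a ->
    ~ (Om `\` \bigcup_(j < M) L j) b ->
    1 <= `|\1_Om a - \1_Om b| + \sum_(j < M) `|\1_(L j) a - \1_(L j) b| :> R.
  move=> [Oa La] nb.
  have s0 (J : pred 'I_M) : 0 <= \sum_(j < M | J j) `|\1_(L j) a - \1_(L j) b| :> R.
    by apply: sumr_ge0.
  have [Ob|nOb] := pselect (Om b); last first.
    by rewrite !indicE mem_set // memNset // subr0 normr1 lerDl.
  have [j jM Lb] : exists2 j, (j < M)%N & L j b.
    have := nb; rewrite /setD /= => /not_andP[//|/contrapT[j jM Lb]].
    by exists j.
  rewrite ler_wpDl // (bigD1 (Ordinal jM)) //=.
  rewrite (indicE _ (L j)) memNset; last by move=> La'; apply: La; exists j.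
  by rewrite indicE mem_set // sub0r normrN normr1 lerDl.
have [hx|hx] := pselect ((Om `\` \bigcup_(j < M) L j) x);
have [hy|hy] := pselect ((Om `\` \bigcup_(j < M) L j) y).
- by rewrite !(indicE _ (_ `\` _)) !mem_set // subrr normr0 addr_ge0 // sumr_ge0.
- rewrite !(indicE _ (_ `\` _)) mem_set // memNset // subr0 normr1; exact: key.
- rewrite !(indicE _ (_ `\` _)) memNset // mem_set // sub0r normrN normr1.
  rewrite distrC; under eq_bigr do rewrite distrC; exact: key.
- by rewrite !(indicE _ (_ `\` _)) !memNset // subrr normr0 addr_ge0 // sumr_ge0.
Qed.

Variables (dT : measure_display) (T : measurableType dT) (P : probability T R)
  (mu : nat -> T -> 'rV[R]_d -> R) (Fam : set (set 'rV[R]_d)).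

(** All that the rest of the proof retains of the two types: A is the growth rate of the values,
    kappa that of the number of sets times the height of a jump. *)
Definition regular_steps (C1 A C3 kappa : R) :=
  [/\ (forall n w x, mu n w x <= C1 * A ^+ n),
      (forall n w, measurable_fun (setT : set (Rd R d)) (mu n w)) &
      {ae P, forall w, exists N0, forall n, (N0 <= n)%N ->
         step_variation_le Fam (C3 * kappa ^+ n) (mu n w)}].

Hypothesis mFam : forall L, Fam L -> measurable (L : set (Rd R d)).

Lemma cell_regular (tau zeta alpha C : R) : 0 < C -> cell_type P mu Fam tau zeta C ->
  (forall n w x, mu n w x <= C * 2 `^ (alpha * n%:R)) ->
  exists kappa, 1 <= kappa /\ regular_steps C (2 `^ alpha) (C * C) kappa.
Proof.
move=> C0 [M [Fs [c [FsP muE aeM]]]] mub.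
(* Rate of the number of cells times that of the coefficients; the maximum with 1 makes the powers
   of kappa nondecreasing. *)
pose k0 : R := 2 `^ zeta * 2 `^ tau.
have k00 : 0 <= k0 by rewrite mulr_ge0 ?powR_ge0.
exists (Num.max 1 k0); split; first by rewrite le_max lexx.
split.
- by move=> n w x; rewrite -powR_mulr_nat.
- move=> n w; have -> : mu n w = fun x => \sum_(j < M n w) c n w j * \1_(Fs n w j) x.
    by apply/funext => x; exact: muE.
  apply: measurable_sum => j; apply: measurable_funM => //.
  by apply: measurable_indic; apply: mFam; case: (FsP n w j (ltn_ord j)).
- apply: filterS aeM => w [N0 hN0]; exists N0 => n Nn.
  exists (M n w), (C * 2 `^ (tau * n%:R)), (Fs n w).
  have h0 : 0 <= C * 2 `^ (tau * n%:R) by rewrite mulr_ge0 ?powR_ge0 // ltW.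
  split => //.
  + apply: le_trans (ler_wpM2r h0 (hN0 n Nn)) _; rewrite mulrACA ler_wpM2l ?mulr_ge0 ?(ltW C0) //.
    rewrite !powR_mulr_nat // -exprMn lerXn2r ?nnegrE ?le_max ?lexx ?orbT //.
    by rewrite ler01.
  + by move=> j jM; case: (FsP n w j jM).
  + move=> x y; rewrite !muE -sumrB mulr_sumr; apply: le_trans (ler_norm_sum _ _ _) _.
    apply: ler_sum => j _; have [_ /andP[c0 cC]] := FsP n w j (ltn_ord j).
    by rewrite -mulrBr normrM ger0_norm // ler_wpM2r.
Qed.

Lemma cutout_regular (alpha zeta C : R) : 0 < C -> cutout_type P mu Fam alpha zeta C ->
  exists kappa, 1 <= kappa /\ regular_steps 1 (2 `^ alpha) (C + 1) kappa.
Proof.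
move=> C0 [Om [M [Lam [FOm FLam muE aeM]]]].
pose k0 : R := Num.max 1 (2 `^ zeta) * 2 `^ alpha.
have k1 : 1 <= Num.max 1 (2 `^ zeta) :> R by rewrite le_max lexx.
have k00 : 0 <= k0 by rewrite mulr_ge0 ?powR_ge0 // (le_trans _ k1).
exists (Num.max 1 k0); split; first by rewrite le_max lexx.
have a0 n : 0 <= 2 `^ (alpha * n%:R) :> R by rewrite powR_ge0.
split.
- by move=> n w x; rewrite muE mul1r -powR_mulr_nat //; apply: ler_piMr.
- move=> n w; have -> : mu n w = fun x => 2 `^ (alpha * n%:R) *
           \1_(Om `\` \bigcup_(j < M n w) Lam n w j) x.
    by apply/funext => x; exact: muE.
  apply: measurable_funM => //; apply: measurable_indic.
  apply: measurableD; first exact: mFam.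
  by apply: bigcup_measurable => j jM; apply: mFam; exact: FLam.
- apply: filterS aeM => w [N0 hN0]; exists N0 => n Nn.
  (* Omega counts as one further jump set, at index 0; hence [M.+1] and the constant C + 1. *)
  exists (M n w).+1, (2 `^ (alpha * n%:R)), (fun j => if j is i.+1 then Lam n w i else Om).
  split => //.
  + have z1 : 1 <= Num.max 1 (2 `^ zeta) ^+ n :> R by rewrite exprn_ege1.
    have M1 : (M n w).+1%:R <= (C + 1) * Num.max 1 (2 `^ zeta) ^+ n :> R.
      rewrite -natr1 mulrDl mul1r lerD //; apply: le_trans (hN0 n Nn) _.
      rewrite ler_wpM2l ?(ltW C0) // powR_mulr_nat //.
      by rewrite lerXn2r ?nnegrE ?powR_ge0 ?(le_trans ler01 k1) // le_max lexx orbT.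
    apply: le_trans (ler_wpM2r (a0 n) M1) _.
    rewrite -mulrA ler_wpM2l ?addr_ge0 ?(ltW C0) // powR_mulr_nat // -exprMn.
    by rewrite lerXn2r ?nnegrE ?le_max ?lexx ?orbT // ler01.
  + by move=> [_|j jM]; [exact: FOm|exact: FLam].
  + move=> x y; rewrite !muE -mulrBr normrM ger0_norm // ler_wpM2l //.
    by rewrite big_ord_recl; exact: indic_diff_bigcup.
Qed.

End Variation.

Lemma measure_balls_le (R : realType) d (eta : {measure set (Rd R d) -> \bar R})
  (cs : seq 'rV[R]_d) (e M : R) : (forall c, (eta (eball c e) <= M%:E)%E) ->
  measurable (\big[setU/set0]_(c <- cs) eball c e : set (Rd R d)) /\
  (eta (\big[setU/set0]_(c <- cs) eball c e) <= ((size cs)%:R * M)%:E)%E.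
Proof.
move=> hM; elim: cs => [|c cs [IH1 IH2]].
  by rewrite big_nil mul0r measure0.
rewrite big_cons; split; first by apply: measurableU => //; exact: measurable_eball.
have mc := measurable_eball c e.
apply: le_trans (measureU2 _ mc IH1) _.
rewrite /= -natr1 mulrDl mul1r addrC EFinD; exact: leeD.
Qed.

(** * Comparison at the scales beta^n *)

Section GeometricScales.
Variables (R : realType) (d m : nat) (Gam : set (param R d m.+1))
  (eta : param R d m.+1 -> {measure set (Rd R d) -> \bar R})
  (Fam : set (set 'rV[R]_d)) (b A1 s gamma1 Cs Cc : R).
Hypotheses (b_gt0 : 0 < b) (b_lt1 : b < 1) (A1_ge0 : 0 <= A1).
Hypothesis Gcon : forall t, Gam t -> contractions b t.1.
Hypothesis Gcod : forall t, Gam t -> coding_bound A1 t.1.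
Hypothesis Gprob : forall t, Gam t -> prob_weights t.
Hypothesis Geta : forall t, Gam t -> selfsim_measure t (eta t).
Hypotheses (Cs_ge0 : 0 <= Cs) (Cc_ge0 : 0 <= Cc) (g_gt0 : 0 < gamma1) (g_lts : gamma1 < s).
Hypothesis frost : forall x t r, Gam t -> 0 < r -> r < 1 ->
  (eta t (eball x r) <= (Cs * r `^ s)%:E)%E.
Hypothesis cover : forall eps, 0 < eps -> eps < 1 -> forall t, Gam t ->
  forall L, Fam L -> exists cs : seq 'rV[R]_d,
    (size cs)%:R <= Cc * eps `^ (- gamma1) /\
    nbhd_eps (boundary L) eps `&` attractor t.1
      `<=` [set x | exists2 c, c \in cs & eball c eps x].

Lemma boundary_mass t L eps : Gam t -> Fam L -> 0 < eps -> eps < 1 ->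
  exists B : set (Rd R d), [/\ measurable B,
    (eta t B <= (Cc * Cs * eps `^ (s - gamma1))%:E)%E &
    nbhd_eps (boundary L) eps `&` attractor t.1 `<=` B].
Proof.
move=> Gt FL e0 e1; have [cs [szcs sub]] := cover e0 e1 Gt FL.
have hM c := frost c Gt e0 e1.
have [mB leB] := measure_balls_le cs hM.
exists (\big[setU/set0]_(c <- cs) eball c eps); split => //.
  apply: le_trans leB _; rewrite lee_fin.
  have M0 : 0 <= Cs * eps `^ s by rewrite mulr_ge0 // powR_ge0.
  apply: le_trans (ler_wpM2r M0 szcs) _.
  have -> : eps `^ (s - gamma1) = eps `^ (- gamma1) * eps `^ s.
    by rewrite -powRD ?(gt_eqF e0) ?implybT // addrC.
  by rewrite le_eqVlt; apply/orP; left; apply/eqP; ring.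
move=> x /sub[c ccs xc]; rewrite -bigcup_seq.
by exists c.
Qed.

Lemma compare_level L n t u (f : 'rV[R]_d -> R) (V Mf : R) :
  Gam t -> Gam u -> pdist t u <= (b ^+ L) ^+ n ->
  (2 + A1) * (b ^+ L) ^+ n < 1 ->
  measurable_fun (setT : set (Rd R d)) f -> (forall x, 0 <= f x <= Mf) ->
  step_variation_le Fam V f ->
  `|fine (\int[eta t]_x (f x)%:E) - word_sum u (L * n) f| <=
   V * (Cc * Cs * ((2 + A1) * (b ^+ L) ^+ n) `^ (s - gamma1))
   + (L * n)%:R * (m.+1%:R * (b ^+ L) ^+ n) * Mf.
Proof.
move=> Gt Gu tu e1 mf f0 [J [h [Lm [h0 JV FL fL]]]].
(* eps strictly exceeds beta^n + A1 beta^n, the distance at which words of length L n couple t and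
   u. *)
set beta := b ^+ L in tu e1 *; set eps := (2 + A1) * beta ^+ n.
have be0 : 0 < beta ^+ n by rewrite !exprn_gt0.
have A2 : 0 < 2 + A1 by have := A1_ge0; lra.
have eps0 : 0 < eps by rewrite mulr_gt0.
have [dS [S [bet [xi [hcyl heta]]]]] := Geta Gt.
have hd : pdist t u + b ^+ (L * n) * A1 < eps.
  rewrite exprM -/beta /eps; apply: (@le_lt_trans _ _ (beta ^+ n + beta ^+ n * A1)).
    by rewrite lerD2r.
  by rewrite mulrDl mulrC [A1 * _]mulrC ltrD2r; have := be0; lra.
have hB j : (j < J)%N -> exists B : set (Rd R d), [/\ measurable B,
    (eta t B <= (Cc * Cs * eps `^ (s - gamma1))%:E)%E &
    nbhd_eps (boundary (Lm j)) eps `&` attractor t.1 `<=` B].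
  by move=> jJ; apply: boundary_mass => //; exact: FL.
have := word_sum_compare (ltW b_gt0) b_lt1 (Gcon Gt) (Gcod Gt) hcyl heta
  (Gcon Gu) (Gcod Gu) (Gprob Gt) (Gprob Gu) mf f0 h0 fL hB hd.
move=> /le_trans; apply; apply: lerD.
  rewrite mulrA ler_wpM2r // 1?mulrC // mulr_ge0 ?powR_ge0 // mulr_ge0 //.
have Mf0 : 0 <= Mf by case/andP: (f0 0) => h1 h2; exact: le_trans h2.
apply: ler_wpM2r => //; apply: ler_wpM2l => //.
apply: (@le_trans _ _ (\sum_(i < m.+1) beta ^+ n)).
  by apply: ler_sum => i _; exact: le_trans (pdist_weight t u i) tu.
by rewrite sumr_const card_ord mulr_natl.
Qed.

Lemma frostman_level L n u (k : 'I_d -> int) : Gam u -> b ^+ L <= 1 / 2 ->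
  \sum_(v : {ffun 'I_(L * n) -> 'I_m.+1} | word_point u v \in @dcube R d n k)
     word_weight u v <=
  (Cs + 1) * (d%:R + A1 + 1) `^ s * ((2 `^ s)^-1) ^+ n.
Proof.
move=> Gu bL; set mass := \sum_(v | _) _.
have s0 : 0 < s by exact: lt_trans g_lts.
pose h : R := (1 / 2) ^+ n; have h0 : 0 < h by rewrite exprn_gt0.
pose c : 'rV[R]_d := \row_i ((k i)%:~R / 2 ^+ n.+1).
pose r := (d%:R + A1 + 1) * h.
have D0 : 0 < d%:R + A1 + 1 :> R by have := A1_ge0; have : 0 <= d%:R :> R by []; lra.
have r0 : 0 < r by rewrite mulr_gt0.
have p2 : 0 < 2 ^+ n :> R by rewrite exprn_gt0.
have hE : h = (2 ^+ n)^-1 by rewrite /h mul1r exprVn.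
have rs : r `^ s = (d%:R + A1 + 1) `^ s * ((2 `^ s)^-1) ^+ n.
  rewrite /r powRM ?(ltW D0) ?(ltW h0) //; congr (_ * _).
  rewrite /h powRX //; congr (_ ^+ _).
  have p2s : 2 `^ s != 0 :> R by rewrite gt_eqF // powR_gt0.
  apply: (mulIf p2s); rewrite mulVf // -powRM // divfK ?powR1 //.
rewrite -mulrA -rs.
have rs0 : 0 <= r `^ s by rewrite powR_ge0.
have [r1|r1] := ltP r 1; last first.
  apply: (@le_trans _ _ 1).
    rewrite -(word_weight_sum (L * n) (Gprob Gu)) [leRHS](bigID (fun v => word_point u v \in @dcube R d n k)) /=.
    by rewrite lerDl; apply: sumr_ge0 => v _; apply: word_weight_ge0; exact: Gprob.
  have : 1 <= r `^ s by rewrite -(powRr0 r) ler_powR // ltW.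
  by have := Cs_ge0; nra.
have [dS [S [bet [xi [hcyl heta]]]]] := Geta Gu.
have near x : @dcube R d n k x -> eucl (x - c) <= d%:R * (h / 2).
  move=> kx; apply: eucl_le_max => i; rewrite !mxE.
  have [h1 h2] := kx i; rewrite ger0_norm ?subr_ge0 //.
  rewrite lerBlDl; apply: le_trans (ltW h2) _.
  by rewrite intrD mulrDl lerD2l mul1r exprS invfM hE mulrC.
have rlt : d%:R * (h / 2) + b ^+ (L * n) * A1 < r.
  have : b ^+ (L * n) <= h.
    by rewrite exprM lerXn2r ?nnegrE ?exprn_ge0 ?(ltW b_gt0) // divr_ge0.
  move=> bh; have : b ^+ (L * n) * A1 <= h * A1 by rewrite ler_wpM2r.
  have : 0 <= d%:R * h :> R by rewrite mulr_ge0 // ltW.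
  by rewrite /r !mulrDl; have := h0; lra.
have := word_mass_le (ltW b_gt0) b_lt1 (Gcon Gu) (Gcod Gu) hcyl heta near rlt.
move=> /le_trans /(_ (frost c Gu r0 r1)); rewrite lee_fin => /le_trans; apply.
by rewrite ler_wpM2r // lerDl.
Qed.

Variables (A C1 C3 kappa : R).
Hypotheses (A_gt0 : 0 < A) (C1_ge0 : 0 <= C1) (C3_ge0 : 0 <= C3) (kappa_ge1 : 1 <= kappa).

(** The conditions let words of length L n resolve the scale 2^(-n), leave room for the factor n in
    the weight error, and make the boundary mass beat the variation kappa^n. *)
Lemma exists_scale : exists L : nat,
  [/\ b ^+ L <= 1 / 2, 4 * (b ^+ L * A) <= 1 & kappa * (b ^+ L) `^ (s - gamma1) <= 1 / 2].
Proof.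
have b0 := ltW b_gt0; have half : 0 < 1 / 2 :> R by [].
have sg : 0 < s - gamma1 by rewrite subr_gt0.
have bs0 : 0 <= b `^ (s - gamma1) by exact: powR_ge0.
have bs1 : b `^ (s - gamma1) < 1.
  have -> : 1 = 1 `^ (s - gamma1) :> R by rewrite powR1.
  by rewrite gt0_ltr_powR // nnegrE.
have [N1 h1] := geometric_small 1 b0 b_lt1 half.
have [N2 h2] := geometric_small (4 * A) b0 b_lt1 (@ltr01 R).
have [N3 h3] := geometric_small kappa bs0 bs1 half.
exists (maxn N1 (maxn N2 N3)); set L := maxn _ _; split.
- by have := h1 L (leq_maxl _ _); rewrite mul1r => /ltW.
- have := h2 L; rewrite leq_max leq_maxl orbT => /(_ isT) /ltW.
  by rewrite -mulrA (mulrC A).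
- have := h3 L; rewrite !leq_max leqnn !orbT => /(_ isT) /ltW.
  by rewrite powRX.
Qed.

Lemma compare_geometric L : b ^+ L <= 1 / 2 -> 4 * (b ^+ L * A) <= 1 ->
  kappa * (b ^+ L) `^ (s - gamma1) <= 1 / 2 ->
  exists C5 N1, 0 <= C5 /\ forall n k t u (f : 'rV[R]_d -> R), (N1 <= n)%N ->
    (n <= k <= n.+1)%N -> Gam t -> Gam u -> pdist t u <= (b ^+ L) ^+ n ->
    measurable_fun (setT : set (Rd R d)) f -> (forall x, 0 <= f x <= C1 * A ^+ k) ->
    step_variation_le Fam (C3 * kappa ^+ k) f ->
    `|fine (\int[eta t]_x (f x)%:E) - word_sum u (L * n) f| <= C5 * (1 / 2) ^+ n.
Proof.
move=> hL1 hL2 hL3; set beta := b ^+ L in hL1 hL2 hL3 *.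
have be0 : 0 < beta by rewrite exprn_gt0.
have be1 : beta < 1 by apply: le_lt_trans hL1 _; lra.
have A20 : 0 <= 2 + A1 by have := A1_ge0; lra.
have [N1 hN1] := geometric_small (2 + A1) (ltW be0) be1 (@ltr01 R).
have kap0 : 0 <= kappa by rewrite (le_trans _ kappa_ge1).
pose K1 := C3 * kappa * (Cc * Cs * (2 + A1) `^ (s - gamma1)).
pose K2 := L%:R * m.+1%:R * (C1 * Num.max 1 A).
have mA1 : 1 <= Num.max 1 A by rewrite le_max lexx.
have K10 : 0 <= K1.
  by rewrite mulr_ge0 ?mulr_ge0 ?powR_ge0 ?mulr_ge0.
have K20 : 0 <= K2.
  by rewrite !mulr_ge0 // (le_trans ler01 mA1).
exists (K1 + K2), N1; split; first by rewrite addr_ge0.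
move=> n k t u f Nn nk Gt Gu tu mf f0 vf.
have := compare_level (L := L) Gt Gu tu (hN1 n Nn) mf f0 vf.
move=> /le_trans; apply; rewrite -/beta [leRHS]mulrDl; apply: lerD.
  have sgm : 0 <= kappa * beta `^ (s - gamma1) by rewrite mulr_ge0 ?powR_ge0.
  have bn0 : 0 <= beta ^+ n by rewrite exprn_ge0 // ltW.
  rewrite (powRM _ A20 bn0) powRX ?(ltW be0) //.
  apply: (@le_trans _ _ (K1 * (kappa * beta `^ (s - gamma1)) ^+ n)); last first.
    by rewrite ler_wpM2l // lerXn2r ?nnegrE.
  rewrite exprMn /K1.
  have kk : kappa ^+ k <= kappa * kappa ^+ n.
    rewrite -exprS; apply: ler_weXn2l => //; by case/andP: nk.
  have -> : C3 * kappa ^+ k * (Cc * Cs * ((2 + A1) `^ (s - gamma1) * beta `^ (s - gamma1) ^+ n)) =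
    kappa ^+ k * (C3 * (Cc * Cs * (2 + A1) `^ (s - gamma1)) * beta `^ (s - gamma1) ^+ n) by ring.
  have -> : C3 * kappa * (Cc * Cs * (2 + A1) `^ (s - gamma1)) *
      (kappa ^+ n * beta `^ (s - gamma1) ^+ n) =
    kappa * kappa ^+ n * (C3 * (Cc * Cs * (2 + A1) `^ (s - gamma1)) * beta `^ (s - gamma1) ^+ n) by ring.
  apply: ler_wpM2r kk; apply: mulr_ge0; last by rewrite exprn_ge0 // powR_ge0.
  by rewrite mulr_ge0 // mulr_ge0 ?powR_ge0 // mulr_ge0.
have Ak : A ^+ k <= Num.max 1 A * A ^+ n.
  have [kn|kn] : k = n \/ k = n.+1.
    by case/andP: nk; rewrite leq_eqVlt => /orP[/eqP|] ? ?; [left|right; apply/eqP; rewrite eqn_leq; apply/andP].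
  - by rewrite kn ler_peMl // exprn_ge0 // ltW.
  - by rewrite kn exprS ler_wpM2r ?exprn_ge0 ?(ltW A_gt0) // le_max lexx orbT.
(* The weight error is linear in the word length; with beta A <= 1/4 it is of order n 4^(-n) <=
   2^(-n). *)
have n2 : n%:R <= 2 ^+ n :> R by rewrite -natrX ler_nat ltnW // ltn_expl.
have q4 : (beta * A) ^+ n <= ((1 / 2) * (1 / 2)) ^+ n.
  rewrite lerXn2r ?nnegrE ?mulr_ge0 ?(ltW be0) ?(ltW A_gt0) //.
  by move: hL2; lra.
have hn : 0 <= (1 / 2) ^+ n :> R by rewrite exprn_ge0.
apply: (@le_trans _ _ (K2 * (n%:R * (beta * A) ^+ n))).
  rewrite natrM exprMn /K2.
  have -> : L%:R * n%:R * (m.+1%:R * beta ^+ n) * (C1 * A ^+ k) =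
    (L%:R * n%:R * (m.+1%:R * beta ^+ n) * C1) * A ^+ k by ring.
  have -> : L%:R * m.+1%:R * (C1 * Num.max 1 A) * (n%:R * (beta ^+ n * A ^+ n)) =
    (L%:R * n%:R * (m.+1%:R * beta ^+ n) * C1) * (Num.max 1 A * A ^+ n) by ring.
  by rewrite ler_wpM2l // !mulr_ge0 // exprn_ge0 // ltW.
rewrite ler_wpM2l //.
have -> : (1 / 2) ^+ n = 2 ^+ n * ((1 / 2) * (1 / 2)) ^+ n :> R.
  by rewrite -exprMn; congr (_ ^+ _); field.
by apply: ler_pM => //; rewrite exprn_ge0 // mulr_ge0 ?(ltW be0) // ltW.
Qed.

End GeometricScales.

(** * Uniform convergence and Hoelder continuity *)

Lemma borel_cantelli_geometric (R : realType) d (T : measurableType d)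
  (P : probability T R) (E : nat -> set T) (K : R) : 0 <= K ->
  (forall n, measurable (E n)) -> (forall n, fine (P (E n)) <= K * (1 / 2) ^+ n) ->
  {ae P, forall w, exists N, forall n, (N <= n)%N -> ~ E n w}.
Proof.
move=> K0 mE hE.
have PE n : (P (E n) <= (K * (1 / 2) ^+ n)%:E)%E.
  by rewrite -[P (E n)]fineK ?fin_num_measure // lee_fin.
have sum_lt : (\sum_(n <oo) P (E n) < +oo)%E.
  apply: (@le_lt_trans _ _ (2 * K)%:E); last exact: ltry.
  apply: lime_le; first by apply: is_cvg_nneseries.
  apply: nearW => n; apply: (@le_trans _ _ (\sum_(0 <= i < n) (K * (1 / 2) ^+ i)%:E)%E).
    by apply: lee_sum => i _.
  rewrite sumEFin lee_fin.
  have : forall k, \sum_(0 <= i < k) K * (1 / 2) ^+ i = 2 * K - 2 * K * (1 / 2) ^+ k.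
    elim=> [|k IH]; first by rewrite big_nil mulr1 subrr.
    by rewrite big_nat_recr //= IH exprS; field.
  by move=> ->; rewrite gerBl mulr_ge0 ?exprn_ge0 // mulr_ge0.
have null := lim_sup_set_cvg0 mE sum_lt.
exists (lim_sup_set E); split => //.
  apply: bigcapT_measurable => n; apply: bigcup_measurable => k _; exact: mE.
move=> w /= hw n _; apply: contrapT => hn; apply: hw; exists n => k nk Ek.
by apply: hn; exists k.
Qed.

(** * The deterministic argument for a fixed path *)

Section Pathwise.
Variables (R : realType) (I : Type) (dist : I -> I -> R) (G : set I)
  (Y : nat -> I -> R) (S : nat -> nat -> I -> R) (net : nat -> I -> Prop)
  (beta C1 A C5 C8 delta : R) (N0 : nat).
Hypotheses (C5_ge0 : 0 <= C5) (C8_ge0 : 0 <= C8) (delta_ge0 : 0 <= delta)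
  (delta_lt1 : delta < 1).
Hypothesis dist_refl : forall t, dist t t = 0.
Hypothesis beta_gt0 : 0 < beta.
Hypothesis YS : forall n k t u, (N0 <= n)%N -> (n <= k <= n.+1)%N -> G t -> G u ->
  dist t u <= beta ^+ n -> `|Y k t - S n k u| <= C5 * (1 / 2) ^+ n.
Hypothesis netG : forall n u, net n u -> G u.
Hypothesis netP : forall n t, G t -> exists2 u, net n u & dist t u <= beta ^+ n.
Hypothesis SS : forall n u, (N0 <= n)%N -> net n u ->
  `|S n n.+1 u - S n n u| <= C8 * delta ^+ n * (1 + S n n u).
Hypothesis Y_ge0 : forall n t, 0 <= Y n t.
Hypothesis Y_le : forall n t, G t -> Y n t <= C1 * A ^+ n.

Local Notation x := (Num.max (1 / 2) delta).

Lemma rate_bounds : [/\ 0 < x, x < 1, (forall n, (1 / 2) ^+ n <= x ^+ n),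
  (forall n, delta ^+ n <= x ^+ n) & forall n, x ^+ n <= 1].
Proof.
have x0 : 0 < x by rewrite lt_max; apply/orP; left; lra.
have x1 : x < 1 by rewrite gt_max delta_lt1 andbT; lra.
split => // n.
- by rewrite lerXn2r ?nnegrE ?(ltW x0) // le_max lexx.
- by rewrite lerXn2r ?nnegrE ?(ltW x0) // le_max lexx orbT.
- by rewrite exprn_ile1 // ltW.
Qed.

(** [S n k u] stands for the sum of mu_k over the words of level n. From Y at t one passes to the
    word sum at a near net point, takes its increment and returns: 2 C5 pays for the two
    comparisons, and 1 + C5 converts 1 + S into 1 + Y. *)
Lemma pathwise_step n t : (N0 <= n)%N -> G t ->
  `|Y n.+1 t - Y n t| <= (2 * C5 + C8 * (1 + C5)) * x ^+ n * (1 + Y n t).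
Proof.
move=> Nn Gt; have [x0 x1 xh xd xle] := rate_bounds.
have [u nu tu] := netP n Gt; have Gu := netG nu.
have h1 := YS (k := n) Nn _ Gt Gu tu; have h2 := YS (k := n.+1) Nn _ Gt Gu tu.
have {h1}h1 := h1 (introT andP (conj (leqnn n) (leqnSn n))).
have {h2}h2 := h2 (introT andP (conj (leqnSn n) (leqnn n.+1))).
have h3 := SS Nn nu; have y0 := Y_ge0 n t.
set a := Y n.+1 t in h2 *; set e := Y n t in h1 y0 *.
set p := S n n.+1 u in h2 h3; set r := S n n u in h1 h3.
have xn0 : 0 <= x ^+ n by rewrite exprn_ge0 // ltW.
have c5 : C5 * (1 / 2) ^+ n <= C5 * x ^+ n by rewrite ler_wpM2l.
have c5' : C5 * x ^+ n <= C5 by rewrite ler_piMr.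
have re : 1 + r <= (1 + e) * (1 + C5).
  have : `|e - r| <= C5 by apply: le_trans h1 _; exact: le_trans c5'.
  rewrite ler_norml => /andP[h4 h5]; have : 0 <= e * C5 by rewrite mulr_ge0.
  by rewrite mulrDl !mulrDr; lra.
have h6 : C8 * delta ^+ n * (1 + r) <= C8 * (1 + C5) * x ^+ n * (1 + e).
  have cd : C8 * delta ^+ n <= C8 * x ^+ n by rewrite ler_wpM2l.
  have cd0 : 0 <= C8 * delta ^+ n by rewrite mulr_ge0 // exprn_ge0.
  apply: (le_trans (ler_wpM2l cd0 re)).
  have -> : C8 * (1 + C5) * x ^+ n * (1 + e) = C8 * x ^+ n * ((1 + e) * (1 + C5)) by ring.
  by apply: ler_wpM2r cd; rewrite mulr_ge0 // addr_ge0.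
have h7 : C5 * x ^+ n <= C5 * x ^+ n * (1 + e).
  by rewrite ler_peMr ?mulr_ge0 // lerDl.
have tri : `|a - e| <= `|a - p| + `|p - r| + `|e - r|.
  have -> : a - e = (a - p) + (p - r) - (e - r) by ring.
  apply: le_trans (ler_normB _ _) _; rewrite lerD2r; exact: ler_normD.
apply: (le_trans tri).
have -> : (2 * C5 + C8 * (1 + C5)) * x ^+ n * (1 + e) =
  C5 * x ^+ n * (1 + e) + C8 * (1 + C5) * x ^+ n * (1 + e) + C5 * x ^+ n * (1 + e).
  by ring.
apply: lerD; first apply: lerD.
- exact: le_trans h2 (le_trans c5 h7).
- exact: le_trans h3 h6.
- exact: le_trans h1 (le_trans c5 h7).
Qed.

(** Gronwall bounds 1 + Y by [c10] from N0 on, after which the relative increments are geometric.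
    The last estimate passes through the word sum of [u] at level n, which is close to Y n at both t
    and u. *)
Lemma pathwise_limit : exists (Z : I -> R) (Kc M : R),
  [/\ 0 <= Kc, 
      (forall n t, (N0 <= n)%N -> G t -> `|Y n t - Z t| <= Kc * x ^+ n),
      (forall t, G t -> `|Z t| <= M) &
      (forall n t u, (N0 <= n)%N -> G t -> G u -> dist t u <= beta ^+ n ->
         `|Z t - Z u| <= (2 * Kc + 2 * C5) * x ^+ n)].
Proof.
have [x0 x1 xh xd xle] := rate_bounds.
have x10 : 0 < 1 - x by rewrite subr_gt0.
pose c9 := 2 * C5 + C8 * (1 + C5).
have c90 : 0 <= c9.
  by rewrite addr_ge0 // mulr_ge0 // addr_ge0.
pose c10 := (1 + `|C1 * A ^+ N0|) * expR (c9 / (1 - x)).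
have c100 : 0 <= c10 by rewrite mulr_ge0 ?expR_ge0 // addr_ge0.
have Ybd n t : (N0 <= n)%N -> G t -> 1 + Y n t <= c10.
  move=> Nn Gt.
  apply: le_trans (@discrete_gronwall R (Y ^~ t) c9 x N0 (ltW x0) x1 c90
    (Y_ge0^~ t) (fun n Nn => pathwise_step Nn Gt) n Nn) _.
  rewrite ler_wpM2r ?expR_ge0 // lerD2l; apply: le_trans (Y_le N0 Gt) _; exact: ler_norm.
have c0 : 0 <= c9 * c10 by rewrite mulr_ge0.
have step n t : (N0 <= n)%N -> G t -> `|Y n.+1 t - Y n t| <= c9 * c10 * x ^+ n.
  move=> Nn Gt; apply: le_trans (pathwise_step Nn Gt) _; rewrite -/c9.
  rewrite mulrAC ler_wpM2r ?exprn_ge0 ?(ltW x0) // ler_wpM2l //; exact: Ybd.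
have /choice[Z ZP] : forall t, exists l, G t -> forall n, (N0 <= n)%N ->
    `|Y n t - l| <= c9 * c10 / (1 - x) * x ^+ n.
  move=> t; have [Gt|nG] := pselect (G t); last by exists 0.
  have [l hl] := @geometric_limit R (Y^~ t) _ x N0 (ltW x0) x1 c0
    (fun n Nn => step n t Nn Gt).
  by exists l.
pose Kc := c9 * c10 / (1 - x).
have Kc0 : 0 <= Kc by rewrite divr_ge0 // ltW.
exists Z, Kc, (Kc + c10); split => //.
- by move=> n t Nn Gt; exact: ZP.
- move=> t Gt; have h := ZP t Gt N0 (leqnn N0); have hY := Ybd N0 t (leqnn N0) Gt.
  have hK : Kc * x ^+ N0 <= Kc by rewrite ler_piMr.
  have y0 := Y_ge0 N0 t.
  have -> : Z t = Y N0 t - (Y N0 t - Z t) by ring.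
  apply: le_trans (ler_normB _ _) _; rewrite addrC; apply: lerD.
    exact: le_trans h hK.
  by rewrite ger0_norm //; lra.
move=> n t u Nn Gt Gu tu.
have nn : (n <= n <= n.+1)%N by rewrite leqnn leqnSn.
have h1 := YS Nn nn Gt Gu tu.
have uu : dist u u <= beta ^+ n by rewrite dist_refl exprn_ge0 // ltW.
have h2 := YS Nn nn Gu Gu uu.
have h3 := ZP t Gt n Nn; have h4 := ZP u Gu n Nn; rewrite -/Kc in h3 h4.
have c5 : C5 * (1 / 2) ^+ n <= C5 * x ^+ n by rewrite ler_wpM2l.
have -> : Z t - Z u = (Y n u - Z u) - (Y n t - Z t) + (Y n t - S n n u) - (Y n u - S n n u).
  by ring.
have -> : (2 * Kc + 2 * C5) * x ^+ n = Kc * x ^+ n + Kc * x ^+ n + C5 * x ^+ n + C5 * x ^+ n.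
  by ring.
apply: le_trans (ler_normB _ _) _; apply: lerD; last exact: le_trans h2 c5.
apply: le_trans (ler_normD _ _) _; apply: lerD; last exact: le_trans h1 c5.
by apply: le_trans (ler_normB _ _) _; apply: lerD.
Qed.

End Pathwise.

(* The supremum defining the constant runs over countably many parameters only,
   so that it is measurable. *)
Lemma measurable_holder_constant (R : realType) d (T : measurableType d) (I : Type)
  (dist : I -> I -> R) (S : nat -> I -> T -> R) (r : nat * nat -> I) (g : R) :
  (forall n t, measurable_fun setT (S n t)) -> (forall t u, 0 <= dist t u) ->
  exists2 K : T -> R, measurable_fun setT K &
    forall w (Z : I -> R) K0, 0 <= K0 ->
      (forall i, S n (r i) w @[n --> \oo] --> Z (r i)) ->
      (forall i j, `|Z (r i) - Z (r j)| <= K0 * dist (r i) (r j) `^ g) ->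
      0 <= K w /\
      forall i j, `|Z (r i) - Z (r j)| <= K w * dist (r i) (r j) `^ g.
Proof.
move=> mS dist0.
(* Enumerates the pairs of indices, with a default pair off the range of [pickle]. *)
pose pr k : (nat * nat) * (nat * nat) := odflt ((0, 0), (0, 0))%N (unpickle k).
pose D k : R := dist (r (pr k).1) (r (pr k).2) `^ g.
pose q k n w : R := `|S n (r (pr k).1) w - S n (r (pr k).2) w| / D k.
(* The upper limit is measurable whether or not the sums converge; where they do, it is the quotient
   of the limits. A zero denominator gives the quotient 0. *)
pose f k w : \bar R := limn_esup (fun n => (q k n w)%:E).
pose K w := fine (esups (f ^~ w) 0%N).
have mf k : measurable_fun setT (f k).
  apply: measurable_fun_limn_esup => n; apply/measurable_EFinP.
  apply: measurable_funM => //; apply: measurableT_comp => //.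
  exact: measurable_funB.
exists K.
  apply: measurableT_comp; first exact: fine_measurable.
  exact: measurable_fun_esups.
move=> w Z K0 K00 SZ ZK.
have fE k : f k w = (`|Z (r (pr k).1) - Z (r (pr k).2)| / D k)%:E.
  have cv : (q k n w)%:E @[n --> \oo] --> (`|Z (r (pr k).1) - Z (r (pr k).2)| / D k)%:E.
    apply: cvg_EFin; first by apply: nearW.
    apply: cvgMl; apply: cvg_norm; exact: cvgB.
  rewrite /f is_cvg_limn_esupE; first exact: (cvg_lim _ cv).
  by apply/cvg_ex; exists (`|Z (r (pr k).1) - Z (r (pr k).2)| / D k)%:E.
have D0 k : 0 <= D k by exact: powR_ge0.
have fK k : (f k w <= K0%:E)%E.
  rewrite fE lee_fin; have [->|Dn] := eqVneq (D k) 0; first by rewrite invr0 mulr0.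
  by rewrite ler_pdivrMr ?lt_def ?Dn ?D0 // ZK.
have f0 k : (0 <= f k w)%E by rewrite fE lee_fin divr_ge0.
have inset k : [set f k w | k in [set k | (0 <= k)%N]] (f k w) by exists k.
have supK : (esups (f ^~ w) 0%N <= K0%:E)%E.
  by apply: ge_ereal_sup => _ [k _ <-].
have sup_ub k : (f k w <= esups (f ^~ w) 0%N)%E.
  by apply: ereal_sup_ubound; exact: inset.
have supfin : esups (f ^~ w) 0%N \is a fin_num.
  rewrite ge0_fin_numE; last exact: le_trans (f0 0%N) (sup_ub 0%N).
  by apply: le_lt_trans supK _; rewrite ltry.
have Kub k : `|Z (r (pr k).1) - Z (r (pr k).2)| / D k <= K w.
  by rewrite -lee_fin -fE /K fineK.
split.
  by apply: le_trans (Kub 0%N); rewrite divr_ge0.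
move=> i j; have := Kub (pickle (i, j)); rewrite /D /pr pickleK /=.
have [dz|dn] := eqVneq (dist (r i) (r j) `^ g) 0.
  by move=> _; have := ZK i j; rewrite dz !mulr0.
by rewrite ler_pdivrMr // lt_def dn powR_ge0.
Qed.

(** Indexing by [nat] with default [t0] lets the nets of all scales form one family over [nat * nat]
    whose members all lie in [Gam]. *)
Lemma total_net (R : realType) (T : Type) (Gam : set T) (t0 : T) (dist : T -> T -> R)
  (N e : R) : Gam t0 ->
  (exists (n : nat) (rep : 'I_n -> T), [/\ n%:R <= N, (forall i, Gam (rep i)) &
     forall t, Gam t -> exists i, dist t (rep i) <= e]) ->
  exists p : nat * (nat -> T), [/\ p.1%:R <= N, (forall i, Gam (p.2 i)) &
     forall t, Gam t -> exists2 i, (i < p.1)%N & dist t (p.2 i) <= e].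
Proof.
move=> G0 [n [rep [nN Gr hr]]].
exists (n, fun i => if insub i is Some j then rep j else t0); split => //=.
  by move=> i; case: insubP.
move=> t /hr[i hi]; exists i => //; by rewrite valK.
Qed.

(** * Choice of the Chernoff parameters and assembly *)

Section UniformHolder.
Variables (R : realType) (d m : nat) (dT : measure_display) (T : measurableType dT)
  (P : probability T R) (B : nat -> set (set T)) (mu : nat -> T -> 'rV[R]_d -> R)
  (C : R) (Gam : set (param R d m.+1))
  (eta : param R d m.+1 -> {measure set (Rd R d) -> \bar R})
  (Fam : set (set 'rV[R]_d)) (b A1 s gamma1 Cs Cc A C1 C3 kappa y : R).
Hypothesis SI : SI_martingale P B mu C.
Hypotheses (b_gt0 : 0 < b) (b_lt1 : b < 1) (A1_ge0 : 0 <= A1).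
Hypothesis Gsim : forall t, Gam t -> forall i, exists2 r, r <= b & is_sim r (t.1 i).
Hypothesis Gcod : forall t, Gam t -> coding_bound A1 t.1.
Hypothesis Gprob : forall t, Gam t -> prob_weights t.
Hypothesis Geta : forall t, Gam t -> selfsim_measure t (eta t).
Hypotheses (Cs_ge0 : 0 <= Cs) (Cc_ge0 : 0 <= Cc) (g_gt0 : 0 < gamma1) (g_lts : gamma1 < s).
Hypothesis frost : forall x t r, Gam t -> 0 < r -> r < 1 ->
  (eta t (eball x r) <= (Cs * r `^ s)%:E)%E.
Hypothesis cover : forall eps, 0 < eps -> eps < 1 -> forall t, Gam t ->
  forall L, Fam L -> exists cs : seq 'rV[R]_d,
    (size cs)%:R <= Cc * eps `^ (- gamma1) /\
    nbhd_eps (boundary L) eps `&` attractor t.1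
      `<=` [set x | exists2 c, c \in cs & eball c eps x].
Hypotheses (A_gt0 : 0 < A) (C1_gt0 : 0 < C1) (C3_ge0 : 0 <= C3) (kappa_ge1 : 1 <= kappa).
Hypothesis mu_reg : regular_steps P mu Fam C1 A C3 kappa.
Hypotheses (y_gt1 : 1 < y) (Ay : A * y ^+ 4 = 2 `^ s).

Let b_ge0 := ltW b_gt0.
Let Gcon t (Gt : Gam t) : contractions b t.1 := Gam_contractions Gsim Gt.
Let mA := Num.max 1 A.
Let C2 := (Cs + 1) * (d%:R + A1 + 1) `^ s.
Let C6 := C2 * (C1 * mA).
Let q := (Num.truncn (2 * C)).+1.
Let Q : R := (q.+1 ^ d)%:R.
Let mass n := C2 * ((2 `^ s)^-1) ^+ n.
(** One bound has to serve mu_n and mu_(n+1); [mA] absorbs the extra factor A. *)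
Let Mx n := C1 * mA * A ^+ n.
(** Since [mass n * Mx n] is C6 y^(-4n), its product with lam_n is y^(-2n) / 2, within the 1/2 that
    the tail bound allows, and the threshold y^n contributes y^n / lam_n = 2 C6 y^(-n). *)
Let lam n := y ^+ (2 * n) / (2 * C6).

Let y_gt0 : 0 < y. Proof. exact: lt_trans ltr01 y_gt1. Qed.
Let mA_ge1 : 1 <= mA. Proof. by rewrite le_max lexx. Qed.
Let mA_gt0 : 0 < mA. Proof. exact: lt_le_trans ltr01 mA_ge1. Qed.
Let C2_gt0 : 0 < C2.
Proof.
rewrite mulr_gt0 ?powR_gt0 //; have := Cs_ge0; have := A1_ge0; first by lra.
by have : 0 <= d%:R :> R by []; lra.
Qed.
Let C6_gt0 : 0 < C6. Proof. by rewrite mulr_gt0 // mulr_gt0. Qed.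

Let dev_set L n u :=
  [set w | 2 * lam n * (mass n * Mx n) *
             point_sum mu (@word_point R d m u (L * n)) (@word_weight R d m u (L * n)) n w
           + Q * (y ^+ n / lam n)
           < `|point_sum mu (@word_point R d m u (L * n)) (@word_weight R d m u (L * n)) n.+1 w
             - point_sum mu (@word_point R d m u (L * n)) (@word_weight R d m u (L * n)) n w|].

Let lam_gt0 n : 0 < lam n.
Proof. by rewrite divr_gt0 ?exprn_gt0 // mulr_gt0. Qed.

Let lam_mass n : 2 * lam n * (mass n * Mx n) = y^-1 ^+ (2 * n).
Proof.
have yn0 : y ^+ n != 0 by rewrite gt_eqF // exprn_gt0.
have C60 : C6 != 0 by rewrite gt_eqF.
have -> : mass n * Mx n = C6 * (y^-1 ^+ n) ^+ 4.
  have -> : (y^-1 ^+ n) ^+ 4 = ((2 `^ s)^-1) ^+ n * A ^+ n.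
    rewrite -exprMn -Ay invfM mulrAC mulVf ?gt_eqF // mul1r -exprM mulnC exprM.
    by rewrite exprVn.
  by rewrite /mass /Mx /C6; ring.
rewrite /lam mulnC !exprM exprVn; field.
by rewrite yn0 C60.
Qed.

Let measurable_dev_set L n u : measurable (dev_set L n u).
Proof.
have mS k : measurable_fun setT (point_sum mu (@word_point R d m u (L * n))
    (@word_weight R d m u (L * n)) k) by exact: (measurable_point_sum SI).
apply: measurable_ltr_set.
  by apply: measurable_funD => //; apply: measurable_funM.
by apply: measurableT_comp => //; apply: measurable_funB.
Qed.

Let dev_set_le L n u : b ^+ L <= 1 / 2 -> Gam u ->
  fine (P (dev_set L n u)) <= 2 * Q * expR (1 - y ^+ n).
Proof.
move=> bL Gu; have [mub _ _] := mu_reg.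
apply: (martingale_tail SI) => //.
- by move=> v; apply: word_weight_ge0; exact: Gprob.
- by rewrite mulr_ge0 ?(ltW C2_gt0) // exprn_ge0 // invr_ge0 powR_ge0.
- by move=> k; apply: (frostman_level b_gt0 b_lt1 A1_ge0 Gcon Gcod Gprob Geta
    Cs_ge0 g_gt0 g_lts frost).
- move=> k w x kn nk; apply: le_trans (mub k w x) _.
  rewrite /Mx -mulrA ler_wpM2l ?(ltW C1_gt0) //.
  have [->|->] : k = n \/ k = n.+1.
    move: nk; rewrite leq_eqVlt => /orP[/eqP->|nk]; first by left.
    by right; apply/eqP; rewrite eqn_leq kn nk.
  + by rewrite ler_peMl // exprn_ge0 // ltW.
  + by rewrite exprS ler_wpM2r ?exprn_ge0 ?(ltW A_gt0) // le_max lexx orbT.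
- by rewrite ltW // truncnS_gt.
- have : 2 * (lam n * (mass n * Mx n)) <= 1.
    rewrite mulrA lam_mass exprn_ile1 ?invr_ge0 ?(ltW y_gt0) //.
    by rewrite invf_le1 // ltW.
  by lra.
- by rewrite !mulr_ge0 ?exprn_ge0 ?(ltW A_gt0) ?(ltW C1_gt0) ?(ltW mA_gt0).
Qed.

Let word_sum_ge0 u N n w : Gam u -> 0 <= word_sum u N (mu n w).
Proof.
move=> Gu; apply: sumr_ge0 => v _; rewrite mulr_ge0 ?(SI_ge0 SI) //.
by apply: word_weight_ge0; exact: Gprob.
Qed.

(** The errors y^(-2n) S and 2 C6 Q y^(-n) both fit under a multiple of y^(-n) (1 + S), the form
    that Gronwall requires. *)
Let dev_setC L n u w : Gam u -> ~ dev_set L n u w ->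
  `|word_sum u (L * n) (mu n.+1 w) - word_sum u (L * n) (mu n w)| <=
  (1 + 2 * C6 * Q) * y^-1 ^+ n * (1 + word_sum u (L * n) (mu n w)).
Proof.
move=> Gu /negP; rewrite -leNgt lam_mass => h; apply: le_trans h _.
rewrite -/(word_sum u (L * n) (mu n w)).
set S := word_sum _ _ _; have S0 : 0 <= S by exact: word_sum_ge0.
have yn0 : 0 <= y^-1 ^+ n by rewrite exprn_ge0 // invr_ge0 ltW.
have yn1 : y^-1 ^+ n <= 1.
  by rewrite exprn_ile1 ?invr_ge0 ?(ltW y_gt0) // invf_le1 // ltW.
have -> : y ^+ n / lam n = 2 * C6 * y^-1 ^+ n.
  rewrite /lam mulnC exprM exprVn; field.
  by rewrite !gt_eqF ?exprn_gt0.
have Q0 : 0 <= Q by [].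
have c0 : 0 <= 2 * C6 * Q by rewrite mulr_ge0 // mulr_ge0 // ltW.
have h1 : y^-1 ^+ (2 * n) * S <= y^-1 ^+ n * S.
  by rewrite ler_wpM2r // mulnC exprM expr2 ler_piMl.
have h2 : 0 <= 2 * C6 * Q * y^-1 ^+ n * S by rewrite mulr_ge0 // mulr_ge0.
have -> : (1 + 2 * C6 * Q) * y^-1 ^+ n * (1 + S) =
  y^-1 ^+ n + y^-1 ^+ n * S + 2 * C6 * Q * y^-1 ^+ n + 2 * C6 * Q * y^-1 ^+ n * S by ring.
have -> : Q * (2 * C6 * y^-1 ^+ n) = 2 * C6 * Q * y^-1 ^+ n by ring.
apply: ler_wpDr => //; apply: lerD => //.
exact: ler_wpDl yn0 h1.
Qed.

Let bad L (net : nat -> nat * (nat -> param R d m.+1)) n :=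
  \bigcup_(i < (net n).1) dev_set L n ((net n).2 i).

Let bad_null L net D Cn : b ^+ L <= 1 / 2 -> 0 <= Cn ->
  (forall n, [/\ (net n).1%:R <= (Cn / (b ^+ L) ^+ n) ^+ D, (forall i, Gam ((net n).2 i)) &
    forall t, Gam t -> exists2 i, (i < (net n).1)%N & pdist t ((net n).2 i) <= (b ^+ L) ^+ n]) ->
  {ae P, forall w, exists N, forall n, (N <= n)%N -> ~ bad L net n w}.
Proof.
move=> bL Cn0 netP; set beta := b ^+ L in netP *.
have be0 : 0 < beta by rewrite exprn_gt0.
(* The rate beta^D / 2 cancels the factor beta^(-D n) of the net cardinality and leaves (1/2)^n for
   Borel-Cantelli. *)
have rho0 : 0 < beta ^+ D / 2 by rewrite divr_gt0 // exprn_gt0.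
have [Ke [Ke0 hKe]] := expRN_exp_decay y_gt1 rho0.
have Q0 : 0 <= Q by [].
have K0 : 0 <= Cn ^+ D * (2 * Q * expR 1 * Ke).
  by rewrite mulr_ge0 ?exprn_ge0 // mulr_ge0 // mulr_ge0 ?expR_ge0 // mulr_ge0.
have mbad n : measurable (bad L net n).
  by apply: bigcup_measurable => i _; exact: measurable_dev_set.
apply: (borel_cantelli_geometric K0 mbad) => n.
have [net1 net2 _] := netP n.
have cov w : bad L net n w -> exists i : 'I_(net n).1, dev_set L n ((net n).2 i) w.
  by move=> [i /= ilt dw]; exists (Ordinal ilt).
apply: le_trans (@prob_union_le R dT T P 'I_(net n).1 _ _ (mbad n)
  (fun i => @measurable_dev_set L n ((net n).2 i)) cov) _.
apply: (@le_trans _ _ (\sum_(i < (net n).1) 2 * Q * expR (1 - y ^+ n))).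
  by apply: ler_sum => i _; apply: dev_set_le.
rewrite sumr_const card_ord -[leLHS]mulr_natl.
have e0 : 0 <= 2 * Q * expR (1 - y ^+ n) by rewrite mulr_ge0 ?expR_ge0 // mulr_ge0.
apply: le_trans (ler_wpM2r e0 net1) _; rewrite expRD.
have bn0 : beta ^+ n != 0 by rewrite gt_eqF // exprn_gt0.
have -> : Cn ^+ D * (2 * Q * expR 1 * Ke) * (1 / 2) ^+ n =
    (Cn / beta ^+ n) ^+ D * (2 * Q * (expR 1 * (Ke * (beta ^+ D / 2) ^+ n))).
  have -> : (beta ^+ D / 2) ^+ n = (beta ^+ n) ^+ D * (1 / 2) ^+ n.
    by rewrite mul1r exprMn -exprM mulnC exprM.
  rewrite [(Cn / _) ^+ D]expr_div_n; field.
  by rewrite expf_neq0.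
rewrite ler_wpM2l ?exprn_ge0 ?divr_ge0 ?exprn_ge0 ?(ltW be0) //.
by rewrite ler_wpM2l ?mulr_ge0 // ler_wpM2l ?expR_ge0.
Qed.

Let integral_bounds n w t : Gam t ->
  0 <= fine (\int[eta t]_x (mu n w x)%:E) <= C1 * A ^+ n.
Proof.
move=> Gt; have [mub mmu _] := mu_reg.
have [dS [S [bet [xi [hcyl heta]]]]] := Geta Gt.
have eta1 : eta t setT = 1%E by exact: eta_setT heta.
have I0 : (0 <= \int[eta t]_x (mu n w x)%:E)%E.
  by apply: integral_ge0 => x _; rewrite lee_fin (SI_ge0 SI).
have Ile : (\int[eta t]_x (mu n w x)%:E <= (C1 * A ^+ n)%:E)%E.
  apply: (@le_trans _ _ (\int[eta t]_x (cst (C1 * A ^+ n)%:E x))%E).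
    apply: ge0_le_integral => //.
    - by move=> x _; rewrite lee_fin (SI_ge0 SI).
    - by apply/measurable_EFinP; exact: mmu.
    - by move=> x _; rewrite lee_fin.
  by rewrite integral_cst // eta1 mule1.
have Ifin : (\int[eta t]_x (mu n w x)%:E)%E \is a fin_num.
  by rewrite ge0_fin_numE //; apply: le_lt_trans Ile _; rewrite ltry.
by rewrite fine_ge0 //= -lee_fin fineK.
Qed.

Lemma uniform_holder t0 : Gam t0 ->
  exists gamma : R, 0 < gamma /\
  exists K : T -> R, measurable_fun setT K /\
  {ae P, forall w,
     exists Y : param R d m.+1 -> R,
       (forall e, 0 < e -> exists N, forall n, (N <= n)%N -> forall t, Gam t ->
          `|fine (\int[eta t]_x (mu n w x)%:E) - Y t| < e) /\
       (forall t u, Gam t -> Gam u ->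
          `|Y t - Y u| <= K w * pdist t u `^ gamma)}.
Proof.
move=> G0; have [mub mmu aevar] := mu_reg.
have [L [hL1 hL2 hL3]] := @exists_scale R b s gamma1 b_gt0 b_lt1 g_lts A kappa.
have [C5 [N1 [C50 cmp]]] := compare_geometric b_gt0 b_lt1 A1_ge0 Gcon Gcod Gprob Geta
  Cs_ge0 Cc_ge0 frost cover A_gt0 (ltW C1_gt0) C3_ge0 kappa_ge1 hL1 hL2 hL3.
set beta := b ^+ L in hL2 hL3 cmp.
have be0 : 0 < beta by rewrite exprn_gt0.
have be1 : beta < 1 by apply: le_lt_trans hL1 _; lra.
have Gw t i : Gam t -> `|t.2 i| <= 1 by move=> Gt; exact: prob_weights_le1 (Gprob Gt).
have [Cn [D [Cn1 hnet]]] := parameter_net b_ge0 b_lt1 A1_ge0 Gsim Gcod Gw.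
have Cn0 : 0 <= Cn by exact: le_trans ler01 Cn1.
have /choice[net netP] : forall n, exists p : nat * (nat -> param R d m.+1),
    [/\ p.1%:R <= (Cn / beta ^+ n) ^+ D, (forall i, Gam (p.2 i)) &
     forall t, Gam t -> exists2 i, (i < p.1)%N & pdist t (p.2 i) <= beta ^+ n].
  move=> n; apply: (total_net G0); apply: hnet; first by rewrite exprn_gt0.
  by rewrite exprn_ile1 // ltW.
have bc := bad_null hL1 Cn0 netP.
pose delta := y^-1; pose x := Num.max (1 / 2) delta.
have delta0 : 0 <= delta by rewrite invr_ge0 ltW.
have delta1 : delta < 1 by rewrite invf_lt1.
have [x0 x1 xh xd xle] := rate_bounds delta0 delta1; rewrite -/x in x0 x1 xh xd xle.
(* The exponent with beta^gam = x, which turns the scale beta^n into the convergence rate x^n. *)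
pose gam := ln x / ln beta.
have lnb : ln beta < 0 by rewrite ln_lt0 // be0.
have gam0 : 0 < gam.
  by rewrite /gam -mulrNN -invrN divr_gt0 // oppr_gt0 // ln_lt0 // x0.
have bx : beta `^ gam = x.
  by rewrite /powR (gt_eqF be0) /gam divfK ?lt_eqF // lnK.
pose r (p : nat * nat) := (net p.1).2 p.2.
have Gr p : Gam (r p) by have [_ h _] := netP p.1; exact: h.
pose W n (t : param R d m.+1) w := word_sum t (L * n) (mu n w).
have mW n t : measurable_fun setT (W n t).
  exact: (@measurable_point_sum R d dT T P B mu C SI
     {ffun 'I_(L * n) -> 'I_m.+1} (@word_point R d m t (L * n))
     (@word_weight R d m t (L * n)) n).
have [K mK hK] := @measurable_holder_constant R dT T _ (@pdist R d m.+1) W r gam mW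
  (@pdist_ge0 R d m.+1).
(* For beta^n <= d(t, u), two uses of [pdist_triangle] put the net points near t and u within 2
   (beta^n + 2 (d + beta^n)) <= 10 d of each other. *)
exists gam; split => //; exists (fun w => 10 `^ gam * K w); split.
  exact: measurable_funM.
apply: filterS2 aevar bc => w [N3 hN3] [N2 hN2].
pose N0 := maxn N1 (maxn N2 N3).
have N01 n : (N0 <= n)%N -> (N1 <= n)%N by apply: leq_trans; exact: leq_maxl.
have N02 n : (N0 <= n)%N -> (N2 <= n)%N.
  by apply: leq_trans; rewrite leq_max leq_maxl orbT.
have N03 n : (N0 <= n)%N -> (N3 <= n)%N.
  by apply: leq_trans; rewrite leq_max leq_maxr orbT.
(* [integral_bounds] speaks of [Gam] only; the value 0 elsewhere makes Y nonnegative at every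
   index. *)
pose Y n t := if pselect (Gam t) then fine (\int[eta t]_x (mu n w x)%:E) else 0.
have YE n t : Gam t -> Y n t = fine (\int[eta t]_x (mu n w x)%:E).
  by rewrite /Y; case: pselect.
pose SS n k (t : param R d m.+1) := word_sum t (L * n) (mu k w).
pose nets n u := exists2 i, (i < (net n).1)%N & u = (net n).2 i.
have hYS n k t u : (N0 <= n)%N -> (n <= k <= n.+1)%N -> Gam t -> Gam u ->
    pdist t u <= beta ^+ n -> `|Y k t - SS n k u| <= C5 * (1 / 2) ^+ n.
  move=> Nn nk Gt Gu tu; rewrite YE //.
  apply: (cmp n k t u (mu k w) (N01 n Nn) nk Gt Gu tu (mmu k w)).
    by move=> z; rewrite (SI_ge0 SI) mub.
  by apply: hN3; apply: leq_trans (N03 _ Nn) _; case/andP: nk.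
have netsG n u : nets n u -> Gam u.
  by move=> [i _ ->]; have [_ h _] := netP n; exact: h.
have netsP n t : Gam t -> exists2 u, nets n u & pdist t u <= beta ^+ n.
  move=> Gt; have [_ _ h] := netP n; have [i ilt hi] := h t Gt.
  by exists ((net n).2 i) => //; exists i.
have hSS n u : (N0 <= n)%N -> nets n u ->
    `|SS n n.+1 u - SS n n u| <= (1 + 2 * C6 * Q) * delta ^+ n * (1 + SS n n u).
  move=> Nn nu; apply: dev_setC; first exact: netsG nu.
  have [i ilt ->] := nu => dw; apply: (hN2 n (N02 _ Nn)).
  by exists i.
have Y0 n t : 0 <= Y n t.
  by rewrite /Y; case: pselect => // Gt; have /andP[] := integral_bounds n w Gt.
have Yle n t : Gam t -> Y n t <= C1 * A ^+ n.
  by move=> Gt; rewrite YE //; have /andP[] := integral_bounds n w Gt.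
have C80 : 0 <= 1 + 2 * C6 * Q.
  by rewrite addr_ge0 // mulr_ge0 // mulr_ge0 // ltW.
have [Z [Kc [M [Kc0 YZ ZM ZZ]]]] := pathwise_limit C50 C80 delta0 delta1
  (@pdist_xx R d m) be0 hYS netsG netsP hSS Y0 Yle.
rewrite -/x in YZ ZZ.
have KZ0 : 0 <= 2 * Kc + 2 * C5 by rewrite addr_ge0 // mulr_ge0.
have [K' K'0 hol] := holder_of_geometric (ltW x0) x1 be0 be1 gam0 bx KZ0
  (@pdist_ge0 R d m.+1) ZM ZZ.
(* Word sums are finite sums of measurable functions of w, so [K] is built from them; their limits
   are those of the integrals. *)
have WZ i : W n (r i) w @[n --> \oo] --> Z (r i).
  apply/cvgrPdist_lt => e e0.
  have [N4 hN4] := geometric_small (Kc + C5) (ltW x0) x1 e0.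
  exists (maxn N0 N4) => // n /= Nn.
  have Nn0 : (N0 <= n)%N by apply: leq_trans Nn; exact: leq_maxl.
  apply: le_lt_trans (hN4 n (leq_trans (leq_maxr _ _) Nn)).
  apply: le_trans (ler_distD (Y n (r i)) _ _) _; rewrite mulrDl; apply: lerD.
    by rewrite distrC; exact: YZ.
  apply: le_trans (hYS n n (r i) (r i) Nn0 _ (Gr i) (Gr i) _) _.
  - by rewrite leqnn leqnSn.
  - by rewrite pdist_xx exprn_ge0 // ltW.
  - by rewrite ler_wpM2l.
have [Kw0 hKw] := hK w Z K' K'0 WZ (fun i j => hol _ _ (Gr i) (Gr j)).
exists Z; split.
  move=> e e0; have [N4 hN4] := geometric_small Kc (ltW x0) x1 e0.
  exists (maxn N0 N4) => n Nn t Gt; rewrite -YE //.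
  apply: le_lt_trans (hN4 n (leq_trans (leq_maxr _ _) Nn)).
  by apply: YZ => //; apply: leq_trans Nn; exact: leq_maxl.
move=> t u Gt Gu.
have bound_ge0 : 0 <= 10 `^ gam * K w * pdist t u `^ gam.
  by rewrite mulr_ge0 ?powR_ge0 // mulr_ge0 ?powR_ge0.
have [dz|dn] := eqVneq (pdist t u) 0.
  by have := hol t u Gt Gu; rewrite dz powR0 ?gt_eqF // mulr0 => h; rewrite mulr0.
have dpos : 0 < pdist t u by rewrite lt_def dn pdist_ge0.
(* The constant [K'] was obtained for this w alone. It serves only to replace t and u by net points
   at an error e / 2 each; the constant that survives is the measurable one in [hKw]. *)
apply/ler_addgt0Pr => e e0.
have [N4 hN4] := geometric_small 1 (ltW be0) be1 dpos.
have e20 : 0 < e / 2 by rewrite divr_gt0.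
have [N5 hN5] := geometric_small K' (ltW x0) x1 e20.
pose n := maxn N4 N5.
have bnd : beta ^+ n <= pdist t u.
  by have := hN4 n (leq_maxl _ _); rewrite mul1r => /ltW.
have Kxn : K' * x ^+ n < e / 2 by exact: hN5 n (leq_maxr _ _).
have [_ _ hn] := netP n.
have [i ilt ti] := hn t Gt; have [j jlt uj] := hn u Gu.
have near_net v k : Gam v -> pdist v (r (n, k)) <= beta ^+ n ->
    `|Z v - Z (r (n, k))| <= e / 2.
  move=> Gv vk; apply: le_trans (hol _ _ Gv (Gr _)) _.
  apply: le_trans (ltW Kxn); rewrite ler_wpM2l // -bx -powRX ?(ltW be0) //.
  by apply: ge0_ler_powR vk; rewrite ?nnegrE ?pdist_ge0 ?exprn_ge0 ?(ltW gam0) // ltW.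
have bcod v : Gam v -> exists A, coding_bound A v.1.
  by move=> Gv; exists A1; exact: Gcod.
have d10 : pdist (r (n, i)) (r (n, j)) <= 10 * pdist t u.
  have h1 := pdist_triangle (bcod _ (Gr (n, i))) (bcod _ Gt) (bcod _ (Gr (n, j))).
  have h2 := pdist_triangle (bcod _ Gt) (bcod _ Gu) (bcod _ (Gr (n, j))).
  have ti' : pdist (r (n, i)) t <= beta ^+ n by rewrite pdistC.
  have uj' : pdist u (r (n, j)) <= beta ^+ n by [].
  have aux (p1 p2 p3 p4 p5 p6 : R) : p1 <= 2 * (p2 + p3) -> p3 <= 2 * (p4 + p5) ->
    p2 <= p6 -> p5 <= p6 -> p6 <= p4 -> p1 <= 10 * p4 by lra.
  exact: aux h1 h2 ti' uj' bnd.
have key : `|Z (r (n, i)) - Z (r (n, j))| <= 10 `^ gam * K w * pdist t u `^ gam.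
  apply: le_trans (hKw (n, i) (n, j)) _.
  have -> : 10 `^ gam * K w * pdist t u `^ gam = K w * (10 * pdist t u) `^ gam.
    by rewrite powRM ?pdist_ge0 //; ring.
  rewrite ler_wpM2l //; apply: ge0_ler_powR d10.
  - exact: ltW.
  - by rewrite nnegrE pdist_ge0.
  - by rewrite nnegrE mulr_ge0 // pdist_ge0.
have -> : Z t - Z u = (Z t - Z (r (n, i))) + (Z (r (n, i)) - Z (r (n, j)))
   - (Z u - Z (r (n, j))) by ring.
have h1 := near_net t i Gt ti; have h2 := near_net u j Gu uj.
apply: le_trans (ler_normB _ _) _.
have -> : 10 `^ gam * K w * pdist t u `^ gam + e =
  (e / 2 + 10 `^ gam * K w * pdist t u `^ gam) + e / 2 by field.
apply: lerD h2; apply: le_trans (ler_normD _ _) _; exact: lerD h1 key.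
Qed.

End UniformHolder.

Theorem theorem9p1 (R : realType) (d m : nat)
  (dT : measure_display) (T : measurableType dT) (P : probability T R)
  (B : nat -> set (set T)) (mu : nat -> T -> 'rV[R]_d -> R)
  (Fam : set (set 'rV[R]_d)) (alpha tau zeta C : R)
  (Gam : set (param R d m))
  (eta : param R d m -> {measure set (Rd R d) -> \bar R})
  (s gamma1 : R) :
  0 < C ->
  borel_family_in_ball Fam ->
  SI_martingale P B mu C ->
  (cell_type P mu Fam tau zeta C /\
     (forall n w x, mu n w x <= C * 2 `^ (alpha * n%:R)))
  \/ cutout_type P mu Fam alpha zeta C ->
  (* Gamma: bounded set of pairs (F,p) in (Sim_d^c)^m x P_m, with contraction
     ratios uniformly bounded away from 0 and 1 *)
  (exists a b : R, [/\ 0 < a, b < 1 &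
     forall t, Gam t -> forall i, exists r, [/\ a <= r, r <= b & is_sim r (t.1 i)]]) ->
  (forall t, Gam t -> (forall i, 0 < t.2 i) /\ \sum_i t.2 i = 1) ->
  (exists D : R, forall t u, Gam t -> Gam u -> pdist t u <= D) ->
  (forall t, Gam t -> selfsim_measure t (eta t)) ->
  alpha < s ->
  (exists Cs : R, forall (x : 'rV[R]_d) t r, Gam t -> 0 < r -> r < 1 ->
     (eta t (eball x r) <= (Cs * r `^ s)%:E)%E) ->
  0 < gamma1 -> gamma1 < s ->
  (exists Cc : R, forall eps, 0 < eps -> eps < 1 -> forall t, Gam t ->
     forall L, Fam L ->
       exists cs : seq 'rV[R]_d,
         (size cs)%:R <= Cc * eps `^ (- gamma1) /\
         nbhd_eps (boundary L) eps `&` attractor t.1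
           `<=` [set x | exists2 c, c \in cs & eball c eps x]) ->
  exists gamma : R, 0 < gamma /\
  exists K : T -> R, measurable_fun setT K /\
  {ae P, forall w,
     exists Y : param R d m -> R,
       (forall e, 0 < e -> exists N, forall n, (N <= n)%N -> forall t, Gam t ->
          `|fine (\int[eta t]_x (mu n w x)%:E) - Y t| < e) /\
       (forall t u, Gam t -> Gam u ->
          `|Y t - Y u| <= K w * pdist t u `^ gamma)}.
Proof.
move=> C_gt0 [c0 [r0 FamB]] SI muT [a [b0 [a_gt0 b0_lt1 Gsim0]]] Gw [D GD] Geta als
  [Cs0 frost0] g_gt0 g_lts [Cc0 cover0].
have [[t0 G0]|noG] := pselect (exists t, Gam t); last first.
  exists 1; split => //; exists (fun=> 0); split => //.
  apply: aeW => w; exists (fun=> 0); split => [e e0|t u Gt].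
    by exists 0%N => n _ t Gt; case: noG; exists t.
  by case: noG; exists t.
(* With no maps the weights would sum to 0 instead of 1. *)
case: m => [|m'] in Gam eta Gsim0 Gw GD Geta frost0 cover0 t0 G0 *.
  have [_] := Gw t0 G0; rewrite big_ord0 => /eqP.
  by rewrite eq_sym oner_eq0.
pose b := Num.max (1 / 2) b0.
have b_gt0 : 0 < b by rewrite lt_max; apply/orP; left; lra.
have b_lt1 : b < 1 by rewrite gt_max b0_lt1 andbT; lra.
have Gsim t : Gam t -> forall i, exists2 r, r <= b & is_sim r (t.1 i).
  move=> Gt i; have [r [_ rb sr]] := Gsim0 t Gt i.
  by exists r => //; rewrite le_max rb orbT.
have Gcon t (Gt : Gam t) : contractions b t.1 := Gam_contractions Gsim Gt.
have bcod t (Gt : Gam t) := coding_boundP (ltW b_gt0) b_lt1 (Gcon t Gt).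
have [A0 hA0] := bcod t0 G0.
(* Boundedness of Gamma enters here: every coding lies within D of the corresponding coding of
   t0. *)
pose A1 := `|A0| + `|D|.
have A1_ge0 : 0 <= A1 by rewrite addr_ge0.
have Gcod t : Gam t -> coding_bound A1 t.1.
  move=> Gt w; have := pdist_coding w (bcod t Gt) (bcod t0 G0).
  move=> /le_trans /(_ (GD t t0 Gt G0)) h.
  rewrite -[coding t.1 w](subrK (coding t0.1 w)) addrC.
  apply: le_trans (eucl_triangle _ _) _; apply: lerD.
    exact: le_trans (hA0 w) (ler_norm _).
  exact: le_trans h (ler_norm _).
have frost x t r : Gam t -> 0 < r -> r < 1 ->
    (eta t (eball x r) <= (`|Cs0| * r `^ s)%:E)%E.
  move=> Gt h0 h1; apply: le_trans (frost0 x t r Gt h0 h1) _.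
  by rewrite lee_fin ler_wpM2r ?powR_ge0 // ler_norm.
have cover eps : 0 < eps -> eps < 1 -> forall t, Gam t -> forall L, Fam L ->
    exists cs : seq 'rV[R]_d, (size cs)%:R <= `|Cc0| * eps `^ (- gamma1) /\
    nbhd_eps (boundary L) eps `&` attractor t.1
      `<=` [set x | exists2 c, c \in cs & eball c eps x].
  move=> e0 e1 t Gt L FL; have [cs [szcs sub]] := cover0 eps e0 e1 t Gt L FL.
  exists cs; split => //; apply: le_trans szcs _.
  by rewrite ler_wpM2r ?powR_ge0 // ler_norm.
have mFam L : Fam L -> measurable (L : set (Rd R d)) by move=> /FamB[].
have [C1 [C3 [kappa [C1_gt0 C3_ge0 kappa_ge1 reg]]]] :
    exists C1 C3 kappa : R, [/\ 0 < C1, 0 <= C3, 1 <= kappa &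
      regular_steps P mu Fam C1 (2 `^ alpha) C3 kappa].
  case: muT => [[cell mub]|cut].
    have [kappa [k1 reg]] := cell_regular mFam C_gt0 cell mub.
    by exists C, (C * C), kappa; split => //; rewrite mulr_ge0 // ltW.
  have [kappa [k1 reg]] := cutout_regular mFam C_gt0 cut.
  by exists 1, (C + 1), kappa; split => //; rewrite addr_ge0 // ltW.
(* The gap alpha < s becomes y = 2^((s - alpha) / 4) > 1, so that 2^alpha y^4 = 2^s. *)
have e0 : 0 < (s - alpha) / 4 by rewrite divr_gt0 // subr_gt0.
have y_gt1 : 1 < 2 `^ ((s - alpha) / 4) :> R.
  have := @gt0_ltr_powR R _ e0 1 2; rewrite !nnegrE powR1; apply => //.
  by rewrite ltr1n.
have Ay : 2 `^ alpha * (2 `^ ((s - alpha) / 4)) ^+ 4 = 2 `^ s :> R.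
  rewrite -powR_mulr_nat // divfK // -powRD ?implybT //.
    by congr (_ `^ _); ring.
  by apply/implyP.
exact: (uniform_holder SI b_gt0 b_lt1 A1_ge0 Gsim Gcod Gw Geta (normr_ge0 Cs0)
  (normr_ge0 Cc0) g_gt0 g_lts frost cover (powR_gt0 alpha (@ltr0Sn R 1)) C1_gt0 C3_ge0
  kappa_ge1 reg y_gt1 Ay G0).
Qed.
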